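(* For all $n\in\mathbb{N}$ and all $C\in\mathcal{C}^n$ there exists a map $\tau_C:N_2(\mathcal{G}^n\times\mathcal{Z})\to\mathbb{Z}/4\mathbb{Z}$ such that the twisted algebra $\left(OH^n_C\otimes_{\mathbb{Z}}\mathbb{Z}[i]\right)_{\tau_C}$ is associative.
   Context: Matchings. $B^n$ is the set of crossingless matchings of $2n$ points on a horizontal line by non-crossing arcs placed below the line. For $b\in B^n$, $W(b)$ is the reflection of $b$ across the line, and $W(b)a$ is the gluing of $W(b)$ on top of $a$, a disjoint union of circles; $|W(b)a|$ is the number of circles. $W(c)bW(b)a$ denotes the disjoint union of $W(c)b$ placed on top of $W(b)a$. Odd arc algebra. For a disjoint union $S$ of circles, $V(S)$ is the free abelian group on the components of $S$, each of degree $2$, and $OF(S)=\bigwedge^*V(S)\{-|S|\}$, where $\{m\}$ shifts the degree up by $m$. Put $b(OH^n)a:=OF(W(b)a)\{n\}$ and $OH^n=\bigoplus_{a,b\in B^n}b(OH^n)a$. For $a,b,c\in B^n$, a choice $C_{cba}$ is a cobordism $W(c)bW(b)a\to W(c)a$ obtained by contracting, by one saddle each, every arc of $b$ with its mirror image in $W(b)$ (replacing the two arcs by two vertical strands), together with (i) an order in which these $n$ saddles are performed, no arc being contracted before an arc surrounding it, and (ii) for each saddle that splits a circle into two, an orientation, i.e. an ordering $b_1\to b_2$ of the two resulting circles. $\mathcal{C}^n$ is the set of all choices $C=\{C_{cba}\mid a,b,c\in B^n\}$. $OF(C_{cba}):OF(W(c)bW(b)a)\to OF(W(c)a)$ is the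 composite of the maps of the saddles: a merge of $a_1,a_2$ acts by the map of exterior algebras identifying $a_1$ with $a_2$; a split of $a$ into $b_1\to b_2$ replaces each occurrence of $a$ by $b_1$ and then multiplies on the left by $(b_1-b_2)\wedge$. The product of $x\in c(OH^n)b$ and $y\in b(OH^n)a$ is $xy:=OF(C_{cba})(x\wedge y)\in c(OH^n)a$; the product $d(OH^n)c\otimes b(OH^n)a\to OH^n$ is zero if $c\neq b$. $OH^n_C$ is $OH^n$ with this (nonassociative) multiplication. Grading. $\mathcal{G}^n$ is the groupoid with object set $B^n$ and exactly one morphism $a\to b$ for all $a,b$, denoted $W(b)a$, with $W(c)b\circ W(b)a=W(c)a$. $\mathcal{Z}$ is the group $\mathbb{Z}$ viewed as a one-object category. $OH^n_C$ is graded by $\mathcal{G}^n\times\mathcal{Z}$: a homogeneous $x\in b(OH^n)a$ of degree $k$ has degree $|x|=(W(b)a,k)$. $N_2(\mathcal{G})$ is the set of pairs of composable morphisms of $\mathcal{G}$. Twist. $\mathbb{Z}[i]$ is the ring of Gaussian integers, and $\mathbb{Z}[i]^*=\{1,i,-1,-i\}\simeq\mathbb{Z}/4\mathbb{Z}$. The twisted algebra $(OH^n_C\otimes\mathbb{Z}[i])_{\tau}$ has the same underlying graded module with product $x*_\tau y:=i^{\tau(|x|,|y|)}xy$ for homogeneous $x,y$ of composable degrees (and zero for non-composable degrees). *)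

(* Defs.v *)
From HB Require Import structures.
From mathcomp Require Import all_boot all_order all_algebra all_field.

Set Implicit Arguments.
Unset Strict Implicit.
Unset Printing Implicit Defensive.

Import Order.TTheory GRing.Theory Num.Theory.
Local Open Scope ring_scope.

Definition gauss_pred : {pred algC} :=
  [pred x | ('Re x \in Num.int) && ('Im x \in Num.int)].

Fact gauss_subring : subring_closed gauss_pred.
Proof.
split=> [|x y /andP[xr xi] /andP[yr yi]|x y /andP[xr xi] /andP[yr yi]].
- by rewrite inE (Creal_ReP _ _) ?(Creal_ImP _ _) ?rpred1 ?rpred0.
- by rewrite inE !raddfB /= !rpredB.
- by rewrite inE ReM ImM rpredB ?rpredD // rpredM.
Qed.

HB.instance Definition _ :=
  GRing.isSubringClosed.Build algC gauss_pred gauss_subring.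

(* The ring Z[i], as a subring of the algebraic complex numbers. *)
Record gaussInt := GaussInt { gauss_val : algC; _ : gauss_val \in gauss_pred }.
HB.instance Definition _ := [isSub for gauss_val].
HB.instance Definition _ := [Choice of gaussInt by <:].
HB.instance Definition _ := [SubChoice_isSubComNzRing of gaussInt by <:].

Fact gauss_i_subproof : ('i : algC) \in gauss_pred.
Proof. by rewrite inE Re_i Im_i rpred0 rpred1. Qed.

Definition gauss_i : gaussInt := GaussInt gauss_i_subproof.

(* The exterior algebra of the free abelian group on T.  The basis element
   indexed by A = {t_1 < ... < t_k} stands for t_1 /\ ... /\ t_k, where T is
   ordered by enum_rank, i.e. in the order in which enum lists it. *)
Definition ext (T : finType) := {ffun {set T} -> int}.

Definition ext1 (T : finType) : ext T := [ffun A => (A == set0)%:R].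

Definition gen (T : finType) (t : T) : ext T := [ffun A => (A == [set t])%:R].

(* The sign of the permutation sorting the concatenation of the increasing
   enumerations of two disjoint sets A and B. *)
Definition shuffle_sign (T : finType) (A B : {set T}) : int :=
  (-1) ^+ #|[set p in setX A B | (enum_rank p.2 < enum_rank p.1)%N]|.

Definition wedge (T : finType) (x y : ext T) : ext T :=
  [ffun U : {set T} => \sum_(A : {set T} | A \subset U)
               shuffle_sign A (U :\: A) * (x A * y (U :\: A))].

(* The morphism of exterior algebras that sends each generator t to f t. *)
Definition ext_map (T T' : finType) (f : T -> T') (x : ext T) : ext T' :=
  \sum_(A : {set T})
     (\big[@wedge T'/ext1 T']_(t <- enum A) gen (f t)) *~ x A.

(* The graph with an edge between x and f x, and between x and g x, for all x.
   If f and g are fixed-point free involutions, i.e. perfect matchings of P by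
   arcs, it is the 1-manifold obtained by gluing these arcs along P, and its
   connected components are the circles of the gluing. *)
Definition glue (P : finType) (f g : P -> P) : rel P :=
  [rel x y | [|| y == f x, x == f y, y == g x | x == g y]].

Fact glue_sym (P : finType) (f g : P -> P) : connect_sym (glue f g).
Proof.
apply: sym_connect_sym => x y.
by apply/idP/idP => /or4P[] /eqP h; rewrite /glue /= -h eqxx ?orbT.
Qed.

(* A connected component is represented by its canonical root. *)
Definition circle (P : finType) (f g : P -> P) : finType :=
  {x : P | fingraph.roots (glue f g) x}.

Definition circ (P : finType) (f g : P -> P) (x : P) : circle f g :=
  exist _ (fingraph.root (glue f g) x) (roots_root (@glue_sym P f g) x).

Definition crossingless (n : nat) (b : {ffun 'I_(n.*2) -> 'I_(n.*2)}) : bool :=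
  [forall i, (b (b i) == i) && (b i != i)] &&
  [forall i : 'I_(n.*2), forall j : 'I_(n.*2),
     ~~ [&& (i < j)%N, (j < b i)%N & (b i < b j)%N]].

(* B^n: a matching sends each of the 2n points to the other end of its arc. *)
Record matching (n : nat) := Matching
  { arc :> {ffun 'I_(n.*2) -> 'I_(n.*2)}; _ : crossingless arc }.
HB.instance Definition _ n := [isSub for @arc n].
HB.instance Definition _ n := [Finite of matching n by <:].

(* The circles of W(b)a. *)
Definition W (n : nat) (b a : matching n) : finType := circle b a.

(* An arc is represented by its left end. *)
Definition left_end (n : nat) (b : matching n) (i : 'I_(n.*2)) : bool :=
  (i < b i)%N.

Definition surrounds (n : nat) (b : matching n) (i j : 'I_(n.*2)) : bool :=
  [&& (i < j)%N, left_end b j & (b j < b i)%N].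

(* The data C_cba.  If the saddle at the arc with left end i splits a circle,
   one of the two resulting circles contains the vertical strand at i and the
   other one the vertical strand at b i: cob_orient i is true when the splitting
   is oriented from the former to the latter.  The value of cob_orient is not
   used at the saddles that merge two circles. *)
Record cob_choice (n : nat) (b : matching n) := CobChoice {
  cob_order : seq 'I_(n.*2);
  cob_orient : 'I_(n.*2) -> bool;
  cob_order_arcs : perm_eq cob_order (enum (left_end b));
  cob_order_surrounds : forall i j : 'I_(n.*2),
    left_end b i -> left_end b j -> surrounds b i j ->
    (index i cob_order < index j cob_order)%N }.

(* C^n *)
Definition choices (n : nat) := forall c b a : matching n, cob_choice b.

(* W(c)bW(b)a, in which the arcs of b with left end in the list s have been
   contracted with their mirror images.  The points of the upper line (between
   W(c) and b) are the (true, i), those of the lower line (between W(b) and a)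
   are the (false, i). *)
Definition outer (n : nat) (c a : matching n) (p : bool * 'I_(n.*2)) :=
  (p.1, if p.1 then c p.2 else a p.2).

Definition inner (n : nat) (b : matching n) (s : seq 'I_(n.*2))
    (p : bool * 'I_(n.*2)) :=
  if (p.2 \in s) || (b p.2 \in s) then (~~ p.1, p.2) else (p.1, b p.2).

Definition stage (n : nat) (c b a : matching n) (s : seq 'I_(n.*2)) : finType :=
  circle (outer c a) (inner b s).

Definition stage_circ (n : nat) (c b a : matching n) (s : seq 'I_(n.*2))
    (p : bool * 'I_(n.*2)) : stage c b a s :=
  circ (outer c a) (inner b s) p.

(* The map of the saddle contracting the arc with left end i, after those with
   left end in s.  It is a splitting exactly when the arc and its mirror image
   lie on the same circle. *)
Definition saddle (n : nat) (c b a : matching n) (o : 'I_(n.*2) -> bool)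
    (s : seq 'I_(n.*2)) (i : 'I_(n.*2)) (x : ext (stage c b a s)) :
    ext (stage c b a (i :: s)) :=
  let new := @stage_circ n c b a (i :: s) in
  let old := @stage_circ n c b a s in
  if old (true, i) == old (false, i) then
    let b1 := new (true, if o i then i else b i) in
    let b2 := new (true, if o i then b i else i) in
    wedge (gen b1 - gen b2)
          (ext_map (fun u => if u == old (true, i) then b1 else new (val u)) x)
  else ext_map (fun u => new (val u)) x.

(* The composite of the saddles at the arcs of the list t, in this order, after
   those of s.  When no arc is left, the circles are identified with those of
   W(c)a by collapsing the vertical strands. *)
Fixpoint saddles (n : nat) (c b a : matching n) (o : 'I_(n.*2) -> bool)
    (t s : seq 'I_(n.*2)) {struct t} : ext (stage c b a s) -> ext (W c a) :=
  match t with
  | [::] => ext_map (fun u => circ c a (val u).2)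
  | i :: t' => fun x => saddles o t' (saddle o i x)
  end.

(* OF(C_cba) *)
Definition OFcob (n : nat) (c b a : matching n) (C : cob_choice b) :
    ext (stage c b a [::]) -> ext (W c a) :=
  fun x => saddles (cob_orient C) (cob_order C) x.

(* The element x /\ y of OF(W(c)bW(b)a) *)
Definition stack (n : nat) (c b a : matching n)
    (x : ext (W c b)) (y : ext (W b a)) : ext (stage c b a [::]) :=
  wedge (ext_map (fun u => stage_circ c b a [::] (true, val u)) x)
        (ext_map (fun u => stage_circ c b a [::] (false, val u)) y).

(* OH^n is the free abelian group on the triples (b, a, A), where A is a set of
   circles of W(b)a and stands for a basis element of b(OH^n)a. *)
Definition OHbasis (n : nat) : finType :=
  {p : matching n * matching n & {set W p.1 p.2}}.

Definition OHelt (n : nat) (b a : matching n) (A : {set W b a}) : OHbasis n :=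
  Tagged (fun p : matching n * matching n => {set W p.1 p.2})
         (A : {set W (b, a).1 (b, a).2}).

Definition OH (n : nat) := {ffun OHbasis n -> int}.

Definition OHblock (n : nat) (b a : matching n) (x : OH n) : ext (W b a) :=
  [ffun A => x (OHelt A)].

(* The product of OH^n_C *)
Definition OHmul (n : nat) (C : choices n) (x y : OH n) : OH n :=
  [ffun K : OHbasis n =>
     let c := (tag K).1 in let a := (tag K).2 in
     \sum_(b : matching n)
        OFcob (C c b a) (stack (OHblock c b x) (OHblock b a y)) (tagged K)].

(* The morphisms of G^n x Z: ((b, a), k) is the morphism (W(b)a, k) from a
   to b. *)
Definition mor (n : nat) : Type := ((matching n * matching n) * int)%type.
Definition mor_tgt (n : nat) (f : mor n) : matching n := f.1.1.
Definition mor_src (n : nat) (f : mor n) : matching n := f.1.2.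

(* Pairs (f, g) such that the composite of g followed by f exists. *)
Definition N2 (n : nat) :=
  {p : mor n * mor n | mor_src p.1 == mor_tgt p.2}.

(* A product of k circles of W(b)a has degree 2k - |W(b)a| + n. *)
Definition OHdeg (n : nat) (I : OHbasis n) : mor n :=
  (tag I,
   (#|tagged I|.*2)%:Z - (#|W (tag I).1 (tag I).2|)%:Z + n%:Z).

(* The extension of scalars of the free abelian group OH^n to Z[i] *)
Definition OHgauss (n : nat) := {ffun OHbasis n -> gaussInt}.

Definition basis_elt (R : pzRingType) (I : finType) (i : I) : {ffun I -> R} :=
  [ffun j => (j == i)%:R].

(* The Z[i]-bilinear extension of the product of OH^n_C *)
Definition OHgauss_mul (n : nat) (C : choices n) (x y : OHgauss n) : OHgauss n :=
  [ffun K => \sum_(I : OHbasis n) \sum_(J : OHbasis n)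
     x I * y J * (OHmul C (basis_elt int I) (basis_elt int J) K)%:~R].

(* The twisted product, extended bilinearly from the homogeneous basis; the
   value of tau is lifted to 0, 1, 2 or 3 in the exponent of i. *)
Definition twisted_mul (n : nat) (C : choices n) (tau : N2 n -> 'Z_4)
    (x y : OHgauss n) : OHgauss n :=
  [ffun K => \sum_(I : OHbasis n) \sum_(J : OHbasis n)
     x I * y J *
     (if insub (OHdeg I, OHdeg J) : option (N2 n) is Some p then
        gauss_i ^+ tau p *
        OHgauss_mul C (basis_elt gaussInt I) (basis_elt gaussInt J) K
      else 0)].

(* Main.v *)
Require Import Defs.
From HB Require Import structures.
From mathcomp Require Import all_boot all_order all_algebra all_field all_fingroup.
From mathcomp Require Import ring zify.

Set Implicit Arguments.
Unset Strict Implicit.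
Unset Printing Implicit Defensive.

Import Order.TTheory GRing.Theory Num.Theory.
Local Open Scope ring_scope.

                          

(** Lift the elements of the blocks to the exterior algebra on the 2n points of the line. The
    product of x in block (c, b) and y in block (b, a) becomes the projection to the circles of
    W(c)a of [D_cba * x * y], where D_cba is the ordered product of the differences of end points
    over the splitting saddles ([OFcobE]). Up to signs of graded commutation, associativity compares
    D_dcb D_dba with D_cba D_dca in the exterior algebra on the circles of W(d)a. They agree up to a
    sign which is a coboundary, apart from a term in the numbers of splits and certain dimensions;
    so the whole associator can be absorbed into a twist with values 0 and 2.

    All coefficients of products of such differences are 0, 1 or -1, by the unimodularity of
    incidence matrices of graphs ([prod_edge_coef]), so the signs can be compared over F_3
    ([ext_trit_lift]), where every nonzero scalar squares to 1. There the points become a basis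
    [theta] of the sum of U = F_3^n and its dual, in which the arcs of a matching a span L_a, the
    sum of X_a and of the annihilator of X_a ([L_arcs]); X_a records the black regions of a
    checkerboard colouring. The circles of W(d)a give the quotient by L_d + L_a, and D_cba is, up to
    sign, a wedge of vectors spanning L_b modulo L_c + L_a ([edges_frame]).

    Such a wedge has a canonical normalisation. A [frame] is a spanning list built from bases of
    intersections of X_c, X_b and X_a; multiplied by the volumes of these bases, its wedge is
    independent of all choices ([frame_unique]). So D_cba is h(c, b, a) times a canonical element,
    for some sign h, and the canonical elements remain to be compared ([frames_quadruple]). If X_d
    and X_b, or X_c and X_a, meet in more than the sum of the two triple intersections inside, both
    products vanish. Otherwise one basis adapted to all four spaces yields four frames, the two
    products consist of the same vectors in another order, and the sign is explicit.

    Finally, the number of splits is the coboundary of [mu] ([size_edges_mu]), and the exponent h +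
    C(s, 2) + (k + mu) l, with s the number of splits and k, l the exterior degrees, corrects every
    sign ([assoc_parity], [bmul_assoc]). *)

(** * Shuffle signs and the exterior algebra over a commutative ring *)

Section Inversions.
Variable T : finType.
Implicit Types A B C : {set T}.

Definition inv A B : nat :=
  #|[set p in setX A B | (enum_rank p.2 < enum_rank p.1)%N]|.

Lemma invE A B :
  inv A B = (\sum_(a in A) \sum_(b in B) (enum_rank b < enum_rank a))%N.
Proof.
rewrite pair_big /= /inv -sum1_card [RHS]big_mkcond [LHS]big_mkcond.
apply: eq_bigr => -[a b] _ /=; rewrite !inE /=.
by case: (a \in A); case: (b \in B).
Qed.

Lemma inv_setUl A B C :
  [disjoint A & B] -> inv (A :|: B) C = (inv A C + inv B C)%N.
Proof. move=> dAB; rewrite !invE -bigU //.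
by apply: eq_bigl => t; rewrite !inE. Qed.

Lemma inv_setUr A B C :
  [disjoint B & C] -> inv A (B :|: C) = (inv A B + inv A C)%N.
Proof.
move=> dBC; rewrite !invE -big_split /=; apply: eq_bigr => a _.
rewrite -bigU //; by apply: eq_bigl => t; rewrite !inE.
Qed.

Lemma inv0l A : inv set0 A = 0%N.
Proof. by rewrite invE big_set0. Qed.

Lemma inv0r A : inv A set0 = 0%N.
Proof. by rewrite invE big1 // => a _; rewrite big_set0. Qed.

Lemma inv_sym A B : [disjoint A & B] -> (inv A B + inv B A = #|A| * #|B|)%N.
Proof.
move=> dAB; rewrite !invE [X in (_ + X)%N]exchange_big /= -big_split /=.
rewrite -sum_nat_const; apply: eq_bigr => a aA; rewrite -big_split /=.
rewrite -[RHS]sum1_card; apply: eq_bigr => b bB.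
have: enum_rank a != enum_rank b.
  by rewrite (inj_eq enum_rank_inj); apply: contraTneq bB => <-;
     rewrite (disjointFr dAB aA).
by rewrite -(inj_eq val_inj) neq_ltn /= => /orP[] h;
   rewrite h ltnNge (ltnW h).
Qed.

End Inversions.

                                                                                
(** Coefficients are general because signs will be compared over ['F_3]; for [R = int] the product
    below is [wedge] on [ext]. *)
Definition extr (R : comNzRingType) (T : finType) : Type := {ffun {set T} -> R}.

Section ExteriorRing.
Variables (R : comNzRingType) (T : finType).
Local Notation E := (extr R T).

HB.instance Definition _ := GRing.Lmodule.copy E {ffun {set T} -> R^o}.

Implicit Types (x y z : E) (U A B : {set T}).

Definition emul x y : E :=
  [ffun U : {set T} => \sum_(A : {set T} | A \subset U)
     (-1) ^+ inv A (U :\: A) * (x A * y (U :\: A))].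

Definition eone : E := [ffun A => (A == set0)%:R].

(** Both bracketings sum over the splittings of U into three parts, with a sign counting the
    inversions between the three pairs of parts, since [inv] is additive over disjoint unions. *)
Lemma emulA : associative emul.
Proof.
move=> x y z; apply/ffunP => U; rewrite !ffunE.
under [RHS]eq_bigr => A sAU do rewrite ffunE mulr_suml mulr_sumr.
rewrite [RHS](exchange_big_dep (fun B => B \subset U)) /=; last first.
  by move=> A B sAU sBA; apply: subset_trans sAU.
apply: eq_bigr => B sBU; rewrite ffunE !mulr_sumr.
rewrite [RHS](reindex_onto (fun C => B :|: C) (fun A => A :\: B)) /=; last first.
  by move=> A /andP[sAU sBA]; rewrite setDE setUIr setUCr setIT; apply/setUidPr.
apply: eq_big => [C|C].
  rewrite subsetD subUset sBU subsetUl /= andbT setDUl setDv set0U.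
  by congr (_ && _); apply: (sameP setDidPl eqP).
rewrite subsetD => /andP[sCU dCB].
have dBC : [disjoint B & C] by rewrite disjoint_sym.
have -> : U :\: B :\: C = U :\: (B :|: C) by rewrite setDDl.
have -> : (B :|: C) :\: B = C.
  by rewrite setDUl setDv set0U; apply/setDidPl.
set W := U :\: (B :|: C).
have dCW : [disjoint C & W].
  rewrite disjoint_sym disjoints_subset; apply/subsetP => t.
  by rewrite !inE negb_or => /andP[/andP[]].
have -> : U :\: B = C :|: W.
  apply/setP => t; rewrite !inE; have := subsetP sCU t.
  have := disjointFr dBC (x := t).
  case: (t \in B); case: (t \in C); case: (t \in U) => //=.
  - by move=> /(_ isT).
  - by move=> /(_ isT).
  - by move=> _ /(_ isT).
rewrite inv_setUr // inv_setUl // !exprD.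
ring.
Qed.

Lemma emul1l : left_id eone emul.
Proof.
move=> x; apply/ffunP => U; rewrite ffunE (bigD1 set0) ?sub0set //= big1.
  by rewrite inv0l setD0 ffunE eqxx !mul1r addr0.
by move=> A /andP[_ /negPf A0]; rewrite ffunE A0 mul0r mulr0.
Qed.

Lemma emul1r : right_id eone emul.
Proof.
move=> x; apply/ffunP => U; rewrite ffunE (bigD1 U) //= big1.
  by rewrite setDv inv0r ffunE eqxx mulr1 mul1r addr0.
move=> A /andP[sAU nAU]; rewrite [eone _]ffunE setD_eq0.
have /negPf-> : ~~ (U \subset A).
  by apply: contra nAU => sUA; rewrite eqEsubset sAU.
by rewrite !mulr0.
Qed.

Lemma emulDl : left_distributive emul +%R.
Proof.
move=> x y z; apply/ffunP => U; rewrite !ffunE -big_split /=.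
by apply: eq_bigr => A _; rewrite ffunE mulrDl mulrDr.
Qed.

Lemma emulDr : right_distributive emul +%R.
Proof.
move=> x y z; apply/ffunP => U; rewrite !ffunE -big_split /=.
by apply: eq_bigr => A _; rewrite ffunE mulrDr mulrDr.
Qed.

Lemma eone_neq0 : eone != 0.
Proof.
by apply/eqP => /ffunP/(_ set0); rewrite !ffunE eqxx => /eqP; rewrite oner_eq0.
Qed.

HB.instance Definition _ :=
  GRing.Zmodule_isNzRing.Build E emulA emul1l emul1r emulDl emulDr eone_neq0.

Lemma escaleAl (a : R) x y : a *: (x * y) = a *: x * y.
Proof.
apply/ffunP => U; rewrite !ffunE scaler_sumr; apply: eq_bigr => A _.
by rewrite ffunE /GRing.scale /=; ring.
Qed.

HB.instance Definition _ := GRing.Lmodule_isLalgebra.Build R E escaleAl.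

Lemma escaleAr (a : R) x y : a *: (x * y) = x * (a *: y).
Proof.
apply/ffunP => U; rewrite !ffunE scaler_sumr; apply: eq_bigr => A _.
by rewrite ffunE /GRing.scale /=; ring.
Qed.

HB.instance Definition _ := GRing.Lalgebra_isAlgebra.Build R E escaleAr.

End ExteriorRing.

(** * Products of anticommuting square-zero elements and the universal property *)

Definition rank_lt (T : finType) : rel T :=
  fun x y => (enum_rank x < enum_rank y)%N.

Lemma rank_lt_trans (T : finType) : transitive (@rank_lt T).
Proof. by move=> y x z; apply: ltn_trans. Qed.

Lemma sorted_enum_rank (T : finType) (B : {pred T}) : sorted (@rank_lt T) (enum B).
Proof.
rewrite /enum_mem -enumT; apply: sorted_filter; first exact: rank_lt_trans.
case: (pickP (pred_of_simpl (@predT T))) => [x0 _|T0]; last first.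
  by rewrite (_ : enum T = [::]) //; case: (enum T) => // x; move: (T0 x).
apply/(sortedP x0) => i; rewrite -cardE => ltiT.
have nthK j (lt_j : (j < #|T|)%N) : enum_rank (nth x0 (enum T) j) = Ordinal lt_j.
  by rewrite -[j]/(val (Ordinal lt_j)) -enum_val_nth enum_valK.
by rewrite /rank_lt (nthK _ ltiT) (nthK _ (ltnW ltiT)).
Qed.

Section AnticommutingSequences.
Variables (R : comNzRingType) (A : algType R) (T : eqType) (g : T -> A).
Hypothesis gg : forall t, g t * g t = 0.
Hypothesis gC : forall t u, g t * g u = - (g u * g t).

Lemma mul_gprod_seq t (s : seq T) :
  g t * \prod_(u <- s) g u = (-1) ^+ size s *: ((\prod_(u <- s) g u) * g t).
Proof.
elim: s => [|u s IH]; first by rewrite big_nil scale1r mul1r mulr1.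
rewrite !big_cons /= exprS mulN1r scaleNr -mulrA scalerAr -IH.
by rewrite mulrA gC mulNr mulrA.
Qed.

Lemma mul_gprod_mem t (s : seq T) : t \in s -> g t * \prod_(u <- s) g u = 0.
Proof.
elim: s => // u s IH; rewrite in_cons big_cons mulrA.
case: eqP => [->|_] /= ts; first by rewrite gg mul0r.
by rewrite gC mulNr -mulrA IH // mulr0 oppr0.
Qed.
End AnticommutingSequences.

Section AnticommutingProducts.
Variables (R : comNzRingType) (A : algType R) (T : finType) (g : T -> A).
Hypothesis gg : forall t, g t * g t = 0.
Hypothesis gC : forall t u, g t * g u = - (g u * g t).

Definition gprod (B : {set T}) : A := \prod_(t <- enum B) g t.

Lemma gprod0 : gprod set0 = 1.
Proof. by rewrite /gprod enum_set0 big_nil. Qed.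

(** Moving [g t] to its sorted place passes exactly the elements of B below t, and these are what
    [inv [set t] B] counts. *)
Lemma mul_gprod t (B : {set T}) :
  g t * gprod B =
  if t \in B then 0 else (-1) ^+ inv [set t] B *: gprod (t |: B).
Proof.
case: ifP => [tB|/negbT tB]; first by rewrite (mul_gprod_mem gg gC) // mem_enum.
pose lo := [seq u <- enum B | rank_lt u t].
pose hi := [seq u <- enum B | rank_lt t u].
have trt := @rank_lt_trans T.
have irr : irreflexive (@rank_lt T) by move=> u; apply: ltnn.
have sB := sorted_enum_rank (mem B).
have tot u : u \in B -> rank_lt u t = ~~ rank_lt t u.
  move=> uB; rewrite /rank_lt -leqNgt ltn_neqAle.
  case: eqP => //= /val_inj/enum_rank_inj eut.
  by rewrite -eut uB in tB.
have memF (P : pred T) u : (u \in [seq v <- enum B | P v]) = P u && (u \in B).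
  by rewrite mem_filter mem_enum.
have slo : sorted (@rank_lt T) lo by apply: sorted_filter.
have shi : sorted (@rank_lt T) hi by apply: sorted_filter.
have path_cat s1 s2 : sorted (@rank_lt T) s1 -> sorted (@rank_lt T) s2 ->
    {in s1 & s2, forall u v, rank_lt u v} -> sorted (@rank_lt T) (s1 ++ s2).
  rewrite !(sorted_pairwise trt) pairwise_cat => -> -> /= h.
  by rewrite !andbT; apply/allrelP.
have lohi : {in lo & hi, forall u v, rank_lt u v}.
  move=> u v; rewrite !memF => /andP[ut _] /andP[tv _].
  exact: trt tv.
have -> : gprod B = \prod_(u <- lo ++ hi) g u.
  rewrite /gprod; congr (\big[_/_]_(u <- _) _).
  apply: (irr_sorted_eq trt irr) => //; first exact: path_cat.
  move=> u; rewrite mem_cat !memF -andb_orl mem_enum.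
  by case uB: (u \in B); rewrite ?andbF // tot // orNb.
have -> : gprod (t |: B) = \prod_(u <- lo ++ t :: hi) g u.
  rewrite /gprod; congr (\big[_/_]_(u <- _) _).
  apply: (irr_sorted_eq trt irr); first exact: sorted_enum_rank.
    apply: path_cat => // [|u v ulo].
      rewrite /= path_min_sorted //; apply/allP => v.
      by rewrite memF => /andP[].
    rewrite inE => /predU1P[->|vhi]; last exact: lohi.
    by move: ulo; rewrite memF => /andP[].
  move=> u; rewrite mem_enum !inE mem_cat inE !memF orbCA -andb_orl.
  case uB: (u \in B); rewrite ?andbF ?andbT //.
  by rewrite tot // orNb.
rewrite !big_cat /= big_cons !mulrA (mul_gprod_seq gC) -scalerAl.
congr (_ ^+ _ *: _); rewrite invE big_set1 size_filter.
rewrite -sum1_count big_mkcond -[RHS]big_enum /=.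
by apply: eq_bigr => u _; rewrite /rank_lt; case: (_ < _)%N.
Qed.

End AnticommutingProducts.

Section Generators.
Variables (R : comNzRingType) (T : finType).
Local Notation E := (extr R T).

Definition ebasis (B : {set T}) : E := [ffun A => (A == B)%:R].
Definition egen (t : T) : E := ebasis [set t].

Lemma ebasisE (x : E) : x = \sum_(B : {set T}) x B *: ebasis B.
Proof.
apply/ffunP => B; rewrite sum_ffunE (bigD1 B) //= big1 => [|C /negPf CB].
  by rewrite !ffunE eqxx /GRing.scale /= mulr1 addr0.
by rewrite !ffunE eq_sym CB /GRing.scale /= mulr0.
Qed.

Lemma ebasis0 : ebasis set0 = 1.
Proof. by []. Qed.

Lemma ebasisM (B C : {set T}) : ebasis B * ebasis C =
  if [disjoint B & C] then (-1) ^+ inv B C *: ebasis (B :|: C) else 0.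
Proof.
apply/ffunP => U; rewrite ffunE.
have [dBC|ndBC] := boolP [disjoint B & C]; last first.
  rewrite ffunE big1 // => A sAU; rewrite !ffunE.
  have [eAB|] := eqVneq A B; last by rewrite mul0r mulr0.
  have [eUC|] := eqVneq (U :\: A) C; last by rewrite !mulr0.
  case/negP: ndBC; rewrite -eAB -eUC disjoint_sym disjoints_subset.
  by apply/subsetP => t; rewrite !inE => /andP[].
rewrite !ffunE.
have [->|nU] := eqVneq U (B :|: C).
  rewrite (bigD1 B) ?subsetUl //= big1 => [|A /andP[_ /negPf AB]].
    have -> : (B :|: C) :\: B = C.
      by rewrite setDUl setDv set0U; apply/setDidPl; rewrite disjoint_sym.
    by rewrite !ffunE !eqxx mulr1 addr0.
  by rewrite !ffunE AB mul0r mulr0.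
rewrite scaler0 big1 // => A sAU; rewrite !ffunE.
have [eAB|] := eqVneq A B; last by rewrite mul0r mulr0.
have [eUC|] := eqVneq (U :\: A) C; last by rewrite !mulr0.
case/negP: nU; apply/eqP; rewrite -eUC -eAB.
by apply/setP => t; rewrite !inE; have := subsetP sAU t;
   case: (t \in A) => // ->.
Qed.

Lemma egen_sqr t : egen t * egen t = 0.
Proof. by rewrite ebasisM disjoints1 set11. Qed.

Lemma egenC t u : egen t * egen u = - (egen u * egen t).
Proof.
have [->|ntu] := eqVneq t u; first by rewrite egen_sqr oppr0.
rewrite !ebasisM !disjoints1 !in_set1 ntu eq_sym ntu setUC -scaleNr.
congr (_ *: _); rewrite -[RHS]mulN1r -exprS -[LHS]signr_odd -[RHS]signr_odd.
congr (_ ^+ nat_of_bool _).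
have := inv_sym (A := [set t]) (B := [set u]).
rewrite disjoints1 in_set1 ntu !cards1 => /(_ isT) /(congr1 odd).
by rewrite oddD /=; case: (odd (inv [set t] _)); case: (odd (inv _ _)).
Qed.

Lemma ebasis_gprod (B : {set T}) : ebasis B = gprod egen B.
Proof.
have [k] := ubnP #|B|; elim: k B => // k IH B.
have [->|[t tB]] := set_0Vmem B; first by rewrite gprod0 ebasis0.
rewrite (cardsD1 t) tB ltnS => /IH eB.
have := mul_gprod egen_sqr egenC t (B :\ t).
rewrite -eB ebasisM disjoints1 !inE eqxx /= setD1K //.
move=> /(congr1 (fun x => (-1) ^+ inv [set t] (B :\ t) *: x)).
by rewrite !scalerA -expr2 sqrr_sign !scale1r.
Qed.

End Generators.

Section UniversalProperty.
Variables (R : comNzRingType) (T : finType) (A : algType R) (g : T -> A).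
Hypothesis gg : forall t, g t * g t = 0.
Hypothesis gC : forall t u, g t * g u = - (g u * g t).
Local Notation E := (extr R T).

Definition elift (x : E) : A := \sum_(B : {set T}) x B *: gprod g B.

Fact elift_is_linear : linear elift.
Proof.
move=> a x y; rewrite /elift scaler_sumr -big_split /=.
by apply: eq_bigr => B _; rewrite !ffunE scalerDl scalerA.
Qed.
HB.instance Definition _ := GRing.isLinear.Build R E A *:%R elift elift_is_linear.

Lemma elift_basis B : elift (ebasis R B) = gprod g B.
Proof.
rewrite /elift (bigD1 B) //= big1 => [|C /negPf CB].
  by rewrite ffunE eqxx scale1r addr0.
by rewrite ffunE CB scale0r.
Qed.

Lemma elift_gen t : elift (egen R t) = g t.
Proof. by rewrite elift_basis /gprod enum_set1 big_seq1. Qed.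

Lemma elift1 : elift 1 = 1.
Proof. by rewrite -ebasis0 elift_basis gprod0. Qed.

Lemma elift_genM t x : elift (egen R t * x) = g t * elift x.
Proof.
rewrite [x]ebasisE mulr_sumr !raddf_sum /= mulr_sumr; apply: eq_bigr => B _.
rewrite -!scalerAr !linearZ /= -scalerAr; congr (_ *: _).
rewrite elift_basis (mul_gprod gg gC) ebasisM disjoints1.
by case: (t \in B) => /=; rewrite ?linear0 // linearZ /= elift_basis.
Qed.

Lemma eliftM x y : elift (x * y) = elift x * elift y.
Proof.
rewrite [x]ebasisE mulr_suml !raddf_sum /= mulr_suml; apply: eq_bigr => B _.
rewrite -!scalerAl !linearZ /= -scalerAl; congr (_ *: _).
rewrite elift_basis ebasis_gprod /gprod.
elim: (enum B) => [|t s IH]; first by rewrite !big_nil !mul1r.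
by rewrite !big_cons -!mulrA elift_genM IH.
Qed.

End UniversalProperty.

(** * Functoriality, grading and change of coefficients *)

Section Functoriality.
Variable R : comNzRingType.

Lemma linear_eq_basis (T : finType) (M : lmodType R)
    (F G : {linear extr R T -> M}) :
  (forall B, F (ebasis R B) = G (ebasis R B)) -> F =1 G.
Proof.
move=> FG x; rewrite (ebasisE x) !raddf_sum /=; apply: eq_bigr => B _.
by rewrite !linearZ /= FG.
Qed.

Definition emap (T T' : finType) (f : T -> T') : extr R T -> extr R T' :=
  elift (fun t => egen R (f t)).

HB.instance Definition _ (T T' : finType) (f : T -> T') :=
  GRing.Linear.copy (emap f) (elift (fun t => egen R (f t))).

Lemma emap_gen (T T' : finType) (f : T -> T') t :
  emap f (egen R t) = egen R (f t).
Proof. exact: elift_gen. Qed.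

Lemma emap1 (T T' : finType) (f : T -> T') : emap f 1 = 1.
Proof. exact: elift1. Qed.

Lemma emapM (T T' : finType) (f : T -> T') (x y : extr R T) :
  emap f (x * y) = emap f x * emap f y.
Proof. by apply: eliftM => *; [exact: egen_sqr | exact: egenC]. Qed.

Lemma emap_prod (T T' : finType) (f : T -> T') I (s : seq I) (F : I -> extr R T) :
  emap f (\prod_(i <- s) F i) = \prod_(i <- s) emap f (F i).
Proof. by apply: (big_morph (emap f)) => [x y|]; rewrite ?emapM ?emap1. Qed.

Lemma emap_basis (T T' : finType) (f : T -> T') B :
  emap f (ebasis R B) = \prod_(t <- enum B) egen R (f t).
Proof. exact: elift_basis. Qed.

Lemma emap_comp (T T' T'' : finType) (f : T' -> T'') (h : T -> T') (x : extr R T) :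
  emap f (emap h x) = emap (f \o h) x.
Proof.
rewrite -[LHS]/((emap f \o emap h) x).
apply: linear_eq_basis => B /=; rewrite !emap_basis emap_prod.
by apply: eq_bigr => t _; rewrite emap_gen.
Qed.

Lemma eq_emap (T T' : finType) (f h : T -> T') : f =1 h -> emap f =1 emap h.
Proof.
move=> fh; apply: linear_eq_basis => B /=; rewrite !emap_basis.
by apply: eq_bigr => t _; rewrite fh.
Qed.

Lemma emap_id (T : finType) (x : extr R T) : emap id x = x.
Proof.
rewrite -[RHS]/(idfun x); apply: linear_eq_basis => B /=.
by rewrite emap_basis ebasis_gprod.
Qed.

Lemma egen_coef (T : finType) (t : T) (x : extr R T) (U : {set T}) :
  (egen R t * x) U =
  if t \in U then (-1) ^+ inv [set t] (U :\ t) * x (U :\ t) else 0.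
Proof.
rewrite ffunE; case: ifP => tU.
  rewrite (bigD1 [set t]) ?sub1set //= big1 => [|A /andP[_ /negPf At]].
    by rewrite ffunE eqxx mul1r addr0.
  by rewrite ffunE At mul0r mulr0.
rewrite big1 // => A sAU; rewrite ffunE; case: eqP => [eA|_].
  by rewrite eA sub1set tU in sAU.
by rewrite mul0r mulr0.
Qed.

Definition homog (T : finType) k (x : extr R T) :=
  forall A, x A != 0 -> #|A| = k.

Lemma homog_gen (T : finType) (t : T) : homog 1 (egen R t).
Proof. by move=> A; rewrite ffunE; have [->|_] := eqVneq A [set t]; rewrite ?cards1 ?eqxx. Qed.

Lemma homog_basis (T : finType) (B : {set T}) : homog #|B| (ebasis R B).
Proof. by move=> A; rewrite ffunE; have [->|_] := eqVneq A B; rewrite ?eqxx. Qed.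

Lemma homogD (T : finType) k (x y : extr R T) :
  homog k x -> homog k y -> homog k (x + y).
Proof.
move=> hx hy A; rewrite ffunE; have [xA|/hx //] := eqVneq (x A) 0.
by rewrite xA add0r => /hy.
Qed.

Lemma homogZ (T : finType) k a (x : extr R T) : homog k x -> homog k (a *: x).
Proof.
move=> hx A; rewrite ffunE; have [xA|/hx //] := eqVneq (x A) 0.
by rewrite xA scaler0 eqxx.
Qed.

Lemma homogB (T : finType) k (x y : extr R T) :
  homog k x -> homog k y -> homog k (x - y).
Proof.
by move=> hx hy; apply: homogD => //; rewrite -scaleN1r; apply: homogZ.
Qed.

Lemma homog0 (T : finType) k : homog k (0 : extr R T).
Proof. by move=> A; rewrite ffunE eqxx. Qed.

Lemma homog_sum (T : finType) k I (s : seq I) (P : pred I) (F : I -> extr R T) :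
  (forall i, P i -> homog k (F i)) -> homog k (\sum_(i <- s | P i) F i).
Proof. by move=> hF; apply: big_ind => //; [exact: homog0 | exact: homogD]. Qed.

Lemma homogM (T : finType) k l (x y : extr R T) :
  homog k x -> homog l y -> homog (k + l) (x * y).
Proof.
move=> hx hy U; rewrite ffunE => xyU.
have [A] : exists A : {set T}, (A \subset U) && (x A * y (U :\: A) != 0).
  apply/existsP; apply: contraNT xyU; rewrite negb_exists => /forallP h.
  apply/eqP; rewrite big1 // => A sAU.
  by move: (h A); rewrite sAU negbK => /eqP->; rewrite mulr0.
case/andP=> sAU xyA.
have xA : x A != 0 by apply: contraNneq xyA => ->; rewrite mul0r.
have yA : y (U :\: A) != 0 by apply: contraNneq xyA => ->; rewrite mulr0.
by rewrite -(hx _ xA) -(hy _ yA) cardsDS // subnKC // subset_leq_card.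
Qed.

Lemma homog1 (T : finType) : homog 0 (1 : extr R T).
Proof. by rewrite -(cards0 T); apply: homog_basis. Qed.

Lemma homog_prod (T : finType) I (s : seq I) (F : I -> extr R T) :
  (forall i, homog 1 (F i)) -> homog (size s) (\prod_(i <- s) F i).
Proof.
move=> hF; elim: s => [|i s IH]; first by rewrite big_nil; exact: homog1.
by rewrite big_cons -[size _]/(1 + size s)%N; apply: homogM.
Qed.

Lemma homog_emap (T T' : finType) (f : T -> T') k (x : extr R T) :
  homog k x -> homog k (emap f x).
Proof.
move=> hx; rewrite (ebasisE x) raddf_sum /=; apply: homog_sum => B _.
rewrite linearZ /= emap_basis.
have [->|/hx <-] := eqVneq (x B) 0; first by rewrite scale0r; apply: homog0.
by rewrite cardE; apply/homogZ/homog_prod => t; apply: homog_gen.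
Qed.

(** Passing to the complement in U exchanges the factors, and by [inv_sym] the two shuffle signs
    differ by the product of the cardinals. *)
Lemma homogC (T : finType) k l (x y : extr R T) :
  homog k x -> homog l y -> y * x = (-1) ^+ (k * l) *: (x * y).
Proof.
move=> hx hy; apply/ffunP => U; rewrite !ffunE scaler_sumr.
rewrite (reindex_onto (fun A => U :\: A) (fun A => U :\: A)) /=; last first.
  by move=> A sAU; rewrite setDDr setDv set0U; apply/setIidPr.
apply: eq_big => [A|A /andP[_ /eqP sAU]].
  rewrite subsetDl setDDr setDv set0U /=.
  by apply/eqP/idP => [<-|sAU]; [exact: subsetIl | apply/setIidPr].
rewrite sAU /GRing.scale /=.
have [xA0|/hx <-] := eqVneq (x A) 0; first by rewrite xA0 !(mul0r, mulr0).
have [yA0|/hy <-] := eqVneq (y (U :\: A)) 0.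
  by rewrite yA0 !(mul0r, mulr0).
rewrite -inv_sym; last first.
  by rewrite disjoint_sym disjoints_subset; apply/subsetP => t; rewrite !inE => /andP[].
rewrite exprD -!mulrA [y _ * x _]mulrC !mulrA; congr (_ * _ * _).
by rewrite mulrAC -expr2 sqrr_sign mul1r.
Qed.

End Functoriality.

Lemma ext_mapE (T T' : finType) (f : T -> T') (x : ext T) :
  ext_map f x = emap f (x : extr int T).
Proof.
rewrite /ext_map /emap /elift; apply: eq_bigr => B _.
by rewrite -[x B in RHS]intz scaler_int.
Qed.

Lemma wedgeE (T : finType) (x y : ext T) :
  wedge x y = (x : extr int T) * (y : extr int T).
Proof. by []. Qed.

Section ChangeOfCoefficients.
Variables (R S : comNzRingType) (phi : {rmorphism R -> S}) (T : finType).

Definition ecoef (x : extr R T) : extr S T := [ffun A => phi (x A)].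

Fact ecoef_is_zmod_morphism : zmod_morphism ecoef.
Proof. by move=> x y; apply/ffunP => A; rewrite !ffunE rmorphB. Qed.
HB.instance Definition _ := GRing.isZmodMorphism.Build _ _ ecoef
  ecoef_is_zmod_morphism.

Fact ecoef_is_monoid_morphism : monoid_morphism ecoef.
Proof.
split=> [|x y]; apply/ffunP => A; rewrite !ffunE ?rmorph_nat // rmorph_sum.
apply: eq_bigr => B _; rewrite !rmorphM /= rmorph_sign.
by rewrite !ffunE.
Qed.
HB.instance Definition _ := GRing.isMonoidMorphism.Build _ _ ecoef
  ecoef_is_monoid_morphism.

Lemma ecoef_basis B : ecoef (ebasis R B) = ebasis S B.
Proof. by apply/ffunP => A; rewrite !ffunE rmorph_nat. Qed.

End ChangeOfCoefficients.

Lemma esubE (R : comNzRingType) (T : finType) (x y : extr R T) U :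
  (x - y) U = x U - y U.
Proof. by rewrite !ffunE. Qed.

                                                          
(** * Products of edge vectors of a graph have coefficients 0, 1 and -1 *)

Section Unimodularity.
Variable T : finType.
Local Notation E := (extr int T).
Local Notation edge v := (egen int v.1 - egen int v.2).

(** Contraction of the edge from p to q: D = p - q satisfies D D = 0, so D p = D q, and next to D
    the vertex q may be renamed p. *)
Lemma edge_merge (p q : T) (s : seq (T * T)) :
  let f := fun t => if t == q then p else t in
  (egen int p - egen int q) * \prod_(v <- s) edge v =
  (egen int p - egen int q) * \prod_(v <- s) edge (f v.1, f v.2).
Proof.
move=> f; set D := _ - _.
have DD : D * D = 0.
  by rewrite mulrBl !mulrBr !egen_sqr [egen _ q * _]egenC subr0 opprK sub0r addNr.
have DC t : D * egen int t = - (egen int t * D).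
  by rewrite mulrBl mulrBr ![_ * egen int t]egenC opprB opprK addrC.
have Df t : D * egen int (f t) = D * egen int t.
  rewrite /f; case: eqP => // ->; apply/eqP.
  by rewrite -subr_eq0 -mulrBr DD.
elim: s => [|v s IH]; first by rewrite !big_nil.
rewrite !big_cons /= !mulrA !mulrBr !Df -!mulrBr.
have Dv : D * edge v = - (edge v * D)
  by rewrite mulrBr !DC [edge v * D]mulrBl opprB opprK addrC.
have Dfv : D * edge (f v.1, f v.2) = - (edge v * D).
  by rewrite /= mulrBr !Df -mulrBr.
by rewrite Dv !mulNr -!mulrA IH.
Qed.

Lemma prod_edge_avoid (q : T) (s : seq (T * T)) (U : {set T}) :
  (forall v, v \in s -> v.1 != q /\ v.2 != q) -> q \in U ->
  (\prod_(v <- s) edge v) U = 0.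
Proof.
elim: s U => [|v s IH] U hs qU.
  rewrite big_nil -ebasis0 ffunE; case: eqP => // U0; move: qU.
  by rewrite U0 inE.
have [vq1 vq2] := hs v (mem_head _ _).
have hs' w : w \in s -> w.1 != q /\ w.2 != q.
  by move=> ws; apply: hs; rewrite inE ws orbT.
have gen0 t : t != q -> (egen int t * \prod_(w <- s) edge w) U = 0.
  move=> tq; rewrite egen_coef; case: ifP => // _.
  by rewrite IH ?mulr0 // !inE eq_sym tq.
by rewrite big_cons mulrBl esubE !gen0 // subr0.
Qed.

(** Contract the first edge (p, q). No remaining factor mentions q, so the coefficient at U comes
    from the term q alone if U contains q and from the term p alone otherwise; nothing adds up, and
    induction applies. *)
Lemma prod_edge_coef (s : seq (T * T)) (U : {set T}) :
  (`|(\prod_(v <- s) edge v) U| <= 1)%R.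
Proof.
have [k] := ubnP (size s); elim: k s U => // k IH [|v s] U.
  by move=> _; rewrite big_nil -ebasis0 ffunE; case: eqP.
rewrite big_cons /= ltnS => lts.
case: v => p q /=; have [->|npq] := eqVneq p q.
  by rewrite subrr mul0r ffunE normr0.
rewrite (edge_merge p q s) /=; set f := fun t => if t == q then p else t.
pose s' := [seq (f v.1, f v.2) | v <- s].
have -> : \prod_(v <- s) (egen int (f v.1) - egen int (f v.2)) =
          \prod_(v <- s') edge v by rewrite big_map.
have s'q (V : {set T}) : q \in V -> (\prod_(v <- s') edge v) V = 0.
  have fq t : f t != q by rewrite /f; case: (eqVneq t q).
  by apply: prod_edge_avoid => _ /mapP[v _ ->] /=; rewrite !fq.
have {}IH (V : {set T}) : `|(\prod_(v <- s') edge v) V| <= 1 by apply: IH; rewrite size_map.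
rewrite mulrBl esubE !egen_coef.
have [qU|qU] := boolP (q \in U).
  rewrite (s'q (U :\ p)) ?inE ?qU ?andbT 1?eq_sym // mulr0 if_same sub0r.
  by rewrite normrN normrM normrX normrN1 expr1n mul1r.
rewrite subr0; case: ifP => _; last by rewrite normr0.
by rewrite normrM normrX normrN1 expr1n mul1r.
Qed.
End Unimodularity.

                            

(** * Circles of a gluing and the effect of a saddle on them *)

Lemma connect_eq (P : finType) (S : Type) (e : rel P) (F : P -> S) :
  (forall p q, e p q -> F p = F q) -> forall p q, connect e p q -> F p = F q.
Proof.
move=> eF p q /connectP[s]; elim: s p => [|r s IH] p /=; first by move=> _ ->.
by case/andP=> /eF-> /IH.
Qed.

Section Circles.
Variables (P : finType) (f g : P -> P).
Implicit Types p q : P.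

Lemma circE p q : (circ f g p == circ f g q) = connect (glue f g) p q.
Proof. by rewrite -val_eqE /= root_connect //; apply: glue_sym. Qed.

Lemma circP p q : reflect (circ f g p = circ f g q) (connect (glue f g) p q).
Proof. by rewrite -circE; apply: eqP. Qed.

Lemma val_circ (u : circle f g) : circ f g (val u) = u.
Proof. by apply: val_inj; case: u => p /= /eqP. Qed.

Lemma glue_f p : connect (glue f g) p (f p).
Proof. by apply: connect1; rewrite /glue /= eqxx. Qed.

Lemma glue_g p : connect (glue f g) p (g p).
Proof. by apply: connect1; rewrite /glue /= eqxx !orbT. Qed.

Lemma circ_f p : circ f g (f p) = circ f g p.
Proof. by apply/esym/circP/glue_f. Qed.

Lemma circ_g p : circ f g (g p) = circ f g p.
Proof. by apply/esym/circP/glue_g. Qed.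

Lemma glue_ind (S : Type) (F : P -> S) :
  (forall p, F (f p) = F p) -> (forall p, F (g p) = F p) ->
  forall p q, connect (glue f g) p q -> F p = F q.
Proof.
move=> Ff Fg; apply: connect_eq => p q.
by case/or4P=> /eqP->; rewrite ?Ff ?Fg.
Qed.

Lemma circ_ind (S : Type) (F : P -> S) :
  (forall p, F (f p) = F p) -> (forall p, F (g p) = F p) ->
  forall p, F (val (circ f g p)) = F p.
Proof.
move=> Ff Fg p; apply: (glue_ind Ff Fg); apply/circP; exact: val_circ.
Qed.

End Circles.

Section Saddle.
Variables (P : finType) (f g g' : P -> P) (col : P -> bool) (x y : P).
Hypotheses (ff : involutive f) (gg : involutive g) (gg' : involutive g').
Hypotheses (col_f : forall p, col (f p) = ~~ col p).
Hypotheses (col_g : forall p, col (g p) = ~~ col p).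
Hypotheses (xy : x != y) (col_xy : col x = col y).
Hypotheses (g'x : g' x = g y) (g'y : g' y = g x).
Hypothesis g'E : forall p, p \notin [:: x; y; g x; g y] -> g' p = g p.

Lemma col_g' p : col (g' p) = ~~ col p.
Proof.
have [|/g'E->] := boolP (p \in [:: x; y; g x; g y]); last exact: col_g.
rewrite !inE => /or4P[]/eqP->; rewrite ?g'x ?g'y ?col_g ?col_xy //.
  by rewrite -g'y gg' negbK.
by rewrite -g'x gg' negbK col_xy.
Qed.

(** Circles alternate the two colours, so following h and then f on the points of one colour turns
    the circles into the cycles of a permutation; points of the other colour are fixed. *)
Let step (h : P -> P) p := if col p == col x then f (h p) else p.

Fact step_inj (h : P -> P) (hh : involutive h)
  (col_h : forall p, col (h p) = ~~ col p) : injective (step h).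
Proof.
move=> p q; rewrite /step.
case: eqP => cp; case: eqP => cq //.
- by move/(inv_inj ff)/(inv_inj hh).
- by move=> e; move: cq; rewrite -e col_f col_h negbK.
- by move=> e; move: cp; rewrite e col_f col_h negbK.
Qed.

Lemma mem_step_porbit (h : P -> P) (hh : involutive h)
    (col_h : forall p, col (h p) = ~~ col p) p q :
  col p = col x -> col q = col x ->
  (q \in porbit (perm (step_inj hh col_h)) p) = connect (glue f h) p q.
Proof.
move=> cp cq; set s := perm _.
pose c r := if col r == col x then r else f r.
have cpp : c p = p by rewrite /c cp eqxx.
have cqq : c q = q by rewrite /c cq eqxx.
apply/idP/idP.
  case/porbitP=> i ->; elim: i => [|i IH]; first by rewrite expg0 perm1.
  rewrite expgSr permM; apply: connect_trans IH _; rewrite permE /step.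
  case: ifP => // _; apply: connect_trans (glue_g f h _) (glue_f f h _).
have cs r : porbit s (s r) = porbit s r.
  by rewrite -[s r]/((s ^+ 1)%g r) porbit_perm.
move=> pq; rewrite -eq_porbit_mem -cpp -cqq eq_sym.
apply/eqP; move: p q pq {cp cq cpp cqq}.
apply: (glue_ind (F := fun r => porbit s (c r))) => r; rewrite /c.
- rewrite col_f; have [cr|ncr] := eqVneq (col r) (col x).
    by rewrite cr; case: (col x); rewrite /= ff.
  by move: ncr; case: (col r); case: (col x).
- rewrite col_h; have [cr|ncr] := eqVneq (col r) (col x).
    rewrite cr (_ : (~~ col x == col x) = false); last by case: (col x).
    by rewrite -(cs r) permE /step cr eqxx.
  have ch : ~~ col r == col x by move: ncr; case: (col r); case: (col x).
  by rewrite ch -(cs (h r)) permE /step col_h ch hh.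
Qed.

(** The saddle multiplies the permutation [step] by the transposition of x and y, which cuts a cycle
    containing both points and joins two cycles containing one each. This is where orientability, in
    the form of the colouring, enters. *)
Lemma connect_exchange : connect (glue f g) x y = ~~ connect (glue f g') x y.
Proof.
rewrite -(mem_step_porbit gg col_g) // -(mem_step_porbit gg' col_g') //.
set s := perm _; set s' := perm _.
have es' : s' = (tperm x y * s)%g.
  have sE r : s r = step g r by rewrite permE.
  have s'E r : s' r = step g' r by rewrite permE.
  apply/permP => p; rewrite permM sE s'E /step.
  have [->|] := eqVneq p x; first by rewrite tpermL g'x -col_xy !eqxx.
  have [->|] := eqVneq p y; first by rewrite tpermR g'y -col_xy !eqxx.
  move=> py px; rewrite tpermD 1?eq_sym //.
  case: eqP => // cp; rewrite g'E // !inE (negPf px) (negPf py) /=.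
  apply/norP; split; apply/eqP => ep; move: cp; rewrite ep col_g.
    by case: (col x).
  by rewrite -col_xy; case: (col x).
have es : s = (tperm x y * s')%g by rewrite es' mulgA tperm2 mul1g.
have := porbits_mul_tperm s' x y; have := porbits_mul_tperm s x y.
rewrite /= -es' -es xy /= ![y \in _]porbit_sym.
by case: (x \in _) => /=; case: (x \in _) => /=; lia.
Qed.

Hypothesis split : connect (glue f g) x y.
Local Notation old := (circ f g).
Local Notation new := (circ f g').

Let old_y : old y = old x.
Proof. exact/esym/circP. Qed.

Lemma split_coarser p q : new p = new q -> old p = old q.
Proof.
move/circP; apply: glue_ind => r; first exact: circ_f.
have [|/g'E->] := boolP (r \in [:: x; y; g x; g y]); last exact: circ_g.
rewrite !inE => /or4P[]/eqP->; rewrite ?g'x ?g'y ?circ_g ?old_y //.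
  by rewrite -g'y gg' old_y.
by rewrite -g'x gg'.
Qed.

Lemma split_circle p : old p = old x -> new p = new x \/ new p = new (g x).
Proof.
pose F r := (new r == new x) || (new r == new (g x)).
suff FE r : old r = old x -> F r = F x.
  by move/FE; rewrite /F eqxx => /orP[]/eqP; [left | right].
move/circP; apply: glue_ind => {}r; first by rewrite /F circ_f.
have [|/g'E<-] := boolP (r \in [:: x; y; g x; g y]); last by rewrite /F circ_g.
have new_gy : new (g y) = new x by rewrite -g'x circ_g.
have new_y : new y = new (g x) by rewrite -g'y circ_g.
by rewrite /F !inE => /or4P[]/eqP->;
   rewrite ?gg ?new_gy ?new_y ?eqxx ?orbT.
Qed.

Lemma split_other p q : old p = old q -> old p != old x -> new p = new q.
Proof.
pose F r := if old r == old x then None else Some (new r).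
move=> opq npx; suff /(congr1 (odflt (new p))) : F p = F q.
  by rewrite /F -opq (negPf npx).
move/circP: opq; apply: glue_ind => r; first by rewrite /F !circ_f.
rewrite /F circ_g.
have [|/g'E<-] := boolP (r \in [:: x; y; g x; g y]); last by rewrite circ_g.
by rewrite !inE => /or4P[]/eqP->; rewrite ?circ_g ?old_y eqxx.
Qed.

Lemma split_neq : new x != new (g x).
Proof. by rewrite -g'y circ_g circE; move: split; rewrite connect_exchange. Qed.

(** Once one half of the split circle is dropped, sending a new circle to the old one containing it
    is a bijection. *)
Lemma card_split : #|circle f g'| = #|circle f g|.+1.
Proof.
pose D := [set~ new (g x)]; pose h u := old (val (u : circle f g')).
have hE p : h (new p) = old p by apply: split_coarser; rewrite val_circ.
rewrite -[LHS]cardsT (cardsD1 (new (g x))) inE add1n; congr _.+1.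
rewrite -[RHS]cardsT (_ : _ :\ _ = D); last by apply/setP => u; rewrite !inE andbT.
rewrite -(card_in_imset (f := h) (D := D)).
  congr #|pred_of_set _|; apply/setP => c; rewrite inE; apply/imsetP.
  rewrite -(val_circ c); have [e|ne] := eqVneq (new (val c)) (new (g x)).
    exists (new x); first by rewrite !inE split_neq.
    by rewrite hE (split_coarser e) circ_g.
  by exists (new (val c)); rewrite ?inE ?hE.
move=> u v; rewrite !inE -(val_circ u) -(val_circ v) !hE => nu nv huv.
have [ux|] := eqVneq (old (val u)) (old x); last exact: split_other.
have vx : old (val v) = old x by rewrite -huv.
case: (split_circle ux) => [->|eu]; last by rewrite eu eqxx in nu.
by case: (split_circle vx) => [->|ev] //; rewrite ev eqxx in nv.
Qed.

End Saddle.

(** * Arcs of a crossingless matching join points of opposite parity *)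

Section Matching.
Variables (n : nat) (b : matching n).
Implicit Types i j k : 'I_(n.*2).

Lemma arcK : involutive b.
Proof. by move=> i; case: b => f /= /andP[/forallP/(_ i)/andP[/eqP]]. Qed.

Lemma arc_neq i : b i != i.
Proof. by case: b => f /= /andP[/forallP/(_ i)/andP[]]. Qed.

Lemma arc_noncrossing i j : (i < j < b i)%N -> (i < b j < b i)%N.
Proof.
have nc (k l : 'I_(n.*2)) : ~~ [&& (k < l)%N, (l < b k)%N & (b k < b l)%N].
  by case: b => f /= /andP[_ /forallP/(_ k)/forallP/(_ l)].
case/andP=> ij jbi; apply/andP; split.
  rewrite ltn_neqAle; apply/andP; split.
    by apply: contraTneq jbi => /val_inj ->; rewrite arcK ltnn.
  rewrite leqNgt; apply/negP => bji.
  by move: (nc (b j) i); rewrite arcK bji ij jbi.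
rewrite ltn_neqAle; apply/andP; split.
  by apply: contraTneq ij => /val_inj/(inv_inj arcK)->; rewrite ltnn.
by rewrite leqNgt; move: (nc i j); rewrite ij jbi.
Qed.

(** The points strictly under an arc are matched among themselves, hence even in number. *)
Lemma odd_arc i : odd (b i) = ~~ odd i.
Proof.
wlog ltib : i / (i < b i)%N.
  move=> wh; have [|lebi] := ltnP i (b i); first exact: wh.
  have /wh : (b i < b (b i))%N.
    by rewrite arcK ltn_neqAle lebi andbT (inj_eq val_inj) arc_neq.
  by rewrite arcK => ->; rewrite negbK.
pose I := [set k : 'I_(n.*2) | (i < k < b i)%N].
pose J := [set k in I | (k < b k)%N].
have bI k : (b k \in I) = (k \in I).
  rewrite !inE; apply/idP/idP => /arc_noncrossing //.
  by rewrite arcK.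
have cI : #|I| = #|J|.*2.
  rewrite -(cardsID J) (setIidPr _); last by apply/subsetP => k; rewrite inE => /andP[].
  rewrite (_ : I :\: J = b @: J) ?card_imset ?addnn //; first exact: inv_inj arcK.
  apply/setP => k; rewrite inE; apply/andP/imsetP => [[kJ kI]|[l lJ ->]].
    exists (b k); last by rewrite arcK.
    move: kJ; rewrite !inE in kI *; rewrite kI /= -leqNgt arcK => lek.
    rewrite arc_noncrossing //= ltn_neqAle lek andbT (inj_eq val_inj).
    exact: arc_neq.
  move: lJ; rewrite [l \in J]inE => /andP[lI ltl]; split; last by rewrite bI.
  by rewrite inE bI lI /= arcK -leqNgt ltnW.
have : #|I| = (b i - i.+1)%N.
  rewrite -sum1dep_card -(big_mkord (fun k : nat => i < k < b i)%N (fun=> 1%N)).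
  rewrite (@big_cat_nat _ _ _ i.+1) //=.
  rewrite big_nat_cond big1 => [|k]; last first.
    by rewrite ltnS => /andP[/andP[_ lek]]; rewrite ltnNge lek.
  rewrite (@big_cat_nat _ _ _ (b i)) //=; last exact: ltnW (ltn_ord _).
  rewrite [X in (_ + (_ + X))%N]big_nat_cond [X in (_ + (_ + X))%N]big1 => [|k]; last first.
    by case/andP=> /andP[lek _] /andP[_]; rewrite ltnNge lek.
  rewrite add0n addn0 big_nat_cond (eq_bigl (fun k : nat => i < k < b i)%N); last first.
    by move=> k; case: (_ < _ < _)%N.
  by rewrite -big_nat sum_nat_const_nat muln1.
move=> cI'; have /(congr1 odd) := etrans (esym cI') cI.
rewrite odd_double oddB //=.
by case: (odd (b i)); case: (odd i).
Qed.

End Matching.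

(** Left multiplication by p - q identifies p with q, so it does not matter which half of a split
    circle represents the old circle. *)
Lemma emap_congr_mod (R : comNzRingType) (T T' : finType) (f h : T -> T')
    (p q : T') (z : extr R T) :
  (forall t, f t = h t \/ (f t \in [:: p; q]) && (h t \in [:: p; q])) ->
  (egen R p - egen R q) * emap f z = (egen R p - egen R q) * emap h z.
Proof.
move=> fh; set D := _ - _.
have DC t : D * egen R t = - (egen R t * D).
  by rewrite mulrBl mulrBr ![_ * egen R t]egenC opprB opprK addrC.
have Dpq : D * egen R p = D * egen R q.
  apply/eqP; rewrite -subr_eq0 -mulrBr mulrBl !mulrBr !egen_sqr.
  by rewrite [egen _ q * _]egenC subr0 opprK sub0r addNr.
have Dfh t : D * egen R (f t) = D * egen R (h t).
  case: (fh t) => [-> //|]; rewrite !inE.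
  by case/andP=> /orP[]/eqP-> /orP[]/eqP->.
pose F k (x : extr R T) := D * emap k x.
have F_lin k : linear (F k).
  by move=> r x y; rewrite /F linearP mulrDr scalerAr.
pose Fl k : {linear extr R T -> extr R T'} := HB.pack (F k)
  (GRing.isLinear.Build _ _ _ _ (F k) (F_lin k)).
rewrite -[LHS]/(Fl f z) -[RHS]/(Fl h z).
apply: linear_eq_basis => B; rewrite /= /F !emap_basis.
elim: (enum B) => [|t s IH]; first by rewrite !big_nil.
by rewrite !big_cons !mulrA Dfh DC !mulNr -!mulrA IH.
Qed.

(** * The cobordism map as multiplication by a product of edge vectors *)

Section Composition.
Variables (n : nat) (c b a : matching n).
Local Notation I := 'I_(n.*2).
Implicit Types (s t : seq I) (i j : I) (p q : bool * I).
Local Notation st := (@stage_circ n c b a).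
Local Notation out := (@outer n c a).

(** The checkerboard colour: arcs change the parity and vertical strands the level, so both change
    the colour. *)
Definition stage_col (p : bool * I) : bool := p.1 (+) odd p.2.

Lemma outerK : involutive out.
Proof. by case=> -[] i; rewrite /outer /= arcK. Qed.

Lemma innerK s : involutive (@inner n b s).
Proof.
case=> u i; rewrite {2}/inner /=; case: ifP => h; rewrite /inner /=.
  by rewrite h negbK.
by rewrite arcK orbC h.
Qed.

Lemma col_outer p : stage_col (out p) = ~~ stage_col p.
Proof. by case: p => -[] i; rewrite /stage_col /outer /= odd_arc ?negbK. Qed.

Lemma col_inner s p : stage_col (@inner n b s p) = ~~ stage_col p.
Proof.
case: p => u i; rewrite /stage_col /inner /=; case: ifP => _ /=.
  by rewrite addNb.
by rewrite odd_arc addbN.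
Qed.

Definition is_split s i : bool := st s (true, i) == st s (false, i).

Section OneSaddle.
Variables (s : seq I) (i : I).
Hypotheses (is_ : i \notin s) (bis : b i \notin s).

Let x : bool * I := (true, i).
(** Contracting the arc exchanges the partners of [x] and [y], which have the same colour because i
    and [b i] have opposite parity. *)
Let y : bool * I := (false, b i).
Let g := @inner n b s.
Let g' := @inner n b (i :: s).

Let gx : g x = (true, b i).
Proof. by rewrite /g /inner /= (negPf is_) (negPf bis). Qed.
Let gy : g y = (false, i).
Proof. by rewrite /g /inner /= arcK (negPf is_) (negPf bis). Qed.
Let g'x : g' x = (false, i).
Proof. by rewrite /g' /inner /= inE eqxx. Qed.
Let g'y : g' y = (true, b i).
Proof. by rewrite /g' /inner /= arcK !inE eqxx !orbT. Qed.
Let xy : x != y. Proof. by []. Qed.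
Let col_xy : stage_col x = stage_col y.
Proof. by rewrite /stage_col /= odd_arc; case: (odd i). Qed.

Let arc_eq j k : (b j == k) = (j == b k).
Proof. by apply/eqP/eqP => [<-|->]; rewrite arcK. Qed.

Let g'E p : p \notin [:: x; y; g x; g y] -> g' p = g p.
Proof.
rewrite gx gy /x /y !inE; case: p => u j; rewrite !xpair_eqE /g /g' /inner /= !inE.
rewrite (arc_eq j i).
by case: u => /=; rewrite ?orbF; case: (j == i) => //=; case: (j == b i).
Qed.

Let gE p : p \notin [:: x; y; g' x; g' y] -> g p = g' p.
Proof.
move=> hp; apply/esym/g'E; move: hp.
by rewrite g'x g'y gx gy !inE => h; apply: contra h => /or4P[]->; rewrite ?orbT.
Qed.

Let g'xE : g' x = g y. Proof. by rewrite g'x gy. Qed.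
Let g'yE : g' y = g x. Proof. by rewrite g'y gx. Qed.
Let gxE : g x = g' y. Proof. exact: esym g'yE. Qed.
Let gyE : g y = g' x. Proof. exact: esym g'xE. Qed.

Let splitE : is_split s i = connect (glue out g) x y.
Proof. by rewrite -circE /is_split -gy [st s (g y)]circ_g. Qed.

Let exch : is_split s i = ~~ connect (glue out g') x y.
Proof.
rewrite splitE; exact: (connect_exchange outerK (innerK s) (innerK _) col_outer
  (col_inner _) xy col_xy g'xE g'yE g'E).
Qed.

Lemma split_on p : is_split s i -> st s p = st s (true, i) ->
  st (i :: s) p = st (i :: s) (true, i) \/ st (i :: s) p = st (i :: s) (true, b i).
Proof.
move=> _; rewrite -gx; exact: (split_circle (innerK s) g'xE g'yE g'E).
Qed.

Lemma split_off p q : is_split s i -> st s p = st s q ->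
  st s p != st s (true, i) -> st (i :: s) p = st (i :: s) q.
Proof. rewrite splitE => sp; exact: (split_other g'E sp). Qed.

(** A merge is a split read backwards, so the facts about splits apply with the two involutions
    exchanged. *)
Lemma merge_old_new p q : ~~ is_split s i ->
  st s p = st s q -> st (i :: s) p = st (i :: s) q.
Proof.
rewrite exch negbK => sp.
exact: (split_coarser (innerK _) gxE gyE gE sp).
Qed.

Lemma card_saddle :
  (#|stage c b a (i :: s)| + 1 = #|stage c b a s| + (is_split s i).*2)%N.
Proof.
have aux (k l : nat) (q : bool) :
    (q -> k = l.+1) -> (~~ q -> l = k.+1) -> (k + 1 = l + q.*2)%N.
  by case: q => [/(_ isT)->|_ /(_ isT)->]; rewrite /= addn1 ?addn2 ?addn0.
apply: aux => sp.
  rewrite splitE in sp.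
  exact: (card_split outerK (innerK s) (innerK _) col_outer
      (col_inner _) xy col_xy g'xE g'yE g'E sp).
rewrite exch negbK in sp.
exact: (card_split outerK (innerK _) (innerK s) col_outer
    (col_inner _) xy col_xy gxE gyE gE sp).
Qed.

Definition saddle_edge (o : I -> bool) j : I * I :=
  if o j then (j, b j) else (b j, j).

(** Every element is written as the image of some z in the exterior algebra on all points. In this
    form a merge only changes the projection, and a split also multiplies z by one edge vector. *)
Lemma saddleE o (z : extr int (bool * I)%type) :
  saddle o i (emap (st s) z) =
  emap (st (i :: s))
    ((if is_split s i then egen int (true, (saddle_edge o i).1)
                         - egen int (true, (saddle_edge o i).2) else 1) * z).
Proof.
rewrite /saddle -/(is_split s i); case: ifP => sp; last first.
  rewrite ext_mapE emap_comp mul1r; apply: eq_emap => p /=.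
  by apply: merge_old_new; [rewrite sp | exact: (val_circ (st s p))].
rewrite wedgeE ext_mapE emap_comp emapM raddfB /= !emap_gen.
have -> : (if o i then i else b i) = (saddle_edge o i).1.
  by rewrite /saddle_edge; case: (o i).
have -> : (if o i then b i else i) = (saddle_edge o i).2.
  by rewrite /saddle_edge; case: (o i).
set b1 := st _ _; set b2 := st _ _.
have nw p : st s p = st s (true, i) -> st (i :: s) p \in [:: b1; b2].
  move/(split_on sp); rewrite !inE /b1 /b2 /saddle_edge.
  by case: (o i) => -[]->; rewrite eqxx ?orbT.
apply: emap_congr_mod => p /=; case: eqP => [e|/eqP ne].
  by right; rewrite inE eqxx nw.
have vE : st s (fingraph.root (glue out (inner b s)) p) = st s p.
  exact: (val_circ (st s p)).
by left; apply: split_off; rewrite ?vE.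
Qed.

End OneSaddle.
Local Notation edge v := (egen int v.1 - egen int v.2).

(** A later saddle multiplies on the left, so its edge comes first. The level of an edge is
    forgotten, since finally all vertical strands are collapsed. The [nseq] makes a list of one edge
    for a split and none for a merge. *)
Fixpoint split_edges (o : I -> bool) t s : seq (I * I) :=
  if t is i :: t' then
    split_edges o t' (i :: s) ++ [seq saddle_edge o i | _ <- nseq (is_split s i) tt]
  else [::].

                                                                                
Definition contraction s t :=
  [&& uniq (t ++ s), all (left_end b) (t ++ s)
    & [forall i, left_end b i ==> (i \in t ++ s)]].

Lemma contraction_cons s i t :
  contraction s (i :: t) -> [/\ i \notin s, b i \notin s & contraction (i :: s) t].
Proof.
case/and3P=> us als cov.
have ps : perm_eq (t ++ i :: s) ((i :: t) ++ s) by rewrite perm_catC /= perm_cons perm_catC.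
split.
- by move: us; rewrite /= mem_cat negb_or -andbA => /and3P[].
- apply/negP => bis.
  have lbi : left_end b (b i) by apply: (allP als); rewrite mem_cat bis orbT.
  have li : left_end b i by apply: (allP als); rewrite mem_head.
  by move: li lbi; rewrite /left_end arcK => li; rewrite ltnNge (ltnW li).
- rewrite /contraction (perm_uniq ps) us (perm_all _ ps) als /=.
  apply/forallP => j; rewrite (perm_mem ps); exact: (forallP cov j).
Qed.

Lemma inner_full s p : contraction s [::] -> @inner n b s p = (~~ p.1, p.2).
Proof.
case/and3P=> _ _ /forallP cov; rewrite /inner; case: p => u i /=.
have /implyP := cov i; have /implyP := cov (b i); rewrite /= /left_end arcK.
case: ltngtP (arc_neq b i) => [_ _ -> //|_ _ _ -> //|/val_inj e].
  by rewrite orbT.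
by rewrite e eqxx.
Qed.

Lemma full_stage_ind (S : Type) (F : I -> S) s :
  contraction s [::] -> (forall i, F (c i) = F i) -> (forall i, F (a i) = F i) ->
  forall p q, st s p = st s q -> F p.2 = F q.2.
Proof.
move=> cs Fc Fa p q /circP; apply: (glue_ind (F := fun r => F r.2)) => r.
  by rewrite /outer; case: r => -[] i /=.
by rewrite inner_full.
Qed.

Lemma saddlesE o t s (z : extr int (bool * I)%type) :
  contraction s t ->
  saddles o t (emap (st s) z) =
  emap (circ c a) (\prod_(v <- split_edges o t s) edge v * emap snd z).
Proof.
elim: t s z => [|i t IH] s z cst /=.
  rewrite big_nil mul1r ext_mapE !emap_comp; apply: eq_emap => p /=.
  apply: (full_stage_ind (F := circ c a) cst); try exact: circ_f; try exact: circ_g.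
  exact: (val_circ (st s p)).
have [is_ bis cst'] := contraction_cons cst.
rewrite (saddleE is_ bis) (IH _ _ cst') big_cat /= -mulrA; congr (emap _ (_ * _)).
rewrite emapM; case: is_split => /=; last by rewrite emap1 big_nil.
by rewrite big_seq1 raddfB /= !emap_gen.
Qed.

(** Go back through the saddles: a merge only coarsens the circles, and the two halves made by a
    split are joined again by its edge. This shows that the split edges generate what the arcs of b
    add to those of c and a. *)
Lemma split_edges_ind (S : Type) (F : I -> S) o t s :
  contraction s t -> (forall i, F (c i) = F i) -> (forall i, F (a i) = F i) ->
  (forall v, v \in split_edges o t s -> F v.1 = F v.2) ->
  forall p q, st s p = st s q -> F p.2 = F q.2.
Proof.
move=> cst Fc Fa; elim: t s cst => [|i t IH] s cst Fv /=.
  exact: full_stage_ind.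
have [is_ bis cst'] := contraction_cons cst.
have {}IH p q : st (i :: s) p = st (i :: s) q -> F p.2 = F q.2.
  by apply: (IH _ cst') => v vin; apply: Fv; rewrite /= mem_cat vin.
move=> p q e; have [sp|nsp] := boolP (is_split s i); last first.
  exact/IH/(merge_old_new is_ bis nsp).
have Fi : F i = F (b i).
  have := Fv (saddle_edge o i); rewrite /= mem_cat sp /= inE eqxx orbT.
  by rewrite /saddle_edge; case: (o i) => /(_ isT).
have [ep|np] := eqVneq (st s p) (st s (true, i)); last first.
  exact/IH/(split_off is_ bis sp e np).
have Fp r : st s r = st s (true, i) -> F r.2 = F i.
  by case/(split_on is_ bis sp) => /IH; rewrite /= -?Fi.
by rewrite !Fp // -e.
Qed.

Lemma size_split_edges o t s : contraction s t ->
  (#|W c a| + size t = #|stage c b a s| + (size (split_edges o t s)).*2)%N.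
Proof.
elim: t s => [|i t IH] s cst /=.
  rewrite !addn0.
  pose h (u : stage c b a s) := circ c a (val u).2.
  have hE p : h (st s p) = circ c a p.2.
    apply: (full_stage_ind (F := circ c a) cst); try exact: circ_f.
      exact: circ_g.
    exact: (val_circ (st s p)).
  have h_inj : injective h.
    move=> u v; rewrite -(val_circ u) -(val_circ v) !hE => /circP.
    case: (val u) (val v) => e i [e' i'] /=.
    have flip (j : bool) (k : I) : st s (j, k) = st s (true, k).
      by case: j => //; rewrite -[RHS](circ_g _ (@inner n b s)) inner_full.
    rewrite -[circ _ _ (e, i)]/(st s (e, i)) -[circ _ _ (e', i')]/(st s (e', i')).
    rewrite (flip e) (flip e').
    apply: (glue_ind (F := fun j => st s (true, j))) => j.
      exact: (circ_f out _ (true, j)).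
    by rewrite -(flip false (a j)) -(flip false j); exact: (circ_f out _ (false, j)).
  rewrite -(card_imset _ h_inj) -[LHS]cardsT; congr #|pred_of_set _|.
  apply/setP => u; rewrite inE; apply/esym/imsetP.
  by exists (st s (true, val u)); rewrite // hE val_circ.
have [is_ bis cst'] := contraction_cons cst.
have aux (k l m p q : nat) (x : bool) : (k + p = l + q.*2 -> l + 1 = m + x.*2 ->
    k + p.+1 = m + (q + x).*2)%N by move=> {cst is_ bis cst' IH}; lia.
rewrite size_cat size_map size_nseq.
exact: (aux _ _ _ _ _ _ (IH _ cst') (card_saddle is_ bis)).
Qed.

Variable C : cob_choice b.

Definition cob_edges : seq (I * I) :=
  split_edges (cob_orient C) (cob_order C) [::].

Lemma cob_contraction : contraction [::] (cob_order C).
Proof.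
have pe := cob_order_arcs C; rewrite /contraction cats0.
rewrite (perm_uniq pe) enum_uniq (perm_all _ pe) /=; apply/andP; split.
  by apply/allP => i; rewrite mem_enum.
by apply/forallP => i; rewrite (perm_mem pe) mem_enum; apply/implyP.
Qed.

(** The block product is left multiplication by one fixed element of the exterior algebra on the 2n
    points, followed by the projection to circles; from here on no topology of intermediate stages
    is needed. *)
Lemma OFcobE (X Y : extr int I) :
  OFcob C (stack (emap (circ c b) X : ext (W c b)) (emap (circ b a) Y : ext (W b a))) =
  emap (circ c a) (\prod_(v <- cob_edges) edge v * (X * Y)).
Proof.
have E0 u i j : connect (glue (if u then c else b) (if u then b else a)) i j ->
    st [::] (u, i) = st [::] (u, j).
  apply: (glue_ind (F := fun j => st [::] (u, j))) => {i j} k.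
    case: u; first exact: (circ_f out _ (true, k)).
    exact: (circ_g out (@inner n b [::]) (false, k)).
  case: u; last exact: (circ_f out _ (false, k)).
  exact: (circ_g out (@inner n b [::]) (true, k)).
rewrite /OFcob /stack (ext_mapE _ (emap (circ c b) X)) (ext_mapE _ (emap (circ b a) Y)).
rewrite wedgeE [emap _ (emap (circ c b) X)]emap_comp [emap _ (emap (circ b a) Y)]emap_comp.
rewrite (eq_emap (h := st [::] \o pair true)); last first.
  by move=> i /=; apply: (E0 true); apply/circP; exact: (val_circ (circ c b i)).
rewrite [emap (_ \o circ b a) Y](eq_emap (h := st [::] \o pair false)); last first.
  by move=> i /=; apply: (E0 false); apply/circP; exact: (val_circ (circ b a i)).
rewrite -(emap_comp (st [::]) (pair true)) -(emap_comp (st [::]) (pair false)).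
rewrite -emapM (saddlesE _ _ cob_contraction).
congr (emap _ (_ * _)); rewrite emapM !emap_comp.
by congr (_ * _); exact: emap_id.
Qed.

Lemma cob_edges_ind (S : Type) (F : I -> S) :
  (forall i, F (c i) = F i) -> (forall i, F (a i) = F i) ->
  (forall v, v \in cob_edges -> F v.1 = F v.2) -> forall i, F (b i) = F i.
Proof.
move=> Fc Fa Fv i.
apply: (split_edges_ind cob_contraction Fc Fa Fv (p := (true, b i)) (q := (true, i))).
exact: (circ_g out (@inner n b [::]) (true, i)).
Qed.

Lemma cob_edges_arc v : v \in cob_edges -> v.2 = b v.1.
Proof.
rewrite /cob_edges; elim: (cob_order C) [::] => //= i t IH s.
rewrite mem_cat => /orP[/IH //|/mapP[_ _ ->]].
by rewrite /saddle_edge; case: cob_orient => //=; rewrite arcK.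
Qed.

Lemma card_left_end : #|left_end b| = n.
Proof.
have : (#|left_end b| + #|[predC left_end b]| = n.*2)%N by rewrite cardC card_ord.
rewrite (_ : #|[predC left_end b]| = #|left_end b|); first by rewrite addnn => /double_inj.
rewrite -(card_image (f := b) (inv_inj (@arcK n b))); apply: eq_card => i.
have memL (k : I) : (k \in left_end b) = (k < b k)%N by [].
apply/imageP/idP => [[j lj ->]|li].
  move: lj; rewrite memL arcK inE /= memL -leqNgt => lej.
  by rewrite ltn_neqAle lej andbT (inj_eq val_inj) arc_neq.
exists (b i); last by rewrite arcK.
by rewrite inE /= memL arcK -leqNgt; apply: ltnW.
Qed.

(** Of the n saddles each split adds one circle and each merge removes one. *)
Lemma size_cob_edges :
  (#|W c a| + n = #|W c b| + #|W b a| + (size cob_edges).*2)%N.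
Proof.
have sz : size (cob_order C) = n.
  by rewrite (perm_size (cob_order_arcs C)) -cardE card_left_end.
have E := size_split_edges (cob_orient C) cob_contraction; rewrite sz in E.
apply: (etrans E); congr (_ + _)%N => {E}.
pose h (u : stage c b a [::]) : W c b + W b a :=
  if (val u).1 then inl (circ c b (val u).2) else inr (circ b a (val u).2).
have hE p : h (st [::] p) =
    if p.1 then inl (circ c b p.2) else inr (circ b a p.2).
  apply: (circ_ind (F := fun p : bool * I => if p.1 then inl (circ c b p.2) else
     inr (circ b a p.2) : W c b + W b a)).
    by case=> -[] i /=; rewrite ?circ_f ?circ_g.
  by case=> -[] i; rewrite /inner /= ?circ_f ?circ_g.
have h_inj : injective h.
  move=> u v; rewrite -(val_circ u) -(val_circ v) !hE.
  case: (val u) (val v) => -[] i [[] j] //= [e].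
    have /circP : circ c b i = circ c b j by apply: val_inj.
    apply: (glue_ind (F := fun j => st [::] (true, j))) => k.
      exact: (circ_f out _ (true, k)).
    exact: (circ_g out (@inner n b [::]) (true, k)).
  have /circP : circ b a i = circ b a j by apply: val_inj.
  apply: (glue_ind (F := fun j => st [::] (false, j))) => k.
    exact: (circ_g out (@inner n b [::]) (false, k)).
  exact: (circ_f out _ (false, k)).
rewrite -card_sum -(card_imset _ h_inj) -[RHS]cardsT; congr #|pred_of_set _|.
apply/setP => u; rewrite [RHS]inE; apply/imsetP.
case: u => u.
  by exists (st [::] (true, val u)); rewrite // hE /= val_circ.
by exists (st [::] (false, val u)); rewrite // hE /= val_circ.
Qed.

End Composition.

                                      

(** * Wedges of lists of vectors and determinants *)

Section WedgeOfVectors.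
Variables (F : fieldType) (V : lmodType F) (A : algType F) (phi : {linear V -> A}).
Hypothesis phi2 : forall v, phi v * phi v = 0.
Implicit Types (s t : seq V) (x : A).

(** Since [phi] has square-zero values it factors through the exterior algebra of V, and this is the
    image of the wedge of s. *)
Definition wed s : A := \prod_(v <- s) phi v.

Lemma wed_nil : wed [::] = 1. Proof. exact: big_nil. Qed.
Lemma wed_cons v s : wed (v :: s) = phi v * wed s. Proof. exact: big_cons. Qed.
Lemma wed_cat s t : wed (s ++ t) = wed s * wed t. Proof. exact: big_cat. Qed.

Lemma phiC u v : phi u * phi v = - (phi v * phi u).
Proof.
apply/eqP; rewrite -addr_eq0; have := phi2 (u + v).
by rewrite raddfD mulrDl !mulrDr !phi2 add0r addr0 addrC => ->.
Qed.

Lemma phi_wed v s : phi v * wed s = (-1) ^+ size s *: (wed s * phi v).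
Proof. exact: (mul_gprod_seq (g := phi) phiC). Qed.

Lemma wedC s t : wed s * wed t = (-1) ^+ (size s * size t) *: (wed t * wed s).
Proof.
elim: s => [|v s IH]; first by rewrite wed_nil mul1r mulr1 scale1r.
rewrite wed_cons -mulrA IH -scalerAr (mulrA (phi v)) (phi_wed v t) -scalerAl scalerA.
by rewrite -exprD mulSn addnC -mulrA.
Qed.

Lemma phi_wed_kill v s x : phi v * x = 0 -> phi v * (wed s * x) = 0.
Proof. by move=> vx; rewrite mulrA phi_wed -scalerAl -mulrA vx mulr0 scaler0. Qed.

Lemma phi_wed_mem v s : v \in s -> phi v * wed s = 0.
Proof.
elim: s => // u s IH; rewrite in_cons wed_cons mulrA.
case: eqP => [->|_] /= vs; first by rewrite phi2 mul0r.
by rewrite phiC mulNr -mulrA IH // mulr0 oppr0.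
Qed.

Lemma prod_lift k (T : 'I_k.+1 -> V) (j : 'I_k.+1) :
  phi (T j) * \prod_(i < k) phi (T (lift j i)) =
  (-1) ^+ j *: \prod_(i < k.+1) phi (T i).
Proof.
elim: k T j => [|k IH] T j.
  by rewrite !big_ord_recl !big_ord0 ord1 scale1r.
have [j'|] := unliftP ord0 j => [->|->]; last first.
  by rewrite [in RHS]big_ord_recl scale1r; congr (_ * _); apply: eq_bigr.
rewrite [in RHS]big_ord_recl [in LHS]big_ord_recl.
have -> : lift (lift ord0 j') ord0 = ord0 :> 'I_k.+2 by apply: val_inj.
rewrite mulrA phiC mulNr -mulrA.
rewrite (eq_bigr (fun i : 'I_k => phi (T (lift ord0 (lift j' i))))); last first.
  by move=> i _; congr (phi (T _)); apply: val_inj; rewrite /= !bumpS.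
rewrite (IH (fun i => T (lift ord0 i))) -scalerAr -scaleNr /= /bump leq0n.
by rewrite exprD expr1 mulN1r.
Qed.

Lemma prod_det k (C : 'M[F]_k) (T : 'I_k -> V) :
  \prod_(i < k) phi (\sum_j C i j *: T j) = \det C *: \prod_(i < k) phi (T i).
Proof.
elim: k C T => [|k IH] C T; first by rewrite !big_ord0 det_mx00 scale1r.
rewrite big_ord_recl raddf_sum /= mulr_suml (expand_det_row _ ord0) scaler_suml.
apply: eq_bigr => j _; rewrite linearZ /= -scalerAl -scalerA; congr (_ *: _).
(* Behind the factor [T j], the entries of column j in the other rows contribute nothing; this
   leaves the minor of the expansion along the first row. *)
have kill : phi (T j) * \prod_(i < k) phi (\sum_l C (lift ord0 i) l *: T l) =
  phi (T j) * \prod_(i < k) phi (\sum_l C (lift ord0 i) (lift j l) *: T (lift j l)).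
  elim/big_rec2: _ => // i x y _ exy.
  rewrite (bigD1_ord j) //= raddfD /= mulrDl mulrDr linearZ /= -scalerAl -scalerAr.
  rewrite [in X in X + _]mulrA phi2 mul0r scaler0 add0r.
  by rewrite !mulrA phiC !mulNr -!mulrA exy.
rewrite kill.
have -> : \prod_(i < k) phi (\sum_l C (lift ord0 i) (lift j l) *: T (lift j l)) =
    \det (row' ord0 (col' j C)) *: \prod_(i < k) phi (T (lift j i)).
  rewrite -IH; apply: eq_bigr => i _; congr (phi _); apply: eq_bigr => l _.
  by rewrite !mxE.
by rewrite -scalerAr prod_lift scalerA /cofactor mulrC.
Qed.

Lemma wed_nth s : wed s = \prod_(i < size s) phi s`_i.
Proof. by rewrite /wed (big_nth 0) big_mkord. Qed.

Lemma wed_det k (C : 'M[F]_k) s t x : size s = k -> size t = k ->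
  (forall i : 'I_k, phi (t`_i - \sum_j C i j *: s`_j) * x = 0) ->
  wed t * x = \det C *: (wed s * x).
Proof.
move=> sk tk hx; rewrite scalerAl !wed_nth sk tk.
rewrite -(prod_det C (fun j => s`_j)).
set P := \prod_(i < k) _; set Q := \prod_(i < k) _.
(* The second conjunct is carried along so that an error term that kills x still kills it behind the
   later factors. *)
suff [] : P * x = Q * x /\ (forall v, phi v * x = 0 -> phi v * (Q * x) = 0) by [].
rewrite {}/P {}/Q; elim/big_rec2: _ => [|i P Q _ [PQ Qk]].
  by split=> // v; rewrite mul1r.
split=> [|v vx]; last by rewrite -mulrA mulrA phiC mulNr -mulrA Qk ?mulr0 ?oppr0.
rewrite -!mulrA PQ; apply/eqP; rewrite -subr_eq0 -mulrBl -raddfB.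
by rewrite Qk.
Qed.

End WedgeOfVectors.

Section ChangeOfLists.
Variables (F : fieldType) (V : vectType F).
Implicit Types (s t : seq V) (K : {vspace V}).

Lemma kill_span (A : algType F) (phi : {linear V -> A}) (x : A) s :
  (forall v, v \in s -> phi v * x = 0) ->
  forall v, v \in <<s>>%VS -> phi v * x = 0.
Proof.
move=> hs v vs; rewrite (coord_span (X := in_tuple s) vs) raddf_sum /= mulr_suml.
apply: big1 => i _; rewrite linearZ /= -scalerAl hs ?scaler0 //.
exact: mem_nth.
Qed.

(** The wedge of t is c times that of s modulo K. Quantifying over all targets [A], [phi] and [x]
    makes c depend only on the lists, so one scalar serves in every block of the algebra. *)
Definition wed_rel K s t (c : F) :=
  forall (A : algType F) (phi : {linear V -> A}) (x : A),
    (forall v, phi v * phi v = 0) -> (forall v, v \in K -> phi v * x = 0) ->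
    wed phi t * x = c *: (wed phi s * x).

Lemma wed_rel_det K s t k (C : 'M[F]_k) : size s = k -> size t = k ->
  (forall i : 'I_k, t`_i - \sum_j C i j *: s`_j \in K) -> wed_rel K s t (\det C).
Proof. by move=> sk tk hK A phi x phi2 Kx; apply: wed_det => // i; apply: Kx. Qed.

Lemma wed_rel_exists K s t : size t = size s ->
  {subset t <= (<<s>> + K)%VS} -> exists c, wed_rel K s t c.
Proof.
move=> ts tK.
pose co (i : 'I_(size s)) (c : 'I_(size s) -> F) :=
  t`_i - \sum_j c j *: s`_j \in K.
have /fin_all_exists[c hc] : forall i, exists c, co i c.
  move=> i; have : t`_i \in (<<s>> + K)%VS by apply/tK/mem_nth; rewrite ts.
  case/memv_addP=> u us [v vK e]; exists (fun j => coord (in_tuple s) j u).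
  by rewrite /co e {1}(coord_span (X := in_tuple s) us) addrAC subrr add0r.
exists (\det (\matrix_(i, j) c i j)); apply: wed_rel_det => // i.
rewrite (eq_bigr (fun j => c i j *: s`_j)) => [|j _]; last by rewrite mxE.
exact: hc.
Qed.

(** Vectors of s vanish next to the wedge of s, so the tails t and t' need to be compared only
    modulo the span of s. *)
Lemma wed_rel_cat K s s' t t' c d : size s' = size s -> size t' = size t ->
  wed_rel K s s' c -> wed_rel (<<s>> + K) t t' d ->
  wed_rel K (s ++ t) (s' ++ t') (c * d).
Proof.
move=> ss tt hs ht A phi x phi2 Kx; rewrite !wed_cat.
rewrite (wedC phi2 s') (wedC phi2 s t) -!scalerAl -!mulrA ss tt hs //.
rewrite -scalerAr ht // => [|v /memv_addP[u us [w wK ->]]].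
  by rewrite !scalerA; congr (_ *: _); ring.
rewrite raddfD /= mulrDl [phi w * _](phi_wed_kill phi2 _ (Kx _ wK)) addr0.
by apply: kill_span us => r rs; rewrite mulrA phi_wed_mem // mul0r.
Qed.

Lemma wed_relS K K' s t c : (K <= K')%VS -> wed_rel K s t c -> wed_rel K' s t c.
Proof. by move=> sK h A phi x p2 Kx; apply: h => // v /(subvP sK)/Kx. Qed.

End ChangeOfLists.

(** * Adapted bases, volumes and dual families *)

Section Bases.
Variables (F : fieldType) (V : vectType F).
Implicit Types (X Y : {vspace V}) (r s t : seq V).

Lemma basis_size X s : basis_of X s -> size s = \dim X.
Proof. by move=> bs; rewrite (size_basis (X := in_tuple s) bs). Qed.

Lemma basis_extend X Y s : (X <= Y)%VS -> basis_of X s ->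
  exists t, basis_of Y (s ++ t).
Proof.
move=> sXY bs; exists (vbasis (Y :\: X)).
have eY : (X + (Y :\: X))%VS = Y by rewrite addvC addv_diff (addv_idPl sXY).
rewrite -[Y in basis_of Y _]eY; apply: cat_basis (vbasisP _) => //.
by apply/directv_addP; rewrite capvC capv_diff.
Qed.

Lemma basis_modular X Y r s t : basis_of (X :&: Y) r ->
  basis_of X (r ++ s) -> basis_of Y (r ++ t) -> basis_of (X + Y) (r ++ s ++ t).
Proof.
move=> br bs bt; rewrite basisEdim; apply/andP; split.
  rewrite -(span_basis bs) -(span_basis bt) !span_cat subv_add.
  by rewrite !addvS ?subvv ?addvSl ?addvSr.
have := dimv_sum_cap X Y.
rewrite -(basis_size br) -(basis_size bs) -(basis_size bt) !size_cat; lia.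
Qed.

Lemma basis_mem X s v : basis_of X s -> v \in s -> v \in X.
Proof. by move=> bs vs; rewrite -(span_basis bs) memv_span. Qed.

Lemma perm_basis_of X s t : perm_eq s t -> basis_of X s -> basis_of X t.
Proof. by move=> st; rewrite (perm_basis X st). Qed.

Definition vol X s : F :=
  \det (\matrix_(i < \dim X, j < \dim X) coord (vbasis X) j s`_i).

Lemma wed_vol X s : basis_of X s -> wed_rel 0 (vbasis X) s (vol X s).
Proof.
move=> bs; apply: wed_rel_det; first by rewrite size_tuple.
  exact: basis_size bs.
move=> i; have sX : s`_i \in X.
  by apply: (basis_mem bs); rewrite mem_nth // (basis_size bs).
rewrite memv0 subr_eq0; apply/eqP; rewrite {1}(coord_vbasis sX).
by apply: eq_bigr => j _; rewrite mxE.
Qed.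

End Bases.

Lemma egen_sum_sqr (R : comNzRingType) (T : finType) (I : Type) (s : seq I)
    (c : I -> R) (g : I -> T) (x := \sum_(i <- s) c i *: egen R (g i)) : x * x = 0.
Proof.
have gS i (r : seq I) : egen R (g i) * (\sum_(j <- r) c j *: egen R (g j)) =
    - ((\sum_(j <- r) c j *: egen R (g j)) * egen R (g i)).
  rewrite mulr_sumr mulr_suml -sumrN; apply: eq_bigr => j _.
  by rewrite -scalerAr -scalerAl egenC scalerN.
rewrite {}/x; elim: s => [|i s IH]; first by rewrite big_nil mul0r.
rewrite !big_cons mulrDl !mulrDr IH addr0 -!scalerAl -!scalerAr.
by rewrite egen_sqr !scaler0 add0r gS scalerN addNr.
Qed.

Section Volume.
Variables (F : fieldType) (n : nat).
Local Notation U := 'rV[F]_n.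

Definition evec (v : U) : extr F 'I_n := \sum_i v 0 i *: egen F i.

Fact evec_is_linear : linear evec.
Proof.
move=> k u v; rewrite /evec scaler_sumr -big_split /=; apply: eq_bigr => i _.
by rewrite !mxE scalerDl scalerA.
Qed.
HB.instance Definition _ := GRing.isLinear.Build F U (extr F 'I_n) _ evec evec_is_linear.

Lemma evec_sqr v : evec v * evec v = 0.
Proof. exact: egen_sum_sqr. Qed.

Lemma evec_delta i : evec (delta_mx 0 i) = egen F i.
Proof.
rewrite /evec (bigD1 i) //= big1 => [|j /negPf ji].
  by rewrite mxE !eqxx scale1r addr0.
by rewrite mxE ji andbF scale0r.
Qed.

(** Extend s to a basis: if its wedge were 0, so would be the top class, which is the wedge of the
    standard basis. *)
Lemma wed_free (s : seq U) : free s -> wed evec s != 0.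
Proof.
move=> fs; have /(basis_extend (subvf _)) [t bt] : basis_of <<s>> s.
  by rewrite /basis_of eqxx.
apply: contraTneq isT => s0.
pose e := [seq delta_mx 0 i : U | i <- enum 'I_n].
have [c hc] : exists c, wed_rel 0%VS (s ++ t) e c.
  apply: wed_rel_exists => [|u _].
    by rewrite size_map size_enum_ord (basis_size bt) dimvf /dim /= mul1n.
  by rewrite (span_basis bt) addv0 memvf.
have /= := hc _ evec 1 evec_sqr; rewrite wed_cat s0 mul0r !mul0r scaler0 mulr1.
have -> : wed evec e = ebasis F [set: 'I_n].
  rewrite ebasis_gprod /gprod /wed big_map enumT /index_enum.
  rewrite (_ : enum [set: _] = enum 'I_n); last by apply: eq_enum => i; rewrite inE.
  by rewrite enumT; apply: eq_bigr => i _ /=; rewrite evec_delta.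
have kill0 v : v \in 0%VS -> evec v * 1 = 0.
  by rewrite memv0 => /eqP->; rewrite raddf0 mul0r.
by move/(_ kill0)/ffunP/(_ [set: 'I_n]); rewrite !ffunE eqxx => /eqP; rewrite oner_eq0.
Qed.

Lemma vol_neq0 (X : {vspace U}) s : basis_of X s -> vol X s != 0.
Proof.
move=> bs; have /negP := wed_free (basis_free bs); apply: contra_not_neq => v0.
have /= := wed_vol bs evec_sqr (x := 1); rewrite v0 scale0r mulr1 => -> //.
by move=> v; rewrite memv0 => /eqP->; rewrite raddf0 mul0r.
Qed.

Lemma vol_rel (X : {vspace U}) s t c : basis_of X s -> basis_of X t ->
  wed_rel 0 s t c -> vol X t = c * vol X s.
Proof.
move=> bs bt st.
have k0 v : v \in 0%VS -> evec v * 1 = 0.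
  by rewrite memv0 => /eqP->; rewrite raddf0 mul0r.
have := st _ _ _ evec_sqr k0.
rewrite (wed_vol bs evec_sqr k0) (wed_vol bt evec_sqr k0) scalerA.
move/eqP; rewrite -subr_eq0 -scalerBl mulr1 scaler_eq0.
by rewrite (negPf (wed_free (basis_free (vbasisP X)))) orbF subr_eq0 => /eqP.
Qed.

Definition dot (w u : U) : F := (w *m u^T) 0 0.

Lemma dotE w u : dot w u = \sum_k w 0 k * u 0 k.
Proof. by rewrite /dot mxE; apply: eq_bigr => k _; rewrite mxE. Qed.

Lemma dotDl w w' u : dot (w + w') u = dot w u + dot w' u.
Proof. by rewrite /dot mulmxDl mxE. Qed.
Lemma dotDr w u u' : dot w (u + u') = dot w u + dot w u'.
Proof. by rewrite /dot linearD mulmxDr mxE. Qed.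
Lemma dotZl k w u : dot (k *: w) u = k * dot w u.
Proof. by rewrite /dot -scalemxAl mxE. Qed.
Lemma dotZr k w u : dot w (k *: u) = k * dot w u.
Proof. by rewrite /dot linearZ /= -scalemxAr mxE. Qed.
Lemma dot0l u : dot 0 u = 0. Proof. by rewrite /dot mul0mx mxE. Qed.
Lemma dot0r w : dot w 0 = 0. Proof. by rewrite /dot trmx0 mulmx0 mxE. Qed.
Lemma dotNl w u : dot (- w) u = - dot w u.
Proof. by rewrite -scaleN1r dotZl mulN1r. Qed.
Lemma dotNr w u : dot w (- u) = - dot w u.
Proof. by rewrite -scaleN1r dotZr mulN1r. Qed.
Lemma dot_suml I (r : seq I) (P : pred I) (G : I -> U) u :
  dot (\sum_(i <- r | P i) G i) u = \sum_(i <- r | P i) dot (G i) u.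
Proof. by apply: (big_morph (dot^~ u)) => [w w'|]; rewrite ?dotDl ?dot0l. Qed.
Lemma dot_sumr I (r : seq I) (P : pred I) (G : I -> U) w :
  dot w (\sum_(i <- r | P i) G i) = \sum_(i <- r | P i) dot w (G i).
Proof. by apply: (big_morph (dot w)) => [u u'|]; rewrite ?dotDr ?dot0r. Qed.

Definition perp (X : {vspace U}) (w : U) := forall u, u \in X -> dot w u = 0.

Lemma perp_span (s : seq U) w :
  (forall u, u \in s -> dot w u = 0) -> perp <<s>> w.
Proof.
move=> sw u us; rewrite (coord_span (X := in_tuple s) us) dot_sumr big1 // => i _.
by rewrite dotZr sw ?mulr0 // mem_nth.
Qed.

Lemma perpD X w w' : perp X w -> perp X w' -> perp X (w + w').
Proof. by move=> hw hw' u uX; rewrite dotDl hw ?hw' ?addr0. Qed.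
Lemma perpZ X k w : perp X w -> perp X (k *: w).
Proof. by move=> hw u uX; rewrite dotZl hw ?mulr0. Qed.
Lemma perp_sum X I (r : seq I) (P : pred I) (G : I -> U) :
  (forall i, P i -> perp X (G i)) -> perp X (\sum_(i <- r | P i) G i).
Proof. by move=> hG u uX; rewrite dot_suml big1 // => i /hG ->. Qed.

(** The family f consists of the coordinate forms of z in the free list [s ++ z], written as row
    vectors for [dot]. *)
Lemma dual_exists (s z : seq U) : free (s ++ z) ->
  exists f : seq U, [/\ size f = size z,
    (forall w, w \in f -> perp <<s>> w) &
    (forall i j, (i < size z)%N -> (j < size z)%N -> dot f`_i z`_j = (i == j)%:R)].
Proof.
move=> fsz; pose X := in_tuple (s ++ z).
have lt_sz i : (i < size z)%N -> (size s + i < size (s ++ z))%N.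
  by rewrite size_cat ltn_add2l.
pose g i : U := if insub (size s + i)%N is Some l then
  \row_k coord X l (delta_mx 0 k) else 0.
have gE i (iz : (i < size z)%N) u : dot (g i) u = coord X (Ordinal (lt_sz i iz)) u.
  rewrite dotE /g insubT; first exact: lt_sz.
  move=> h; rewrite {2}(row_sum_delta u) linear_sum; apply: eq_bigr => k _.
  by rewrite mxE linearZ /= mulrC; congr (_ * coord _ _ _); apply: val_inj.
exists (mkseq g (size z)); split; first by rewrite size_mkseq.
  move=> w /mapP[i]; rewrite mem_iota add0n /= => iz ->.
  apply: perp_span => u us; rewrite gE //.
  have lu : (index u s < size (s ++ z))%N.
    by rewrite size_cat ltn_addr // index_mem.
  have -> : u = X`_(Ordinal lu) by rewrite /= nth_cat index_mem us nth_index.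
  rewrite coord_free //= -val_eqE /=; case: eqP => // e.
  by move: us; rewrite -index_mem e ltnNge leq_addr.
move=> i j iz jz; rewrite nth_mkseq // gE.
have -> : z`_j = X`_(Ordinal (lt_sz j jz)).
  by rewrite /= nth_cat ltnNge leq_addr /= addKn.
by rewrite coord_free //= -val_eqE /= eqn_add2l eq_sym.
Qed.

End Volume.

               

Section WedgeRelMore.
Variables (F : fieldType) (V : vectType F).
Implicit Types (s t : seq V) (K : {vspace V}).

Lemma wed_rel_swap K (u s t v : seq V) :
  wed_rel K (u ++ s ++ t ++ v) (u ++ t ++ s ++ v) ((-1) ^+ (size s * size t)).
Proof.
move=> A phi x phi2 _; rewrite scalerAl; congr (_ * x); rewrite !wed_cat.
rewrite !mulrA -[wed phi u * _ * _]mulrA -[wed phi u * wed phi s * _]mulrA.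
rewrite (wedC phi2 s) -!(scalerAl, scalerAr) scalerA -exprD addnn -muln2 mulnC.
by rewrite exprM sqrrN expr1n expr1n scale1r !mulrA.
Qed.

(** Padding s with zero vectors up to the length of t keeps its span and makes its wedge 0. *)
Lemma wed_rel_overflow K s t (A : algType F) (phi : {linear V -> A}) x :
  (forall v, phi v * phi v = 0) -> (forall v, v \in K -> phi v * x = 0) ->
  (size s < size t)%N -> {subset t <= (<<s>> + K)%VS} -> wed phi t * x = 0.
Proof.
move=> phi2 Kx st tK; pose s0 := s ++ nseq (size t - size s) 0.
have [c hc] : exists c, wed_rel K s0 t c.
  apply: wed_rel_exists => [|v /tK]; first by rewrite size_cat size_nseq subnKC // ltnW.
  by apply/subvP; rewrite addvS // span_cat addvSl.
rewrite (hc _ _ _ phi2 Kx) /s0 wed_cat -[(_ - _)%N]prednK ?subn_gt0 //=.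
by rewrite wed_cons raddf0 mul0r mulr0 mul0r scaler0.
Qed.

                                                                              
                                                       
(** If the scalar found from s to t is 0, then t, and by the reverse relation s as well, has wedge 0
    wherever it is tested, so the scalar 1 serves too. *)
Lemma wed_rel_unit K s t : size t = size s ->
  {subset t <= (<<s>> + K)%VS} -> {subset s <= (<<t>> + K)%VS} ->
  exists2 c, c != 0 & wed_rel K s t c.
Proof.
move=> st tK sK; have [c hc] := wed_rel_exists st tK.
have [c0|nc0] := eqVneq c 0; last by exists c.
have [d hd] := wed_rel_exists (esym st) sK.
exists 1; first exact: oner_neq0.
move=> A phi x phi2 Kx; rewrite (hc _ _ _ phi2 Kx) c0 scale0r.
by rewrite (hd _ _ _ phi2 Kx) (hc _ _ _ phi2 Kx) c0 scale0r !scaler0.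
Qed.

End WedgeRelMore.

(** * Conormal spaces and the normalised wedge of a frame *)

Section Frames.
Variables (F : fieldType) (n : nat).
Hypothesis sqF : forall k : F, k != 0 -> k * k = 1.
Local Notation U := 'rV[F]_n.
Local Notation V := (U * U)%type.
Implicit Types (X Y : {vspace U}) (K : {vspace V}).

(** The second copy of U plays the dual of the first through [dot]; the names refer to the black and
    white regions of a checkerboard colouring. *)
Definition blk (u : U) : V := (u, 0).
Definition wht (w : U) : V := (0, w).

Fact blk_is_linear : linear blk.
Proof. by move=> k u v; apply: injective_projections; rewrite /= ?scaler0 ?addr0. Qed.
HB.instance Definition _ := GRing.isLinear.Build F U V _ blk blk_is_linear.
Fact wht_is_linear : linear wht.
Proof. by move=> k u v; apply: injective_projections; rewrite /= ?scaler0 ?addr0. Qed.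
HB.instance Definition _ := GRing.isLinear.Build F U V _ wht wht_is_linear.

Lemma blkZ k u : blk (k *: u) = k *: blk u. Proof. exact: linearZ. Qed.
Lemma whtZ k w : wht (k *: w) = k *: wht w. Proof. exact: linearZ. Qed.
Lemma whtD w w' : wht (w + w') = wht w + wht w'. Proof. exact: raddfD. Qed.
Lemma blk_wht (v : V) : v = blk v.1 + wht v.2.
Proof. by apply: injective_projections; rewrite /= ?addr0 ?add0r. Qed.

                                                                                
(** The sum of X and its annihilator, a Lagrangian subspace of dimension n. It is kept as a
    predicate; [L_space] ties it to an actual subspace. *)
Definition in_L X (v : V) := v.1 \in X /\ perp X v.2.

Lemma in_LZ X k v : in_L X v -> in_L X (k *: v).
Proof. by case=> h1 h2; split; [apply: memvZ | apply: perpZ]. Qed.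
Lemma in_L_blk X u : u \in X -> in_L X (blk u).
Proof. by move=> uX; split=> // u' _; rewrite dot0l. Qed.
Lemma in_L_wht X w : perp X w -> in_L X (wht w).
Proof. by split; rewrite ?mem0v. Qed.
Lemma dot_eq (s : seq U) w w' : basis_of fullv s ->
  (forall u, u \in s -> dot w u = dot w' u) -> w = w'.
Proof.
move=> bs h; apply/rowP => k.
have p0 : perp <<s>> (w - w').
  by apply: perp_span => u us; rewrite dotDl dotNl h ?subrr.
have /p0 : (delta_mx 0 k : U) \in <<s>>%VS by rewrite (span_basis bs) memvf.
rewrite dotE (bigD1 k) //= big1 => [|j /negPf jk].
  by rewrite !mxE !eqxx mulr1 addr0 => /eqP; rewrite subr_eq0 => /eqP.
by rewrite [delta_mx _ _ _ _]mxE jk andbF mulr0.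
Qed.

Lemma dual_expand (t f : seq U) w : size f = size t ->
  (forall i j, (i < size t)%N -> (j < size t)%N -> dot f`_i t`_j = (i == j)%:R) ->
  forall u, u \in t -> dot (\sum_(i < size t) dot w t`_i *: f`_i) u = dot w u.
Proof.
move=> sf ft u ut; rewrite -(nth_index 0 ut); move: (ut); rewrite -index_mem.
move: (index u t) => j jt; rewrite dot_suml (bigD1 (Ordinal jt)) //= big1.
  by rewrite dotZl ft // eqxx mulr1 addr0.
by move=> i; rewrite -val_eqE /= => /negPf ij; rewrite dotZl ft // ij mulr0.
Qed.

Definition L_space X K := forall v, v \in K <-> in_L X v.

(** Two spaces are allowed because an intersection of Lagrangians pairs the intersection of the X's
    with the annihilator of their sum. The dimension bound is sharp, see [conormal_dim]. *)
Lemma conormal_exists X Y : exists K,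
  (forall v, v \in K <-> v.1 \in X /\ perp Y v.2) /\
  (\dim K + \dim Y <= \dim X + n)%N.
Proof.
have [t bt] := basis_extend (subvf Y) (vbasisP Y).
have [f [sf fY ft]] := dual_exists (basis_free bt).
exists <<[seq blk u | u <- vbasis X] ++ [seq wht w | w <- f]>>%VS; split=> [v|]; last first.
  have e := basis_size bt; rewrite size_cat size_tuple dimvf /dim /= mul1n in e.
  have h := dim_span ([seq blk u | u <- vbasis X] ++ [seq wht w | w <- f]).
  rewrite size_cat !size_map size_tuple sf in h.
  by apply: leq_trans (leq_add h (leqnn _)) _; rewrite -addnA leq_add2l addnC e.
split.
  move=> vs; rewrite (coord_span (X := in_tuple _) vs).
  elim/big_ind: _ => [|u w [h1 h2] [h1' h2']|i _].
  - by split; rewrite ?mem0v // => u _; rewrite dot0l.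
  - by split; [apply: memvD | apply: perpD].
  have := mem_nth 0 (ltn_ord i); set u := nth _ _ _; rewrite mem_cat.
  case/orP=> /mapP[w ws e]; rewrite -/u e /=; split.
  - by rewrite memvZ // vbasis_mem.
  - by apply: perpZ => ? _; rewrite dot0l.
  - by rewrite scaler0 mem0v.
  - by apply: perpZ; rewrite -(span_basis (vbasisP Y)); apply: fY.
case=> vX vp; rewrite span_cat [v]blk_wht memv_add //.
  rewrite (coord_vbasis vX) raddf_sum /= memv_suml // => i _.
  by rewrite linearZ /= memvZ // memv_span // map_f // mem_nth ?size_tuple.
have -> : v.2 = \sum_(i < size t) dot v.2 t`_i *: f`_i.
  apply: (dot_eq bt) => u; rewrite mem_cat => /orP[us|ut].
    rewrite dot_suml big1 ?vp ?vbasis_mem // => i _.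
    by rewrite dotZl (fY f`_i) ?mulr0 ?memv_span // mem_nth ?sf.
  by rewrite dual_expand.
rewrite raddf_sum /= memv_suml // => i _.
by rewrite linearZ /= memvZ // memv_span // map_f // mem_nth ?sf.
Qed.

Lemma L_space_exists X : exists K, L_space X K.
Proof. by have [K [hK _]] := conormal_exists X X; exists K. Qed.

(** Extend a basis of the intersection by t to a basis of Y, and let w1 vanish on X and agree with w
    on t; then w - w1 vanishes on Y. *)
Lemma perp_cap X Y w : perp (X :&: Y) w ->
  exists w1 w2, [/\ w = w1 + w2, perp X w1 & perp Y w2].
Proof.
move=> wXY; have bXY := vbasisP (X :&: Y).
have [s bs] := basis_extend (capvSl X Y) bXY.
have [t bt] := basis_extend (capvSr X Y) bXY.
have b := basis_modular bXY bs bt; rewrite catA in b.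
have [f [sf fX ft]] := dual_exists (basis_free b).
pose w1 := \sum_(i < size t) dot w t`_i *: f`_i.
exists w1, (w - w1); split; first by rewrite addrC subrK.
  apply: perp_sum => i _; apply: perpZ; rewrite -(span_basis bs).
  by apply: fX; rewrite mem_nth ?sf.
rewrite -(span_basis bt); apply: perp_span => u.
rewrite dotDl dotNl mem_cat => /orP[uXY|ut].
  rewrite wXY ?(basis_mem bXY) // dot_suml big1 ?subrr // => i _.
  have fi : f`_i \in f by rewrite mem_nth ?sf.
  by rewrite dotZl (fX _ fi) ?mulr0 // memv_span // mem_cat uXY.
by rewrite dual_expand // subrr.
Qed.

Section FrameDef.
Variables (Xc Xb Xa : {vspace U}).

                                                                             
                                                                           
                                                                              
                                                                           
(** Data spanning L_b modulo L_c + L_a. The lists R0, R1, R2 lie in X_c or X_a and drop out; T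
    completes them to a basis of X_b. Covectors killing X_b matter only through their values on the
    meet of X_c and X_a, so they are represented by f, dual to a complement Z of the triple
    intersection there. *)
Record frame := Frame {
  fr_R0 : seq U; fr_R1 : seq U; fr_R2 : seq U; fr_T : seq U;
  fr_Z : seq U; fr_f : seq U;
  fr_cba : basis_of (Xc :&: Xb :&: Xa) fr_R0;
  fr_ba : basis_of (Xb :&: Xa) (fr_R0 ++ fr_R1);
  fr_cb : basis_of (Xc :&: Xb) (fr_R0 ++ fr_R2);
  fr_b : basis_of Xb (fr_R0 ++ fr_R1 ++ fr_R2 ++ fr_T);
  fr_ca : basis_of (Xc :&: Xa) (fr_R0 ++ fr_Z);
  fr_size : size fr_f = size fr_Z;
  fr_perp : forall w, w \in fr_f -> perp Xb w;
  fr_dual : forall i j, (i < size fr_Z)%N -> (j < size fr_Z)%N ->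
    dot fr_f`_i fr_Z`_j = (i == j)%:R }.

Definition fr_list (r : frame) : seq V :=
  [seq blk u | u <- fr_T r] ++ [seq wht w | w <- fr_f r].

(** The volumes compensate every change of basis in [fr_list]. The last sign depends on dimensions
    only; it brings the comparison of [frames_quadruple] into its simple form. *)
Definition fr_vol (r : frame) : F :=
  vol Xb (fr_R0 r ++ fr_R1 r ++ fr_R2 r ++ fr_T r) *
  vol (Xb :&: Xa) (fr_R0 r ++ fr_R1 r) * vol (Xc :&: Xb) (fr_R0 r ++ fr_R2 r) *
  vol (Xc :&: Xa) (fr_R0 r ++ fr_Z r) *
  (-1) ^+ (size (fr_R1 r) * (size (fr_R2 r) + size (fr_T r))).

Lemma fr_capE : ((Xb :&: Xa) :&: (Xc :&: Xb) = Xc :&: Xb :&: Xa)%VS.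
Proof.
apply/vspaceP => v; rewrite !memv_cap.
by case: (v \in Xb); case: (v \in Xa); case: (v \in Xc).
Qed.

Lemma fr_dual_list R0 Z : basis_of (Xc :&: Xb :&: Xa) R0 ->
  basis_of (Xc :&: Xa) (R0 ++ Z) -> exists f : seq U,
  [/\ size f = size Z, (forall w, w \in f -> perp Xb w) &
    (forall i j, (i < size Z)%N -> (j < size Z)%N -> dot f`_i Z`_j = (i == j)%:R)].
Proof.
move=> b0 bZ.
have sb : (Xc :&: Xb :&: Xa <= Xb)%VS.
  by apply/subvP => v; rewrite !memv_cap => /andP[/andP[]].
have [t bt] := basis_extend sb b0.
have e : (Xb :&: (Xc :&: Xa) = Xc :&: Xb :&: Xa)%VS.
  by rewrite [(Xc :&: Xb)%VS]capvC capvA.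
rewrite -e in b0.
have b := basis_modular b0 bt bZ; rewrite catA in b.
have [f [sf fX ft]] := dual_exists (basis_free b).
by exists f; split=> // w /fX; rewrite (span_basis bt).
Qed.

Lemma frame_exists : exists r : frame, True.
Proof.
have b0 := vbasisP (Xc :&: Xb :&: Xa).
have s1 : (Xc :&: Xb :&: Xa <= Xb :&: Xa)%VS.
  by apply/subvP => v; rewrite !memv_cap => /andP[/andP[_ ->] ->].
have s3 : (Xc :&: Xb :&: Xa <= Xc :&: Xa)%VS.
  by apply/subvP => v; rewrite !memv_cap => /andP[/andP[-> _] ->].
have [R1 b1] := basis_extend s1 b0.
have [R2 b2] := basis_extend (capvSl _ _) b0.
have [Z bZ] := basis_extend s3 b0.
have [f [sf fX fd]] := fr_dual_list b0 bZ.
have b12 : basis_of ((Xb :&: Xa) :&: (Xc :&: Xb)) (vbasis (Xc :&: Xb :&: Xa)).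
  by rewrite fr_capE.
have {}b12 := basis_modular b12 b1 b2.
have [|T bT] := basis_extend _ b12 (Y := Xb).
  by rewrite subv_add capvSl capvSr.
by rewrite -!catA in bT; exists (Frame b0 b1 b2 bT bZ sf fX fd).
Qed.

Lemma size_fr_T r : (size (fr_T r) + \dim (Xb :&: Xa) + \dim (Xc :&: Xb) =
  \dim Xb + \dim (Xc :&: Xb :&: Xa))%N.
Proof.
have := basis_size (fr_ba r); have := basis_size (fr_cb r).
have := basis_size (fr_b r); have := basis_size (fr_cba r).
rewrite !size_cat => <- <- <- <-.
by move: (size (fr_R0 r)) (size (fr_R1 r)) (size (fr_R2 r)) (size (fr_T r)); lia.
Qed.

Lemma size_fr_f r :
  (size (fr_f r) + \dim (Xc :&: Xb :&: Xa) = \dim (Xc :&: Xa))%N.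
Proof.
by rewrite -(basis_size (fr_ca r)) -(basis_size (fr_cba r)) size_cat fr_size addnC.
Qed.

Lemma size_fr_list r : (size (fr_list r) + \dim (Xb :&: Xa) + \dim (Xc :&: Xb) =
  \dim Xb + \dim (Xc :&: Xa))%N.
Proof.
have := size_fr_T r; have := size_fr_f r; rewrite size_cat !size_map; lia.
Qed.

(** The black part lies in the span of the basis of X_b. From the covector part subtract its
    expansion in f: the rest vanishes on the meet of X_c and X_a, so [perp_cap] splits it between
    L_c and L_a. *)
Lemma fr_span r K v : (forall u, in_L Xa u -> u \in K) ->
  (forall u, in_L Xc u -> u \in K) -> in_L Xb v -> v \in (<<fr_list r>> + K)%VS.
Proof.
move=> aK cK [v1 v2]; rewrite [v]blk_wht rpredD //.
  move: v1; rewrite -(span_basis (fr_b r)) => v1.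
  rewrite (coord_span (X := in_tuple _) v1) raddf_sum /= memv_suml // => i _.
  rewrite linearZ /= memvZ // {v1}; move: (mem_nth 0 (ltn_ord i)).
  set u := _`_i; rewrite !mem_cat => /or4P[] ur.
  - apply: (subvP (addvSr _ _)); apply/aK/in_L_blk.
    have := basis_mem (fr_cba r) ur; by rewrite memv_cap => /andP[].
  - apply: (subvP (addvSr _ _)); apply/aK/in_L_blk.
    have := basis_mem (v := u) (fr_ba r); rewrite mem_cat ur orbT => /(_ isT).
    by rewrite memv_cap => /andP[].
  - apply: (subvP (addvSr _ _)); apply/cK/in_L_blk.
    have := basis_mem (v := u) (fr_cb r); rewrite mem_cat ur orbT => /(_ isT).
    by rewrite memv_cap => /andP[].
  - by apply: (subvP (addvSl _ _)); rewrite memv_span // mem_cat map_f.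
pose w1 := \sum_(i < size (fr_Z r)) dot v.2 (fr_Z r)`_i *: (fr_f r)`_i.
have w1b : perp Xb w1.
  by apply: perp_sum => i _; apply: perpZ; apply: (@fr_perp r);
     rewrite mem_nth ?fr_size.
have -> : v.2 = w1 + (v.2 - w1) by rewrite addrC subrK.
rewrite raddfD rpredD //.
  apply: (subvP (addvSl _ _)); rewrite raddf_sum /= memv_suml // => i _.
  by rewrite linearZ /= memvZ // memv_span // mem_cat map_f ?orbT // mem_nth ?fr_size.
apply: (subvP (addvSr _ _)).
have [] : exists w2 w3, [/\ v.2 - w1 = w2 + w3, perp Xc w2 & perp Xa w3].
  apply: perp_cap; rewrite -(span_basis (fr_ca r)); apply: perp_span => u.
  rewrite mem_cat dotDl dotNl => /orP[ur|uz].
    have := basis_mem (fr_cba r) ur; rewrite !memv_cap => /andP[/andP[_ ub] _].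
    by rewrite v2 // w1b // subrr.
  by rewrite dual_expand ?fr_size ?subrr //; exact: fr_dual.
move=> w2 [w3 [-> w2c w3a]]; rewrite raddfD rpredD //.
  exact/cK/in_L_wht.
exact/aK/in_L_wht.
Qed.

Lemma fr_list_in_L r v : v \in fr_list r -> in_L Xb v.
Proof.
rewrite mem_cat => /orP[] /mapP[u ur ->].
  by apply/in_L_blk/(basis_mem (fr_b r)); rewrite !mem_cat ur !orbT.
by apply: in_L_wht; apply: (@fr_perp r).
Qed.

End FrameDef.

End Frames.

Lemma wed_map (F : fieldType) (U V : lmodType F) (A : algType F)
    (phi : {linear V -> A}) (h : {linear U -> V}) (s : seq U) :
  wed phi [seq h u | u <- s] = wed (phi \o h) s.
Proof. by rewrite /wed big_map. Qed.

Section FrameUniqueness.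
Variables (F : fieldType) (n : nat).
Hypothesis sqF : forall k : F, k != 0 -> k * k = 1.
Local Notation U := 'rV[F]_n.
Local Notation V := (U * U)%type.
Variables (Xc Xb Xa : {vspace U}) (r r' : frame Xc Xb Xa).
Variables (A : algType F) (phi : {linear V -> A}) (x : A).
Hypothesis phi2 : forall v, phi v * phi v = 0.
Hypothesis phic : forall v, in_L Xc v -> phi v * x = 0.
Hypothesis phia : forall v, in_L Xa v -> phi v * x = 0.

Lemma wed_rel_bases (X : {vspace U}) (s t t' : seq U) :
  basis_of X (s ++ t) -> size t' = size t -> {subset t' <= X} ->
  exists c, wed_rel (<<s>> + 0)%VS t t' c.
Proof.
move=> bst st t'X; apply: wed_rel_exists => // v /t'X.
by rewrite addv0 addvC -span_cat (span_basis bst).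
Qed.

(** If R0, R1, R2 and T change by determinants c0, c1, c2 and c3, each of them occurs to an even
    power in the total. The change of Z is inverse to that of its dual f. All factors therefore
    cancel by [sqF]. *)
Lemma frame_unique :
  fr_vol r *: (wed phi (fr_list r) * x) = fr_vol r' *: (wed phi (fr_list r') * x).
Proof.
case: r r' => R0 R1 R2 T Z f b0 b1 b2 bb bz sf fb fz.
case=> R0' R1' R2' T' Z' f' b0' b1' b2' bb' bz' sf' fb' fz'.
rewrite /fr_vol /fr_list /=.
have s0 : size R0' = size R0 by rewrite (basis_size b0') (basis_size b0).
have s1 : size R1' = size R1.
  by have := basis_size b1'; rewrite -(basis_size b1) !size_cat s0 => /addnI.
have s2 : size R2' = size R2.
  by have := basis_size b2'; rewrite -(basis_size b2) !size_cat s0 => /addnI.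
have sT : size T' = size T.
  have := basis_size bb'; rewrite -(basis_size bb) !size_cat s0 s1 s2.
  by move=> /addnI/addnI/addnI.
have sZ : size Z' = size Z.
  by have := basis_size bz'; rewrite -(basis_size bz) !size_cat s0 => /addnI.
have sub (X : {vspace U}) (s t : seq U) : basis_of X (s ++ t) -> {subset t <= X}.
  by move=> bs v vt; apply: (basis_mem bs); rewrite mem_cat vt orbT.
have [c0 h0] : exists c, wed_rel 0%VS R0 R0' c.
  apply: wed_rel_exists => // v vR; rewrite addv0 (span_basis b0).
  exact: basis_mem b0' vR.
have [c1 h1] := wed_rel_bases b1 s1 (sub _ _ _ b1').
have [c2 h2] := wed_rel_bases b2 s2 (sub _ _ _ b2').
have bbA := bb; rewrite !catA in bbA.
have bbA' := bb'; rewrite !catA in bbA'.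
have [c3 h3] := wed_rel_bases bbA sT (sub _ _ _ bbA').
pose C4 : 'M[F]_(size Z) := \matrix_(i, j) dot f`_j Z'`_i.
pose C5 : 'M[F]_(size Z) := \matrix_(i, j) dot f'`_i Z`_j.
have killR0 w (g : seq U) : (forall w, w \in g -> perp Xb w) -> w \in g ->
    forall u, u \in <<R0>>%VS -> dot w u = 0.
  move=> gb wg u; rewrite (span_basis b0) => uR; apply: (gb _ wg).
  by move: uR; rewrite !memv_cap => /andP[/andP[]].
have memf i : (i < size Z)%N -> f`_i \in f by rewrite -sf => /mem_nth.
have memf' i : (i < size Z)%N -> f'`_i \in f' by rewrite -sZ -sf' => /mem_nth.
have memZ i : (i < size Z)%N -> Z`_i \in Z by move=> /mem_nth.
have memZ' i : (i < size Z)%N -> Z'`_i \in Z' by rewrite -sZ => /mem_nth.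
have decZ i : (i < size Z)%N -> exists2 u, u \in <<R0>>%VS &
    Z'`_i = u + \sum_(j < size Z) dot f`_j Z'`_i *: Z`_j.
  move=> iZ; have := sub _ _ _ bz' _ (memZ' _ iZ).
  rewrite -(span_basis bz) span_cat => /memv_addP[u uR [v vZ e]]; exists u => //.
  rewrite {1}e {1}(coord_span (X := in_tuple Z) vZ); congr (_ + _).
  apply: eq_bigr => j _; congr (_ *: _).
  rewrite e dotDr (killR0 _ _ fb (memf _ _)) // add0r.
  rewrite [v in RHS](coord_span (X := in_tuple Z) vZ) dot_sumr (bigD1 j) //= big1.
    by rewrite dotZr fz // eqxx mulr1 addr0.
  by move=> l /negPf lj; rewrite dotZr fz // val_eqE eq_sym lj mulr0.
have h4 : wed_rel (<<R0>> + 0)%VS Z Z' (\det C4).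
  apply: wed_rel_det => // i; have [u uR e] := decZ i (ltn_ord i).
  rewrite (eq_bigr (fun j : 'I_(size Z) => dot f`_j Z'`_i *: Z`_j)); last first.
    by move=> j _; rewrite mxE.
  by rewrite {1}e addrK addv0.
(* The product of C5 with the transpose of C4 is the matrix of f' against Z', which is the identity
   by duality. *)
have c45 : \det C5 * \det C4 = 1.
  rewrite -(det_tr C4) -det_mulmx -[RHS](det1 _ (size Z)); congr (\det _).
  apply/matrixP => i k; rewrite !mxE.
  have [u uR e] := decZ k (ltn_ord k).
  have := fz' i k; rewrite sZ => /(_ (ltn_ord i) (ltn_ord k)).
  rewrite e dotDr (killR0 _ _ fb' (memf' _ _)) // add0r dot_sumr => <-.
  by apply: eq_bigr => j _; rewrite !mxE dotZr mulrC.
have h5 : wed phi [seq wht w | w <- f'] * x =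
    \det C5 *: (wed phi [seq wht w | w <- f] * x).
  apply: wed_det => [//|||i]; rewrite ?size_map //; first by rewrite sf' sZ.
  (* This difference vanishes on the meet of X_c and X_a, so it is a sum of covectors from L_c and
     L_a, both of which kill x. *)
  pose w := f'`_i - \sum_j C5 i j *: f`_j.
  have wca : perp (Xc :&: Xa) w.
    rewrite -(span_basis bz); apply: perp_span => u; rewrite mem_cat dotDl dotNl.
    have sum_fb : perp Xb (\sum_j C5 i j *: f`_j).
      by apply: perp_sum => j _; apply/perpZ/fb/memf.
    case/orP=> [uR|uZ].
      have uR0 := memv_span uR.
      rewrite (killR0 _ _ fb' (memf' _ _)) // sum_fb ?subrr //.
      move: uR0; rewrite (span_basis b0) !memv_cap => /andP[/andP[]] //.
    have := dual_expand f'`_i sf fz uZ.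
    rewrite (eq_bigr (fun j : 'I_(size Z) => C5 i j *: f`_j)) => [->|j _].
      by rewrite subrr.
    by rewrite mxE.
  have [w1 [w2 [ew w1c w2a]]] := perp_cap wca.
  have nthw g k : [seq wht w | w <- g : seq U]`_k = wht g`_k.
    have [kg|gk] := ltnP k (size g); first by rewrite (nth_map 0).
    by rewrite !nth_default ?size_map.
  have -> : \sum_j C5 i j *: [seq wht w | w <- f]`_j = wht (\sum_j C5 i j *: f`_j).
    rewrite (raddf_sum (@wht F n)); apply: eq_bigr => j _.
    by rewrite nthw -[RHS]/(wht _) whtZ.
  rewrite nthw -raddfB -/w ew raddfD /= raddfD mulrDl.
  by rewrite phic ?phia ?addr0 //; apply: in_L_wht.
have killR y : (forall v, in_L Xc v -> phi v * y = 0) ->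
    (forall v, in_L Xa v -> phi v * y = 0) ->
    forall v, v \in (<<R0 ++ R1 ++ R2>> + 0)%VS -> (phi \o @blk F n) v * y = 0.
  move=> yc ya v; rewrite addv0 => vR.
  apply: (kill_span (phi := phi \o @blk F n)) vR => u.
  move=> uR; suff: phi (blk u) * y = 0 by [].
  move: uR; rewrite !mem_cat => /or3P[] uR.
  - apply/ya/in_L_blk; have := basis_mem b0 uR; by rewrite memv_cap => /andP[].
  - apply/ya/in_L_blk; have := sub _ _ _ b1 _ uR; by rewrite memv_cap => /andP[].
  - apply/yc/in_L_blk; have := sub _ _ _ b2 _ uR; by rewrite memv_cap => /andP[].
have h3' : wed phi [seq blk u | u <- T'] * (wed phi [seq wht w | w <- f'] * x) =
    c3 *: (wed phi [seq blk u | u <- T] * (wed phi [seq wht w | w <- f'] * x)).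
  rewrite [wed phi [seq blk u | u <- T']]wed_map [wed phi [seq blk u | u <- T]]wed_map.
  apply: h3; rewrite -?catA; first by move=> v; exact: phi2.
  by apply: killR => v vL; apply: phi_wed_kill => //; [apply: phic | apply: phia].
rewrite !wed_cat -!mulrA h3' h5 -scalerAr !scalerA; congr (_ *: _).
have h01 := wed_rel_cat s0 s1 h0 h1.
have h02 := wed_rel_cat s0 s2 h0 h2.
have h0z := wed_rel_cat s0 sZ h0 h4.
have h2' : wed_rel (<<R0 ++ R1>> + 0)%VS R2 R2' c2.
  by apply: wed_relS h2; rewrite !addv0 span_cat addvSl.
have s01 : size (R0' ++ R1') = size (R0 ++ R1) by rewrite !size_cat s0 s1.
have h012 := wed_rel_cat s01 s2 h01 h2'.
have s012 : size ((R0' ++ R1') ++ R2') = size ((R0 ++ R1) ++ R2).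
  by rewrite !size_cat s0 s1 s2.
have hb := wed_rel_cat s012 sT h012 h3.
have vb := vol_rel bbA bbA' hb; rewrite -!catA in vb.
have nb := vol_neq0 bb'; rewrite vb mulf_eq0 !mulf_eq0 !negb_or in nb.
case/andP: nb => /andP[/andP[/andP[c0n c1n] c2n] c3n] _.
rewrite vb (vol_rel b1 b1' h01) (vol_rel b2 b2' h02) (vol_rel bz bz' h0z).
rewrite s1 s2 sT; set e := (-1) ^+ _.
have := sqF c0n; have := sqF c1n; have := sqF c2n; have := sqF c3n.
move: (vol _ _) (vol _ _) (vol _ _) (vol _ _) e (\det C5) (\det C4) c45.
move=> w1 w2 w3 w4 e d5 d4 e45 q3 q2 q1 q0.
transitivity ((c0 * c0) * (c0 * c0) * (c1 * c1) * (c2 * c2) * (c3 * c3) * (d5 * d4)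
  * (w1 * w2 * w3 * w4 * e)); last by ring.
by rewrite q0 q1 q2 q3 e45 !mul1r; ring.
Qed.

End FrameUniqueness.

(** * Comparison of the two products of normalised frames for four spaces *)

Lemma vol_swap (F : fieldType) (n : nat) (X : {vspace 'rV[F]_n})
    (u s t v : seq 'rV[F]_n) : basis_of X (u ++ s ++ t ++ v) ->
  vol X (u ++ t ++ s ++ v) = (-1) ^+ (size s * size t) * vol X (u ++ s ++ t ++ v).
Proof.
move=> b; apply: (vol_rel b _ (@wed_rel_swap _ _ _ _ _ _ _)).
by apply: perm_basis_of b; rewrite perm_cat2l perm_catCA.
Qed.

Lemma sign_parity (R : pzRingType) (k l : nat) :
  odd k = odd l -> (-1) ^+ k = (-1) ^+ l :> R.
Proof. by move=> e; rewrite -signr_odd e signr_odd. Qed.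

Lemma sign_vols (R : comNzRingType) (c cb dc db b ab da ca : R)
    (k1 k2 k3 k4 l1 l2 l3 l4 l5 l6 l7 l8 l9 l10 : nat) :
  db * db = 1 -> ca * ca = 1 ->
  odd (k1 + k2 + k3 + k4) =
    odd (l1 + l2 + l3 + l4 + l5 + l6 + l7 + l8 + l9 + l10) ->
  c * cb * dc * ((-1) ^+ k1 * db) * (-1) ^+ k2 *
    (b * ab * db * da * (-1) ^+ k3) * (-1) ^+ k4 =
  (-1) ^+ l1 * ((-1) ^+ l2 * b * ((-1) ^+ l3 * ab) * ((-1) ^+ l4 * cb) * ca *
    (-1) ^+ l5) *
  ((-1) ^+ l6 * c * ((-1) ^+ l7 * ca) * ((-1) ^+ l8 * dc) * ((-1) ^+ l9 * da) *
    (-1) ^+ l10).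
Proof.
move=> qdb qca /(sign_parity R); rewrite !exprD.
move: ((-1) ^+ k1) ((-1) ^+ k2) ((-1) ^+ k3) ((-1) ^+ k4) => K1 K2 K3 K4.
move: ((-1) ^+ l1) ((-1) ^+ l2) ((-1) ^+ l3) ((-1) ^+ l4) ((-1) ^+ l5) => L1 L2 L3 L4 L5.
move: ((-1) ^+ l6) ((-1) ^+ l7) ((-1) ^+ l8) ((-1) ^+ l9) ((-1) ^+ l10) => L6 L7 L8 L9 L10 e.
transitivity (c * cb * dc * b * ab * da * (K1 * K2 * K3 * K4) * (db * db)); first by ring.
by rewrite e qdb -qca; ring.
Qed.

Ltac cases_mem :=
  repeat match goal with |- context[?v \in ?X] => generalize (v \in X) end;
  by do !case.
Ltac caps := apply/subvP => ?; rewrite !memv_cap; cases_mem.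
Ltac capsE := apply/vspaceP => ?; rewrite !memv_cap; cases_mem.
Ltac perm_cat := apply/seq.permP => ?; rewrite !count_cat;
  repeat match goal with |- context[count ?a ?s] => generalize (count a s) end;
  clear; intros; lia.

Lemma count_overflow (v v0 v1 v2 v3 v4 s s0 : nat) : (v4 < v3 ->
  v4 + v2 = v1 + v0 -> s0 + v1 = v -> s + v0 = v3 -> v < s + s0 + v2)%N.
Proof. by lia. Qed.

Lemma count_overflow' (v v0 v1 v2 v3 v4 s s0 : nat) : (v4 < v3 ->
  v4 + v2 = v1 + v0 -> s0 + v0 = v -> s + v1 = v3 -> v < s + s0 + v2)%N.
Proof. by lia. Qed.

Section Quadruple.
Variables (F : fieldType) (n : nat).
Hypothesis sqF : forall k : F, k != 0 -> k * k = 1.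
Local Notation U := 'rV[F]_n.
Local Notation V := (U * U)%type.

Section FrameKill.
Variables (A : algType F) (phi : {linear V -> A}) (x : A).
Hypothesis phi2 : forall v, phi v * phi v = 0.

(** L_b is spanned by the frame modulo L_c + L_a, so it dies next to the wedge of the frame. Hence
    this wedge can serve as the x of [frame_unique] for a second frame that has X_b as an outer
    space. *)
Lemma fr_kill (Xc Xb Xa : {vspace U}) (r : frame Xc Xb Xa) v :
  (forall v, in_L Xc v -> phi v * x = 0) -> (forall v, in_L Xa v -> phi v * x = 0) ->
  in_L Xb v -> phi v * (wed phi (fr_list r) * x) = 0.
Proof.
move=> kc ka vL.
have [Kc hc] := L_space_exists Xc; have [Ka ha] := L_space_exists Xa.
have /memv_addP[v1 v1s [v2 v2K ->]] : v \in (<<fr_list r>> + (Kc + Ka))%VS.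
  apply: fr_span vL => u /=; first by move/ha; apply: (subvP (addvSr _ _)).
  by move/hc; apply: (subvP (addvSl _ _)).
rewrite raddfD mulrDl -[RHS]addr0; congr (_ + _).
  by apply: kill_span v1s => u us; rewrite mulrA phi_wed_mem // mul0r.
apply: phi_wed_kill => //; case/memv_addP: v2K => u /hc uc [w /ha wa ->].
by rewrite raddfD mulrDl kc ?ka ?addr0.
Qed.

End FrameKill.

Variables (Xd Xc Xb Xa : {vspace U}).
Variables (A : algType F) (phi : {linear V -> A}).
Hypothesis phi2 : forall v, phi v * phi v = 0.
Hypothesis phid : forall v, in_L Xd v -> phi v = 0.
Hypothesis phia : forall v, in_L Xa v -> phi v = 0.

Let N Yc Yb Ya (r : frame Yc Yb Ya) := fr_vol r *: wed phi (fr_list r).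

Lemma frame_unique1 (Xy : {vspace U}) (r r' : frame Xd Xy Xa) : N r = N r'.
Proof.
have := frame_unique sqF r r' phi2 (x := 1).
rewrite !mulr1; apply=> v; first by move/phid->; rewrite mul0r.
by move/phia->; rewrite mul0r.
Qed.

Lemma frame_unique2 (r1 r1' : frame Xd Xc Xb) (r2 r2' : frame Xd Xb Xa) :
  N r1 * N r2 = N r1' * N r2'.
Proof.
rewrite (frame_unique1 r2 r2') /N -!scalerAl; apply: (frame_unique sqF) => // v vL.
  by rewrite (phid vL) mul0r.
rewrite -scalerAr -[wed _ (fr_list r2')]mulr1 fr_kill ?scaler0 // => u uL.
  by rewrite phid // mul0r.
by rewrite phia // mul0r.
Qed.

Lemma frame_unique3 (r3 r3' : frame Xc Xb Xa) (r4 r4' : frame Xd Xc Xa) :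
  N r3 * N r4 = N r3' * N r4'.
Proof.
rewrite (frame_unique1 r4 r4') /N -!scalerAl; apply: (frame_unique sqF) => // v vL.
  rewrite -scalerAr -[wed _ (fr_list r4')]mulr1 fr_kill ?scaler0 // => u uL.
    by rewrite phid // mul0r.
  by rewrite phia // mul0r.
by rewrite (phia vL) mul0r.
Qed.

Lemma phi_wht_ca w : perp (Xd :&: Xa) w -> phi (wht w) = 0.
Proof.
move=> /perp_cap[w1 [w2 [-> w1d w2a]]]; rewrite whtD raddfD /=.
by rewrite phid ?phia ?addr0 //; apply: in_L_wht.
Qed.

Local Notation I4 := (Xd :&: Xc :&: Xb :&: Xa)%VS.

(** Covectors killing [I4], taken modulo those killing the meet of X_d and X_a, form a space of
    dimension the difference of the two dimensions; a longer wedge vanishes. *)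
Lemma wed_wht_overflow (g : seq U) : (forall w, w \in g -> perp I4 w) ->
  (\dim (Xd :&: Xa) < size g + \dim I4)%N -> wed phi [seq wht w | w <- g] = 0.
Proof.
move=> gI sg; have b0 := vbasisP I4.
have sI : (I4 <= Xd :&: Xa)%VS.
  by apply/subvP => v; rewrite !memv_cap => /andP[/andP[/andP[-> _] _] ->].
have [z bz] := basis_extend sI b0.
have [f [sf fI ft]] := dual_exists (basis_free bz).
have [Kd hd] := L_space_exists Xd; have [Ka ha] := L_space_exists Xa.
rewrite -[LHS]mulr1; apply: (@wed_rel_overflow _ _ (Kd + Ka)%VS [seq wht w | w <- f]) => //.
- move=> v /memv_addP[u /hd uL [w /ha wL ->]].
  by rewrite raddfD /= phid // phia // addr0 mul0r.
- have e := basis_size bz; rewrite size_cat (basis_size b0) addnC in e.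
  by move: sg; rewrite -e ltn_add2r !size_map sf.
move=> _ /mapP[w wg ->].
pose w1 := \sum_(i < size z) dot w z`_i *: f`_i.
have -> : w = w1 + (w - w1) by rewrite addrC subrK.
rewrite whtD memv_add //.
  rewrite raddf_sum /= memv_suml // => i _.
  by rewrite whtZ memvZ // memv_span // map_f // mem_nth ?sf.
have : perp (Xd :&: Xa) (w - w1).
  rewrite -(span_basis bz); apply: perp_span => u; rewrite mem_cat dotDl dotNl.
  case/orP=> [uI|uz]; last by rewrite dual_expand // subrr.
  rewrite (gI _ wg) ?(basis_mem b0) // dot_suml big1 ?subrr // => i _.
  by rewrite dotZl (fI f`_i) ?mulr0 ?memv_span // mem_nth ?sf.
move=> /perp_cap[w2 [w3 [-> w2d w3a]]]; rewrite whtD memv_add //.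
  by apply/hd/in_L_wht.
by apply/ha/in_L_wht.
Qed.

Lemma frames_overflow Yc Yb Ya Yc' Yb' Ya' (r : frame Yc Yb Ya) (r' : frame Yc' Yb' Ya') :
  (I4 <= Yb)%VS -> (I4 <= Yb')%VS ->
  (\dim (Xd :&: Xa) < size (fr_f r) + size (fr_f r') + \dim I4)%N ->
  wed phi (fr_list r) * wed phi (fr_list r') = 0.
Proof.
move=> sI sI' lt_dim; rewrite !wed_cat.
have := wedC phi2 [seq wht w | w <- fr_f r] [seq blk u | u <- fr_T r'].
have : wed phi [seq wht w | w <- fr_f r] * wed phi [seq wht w | w <- fr_f r'] = 0.
  rewrite -wed_cat -map_cat wed_wht_overflow ?size_cat //.
  move=> w; rewrite mem_cat => /orP[wr|wr] u uI.
    exact: fr_perp wr _ (subvP sI _ uI).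
  exact: fr_perp wr _ (subvP sI' _ uI).
move: (wed _ _) (wed _ _) (wed _ _) (wed _ _) ((-1) ^+ _) => w1 w2 w3 w4 k.
move=> e0 e; rewrite -mulrA (mulrA w4) e -scalerAl -(mulrA w2) e0.
by rewrite mulr0 scaler0 mulr0.
Qed.

(** The two concatenated lists have equal length and both span L_b + L_c modulo L_d + L_a, so their
    wedges differ by a nonzero scalar. *)
Lemma frames_both_zero (r1 : frame Xd Xc Xb) (r2 : frame Xd Xb Xa)
    (r3 : frame Xc Xb Xa) (r4 : frame Xd Xc Xa) :
  (wed phi (fr_list r1) * wed phi (fr_list r2) == 0) =
  (wed phi (fr_list r3) * wed phi (fr_list r4) == 0).
Proof.
have [Kd hd] := L_space_exists Xd; have [Ka ha] := L_space_exists Xa.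
pose K := (Kd + Ka)%VS.
have dK v : in_L Xd v -> v \in K by move/hd; apply: (subvP (addvSl _ _)).
have aK v : in_L Xa v -> v \in K by move/ha; apply: (subvP (addvSr _ _)).
have c4 v : in_L Xc v -> v \in (<<fr_list r4>> + K)%VS by apply: fr_span.
have b2 v : in_L Xb v -> v \in (<<fr_list r2>> + K)%VS by apply: fr_span.
have KS S v : v \in K -> v \in (S + K)%VS by apply: (subvP (addvSr _ _)).
have b3 v : in_L Xb v -> v \in (<<fr_list r3>> + (<<fr_list r4>> + K))%VS.
  by apply: fr_span => u; [move/aK/KS | move/c4].
have c1 v : in_L Xc v -> v \in (<<fr_list r1>> + (<<fr_list r2>> + K))%VS.
  by apply: fr_span => u; [move/b2 | move/dK/KS].
have sz : size (fr_list r1 ++ fr_list r2) = size (fr_list r3 ++ fr_list r4).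
  have := size_fr_list r1; have := size_fr_list r2.
  have := size_fr_list r3; have := size_fr_list r4; rewrite !size_cat; lia.
have Kx v : v \in K -> phi v * 1 = 0.
  case/memv_addP=> u /hd uL [w /ha wL ->].
  by rewrite raddfD /= phid // phia // addr0 mul0r.
have [||c c0 hc] := wed_rel_unit sz (K := K).
- move=> v; rewrite mem_cat span_cat -addvA => /orP[] /fr_list_in_L vL.
    by apply: (subvP (addvSr _ _)); apply: c4.
  exact: b3.
- move=> v; rewrite mem_cat span_cat -addvA => /orP[] /fr_list_in_L vL.
    by apply: (subvP (addvSr _ _)); apply: b2.
  exact: c1.
have := hc _ _ _ phi2 Kx; rewrite !mulr1 !wed_cat => ->.
by rewrite scaler_eq0 (negPf c0).
Qed.

Lemma wed_reverse (X Y W : seq V) z :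
  wed phi X * (wed phi Y * (wed phi W * z)) =
  (-1) ^+ (size X * size Y + size X * size W + size Y * size W) *:
    (wed phi W * (wed phi Y * (wed phi X * z))).
Proof.
rewrite !mulrA (wedC phi2 X Y) -2!scalerAl -[_ * wed phi X * wed phi W]mulrA.
rewrite (wedC phi2 X W) -scalerAr -scalerAl mulrA (wedC phi2 Y W) -2!scalerAl.
by rewrite !scalerA -!exprD.
Qed.

(** By uniqueness the frames may be replaced by four cut out of one common basis. Both products then
    contain the same vectors, as three blocks in opposite orders followed by a common tail, and the
    four normalisations differ by block permutations. *)
Lemma frames_quadruple_planar (r1 : frame Xd Xc Xb) (r2 : frame Xd Xb Xa)
    (r3 : frame Xc Xb Xa) (r4 : frame Xd Xc Xa) :
  (Xd :&: Xb <= Xd :&: Xb :&: Xa + Xd :&: Xc :&: Xb)%VS ->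
  (Xc :&: Xa <= Xc :&: Xb :&: Xa + Xd :&: Xc :&: Xa)%VS ->
  N r1 * N r2 =
  (-1) ^+ (size (fr_list r3) * (\dim Xc - \dim (Xd :&: Xc))) *: (N r3 * N r4).
Proof.
move=> hdb hca.
(* Adapted basis: [al] for the fourfold intersection; s, p, r, q extend it to the triple
   intersections dcb, dba, cba, dca; zab, zbc, zcd, zda to the meets of cyclic neighbours; tb and tc
   to X_b and X_c. By the two hypotheses the meets db and ca need no further vectors. *)
have [al bal] : exists al, basis_of I4 al by exists (vbasis I4); exact: vbasisP.
have [|s bs] := basis_extend (Y := (Xd :&: Xc :&: Xb)%VS) _ bal; first by caps.
have [|p bp] := basis_extend (Y := (Xd :&: Xb :&: Xa)%VS) _ bal; first by caps.
have [|r br] := basis_extend (Y := (Xc :&: Xb :&: Xa)%VS) _ bal; first by caps.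
have [|q bq] := basis_extend (Y := (Xd :&: Xc :&: Xa)%VS) _ bal; first by caps.
have Bdb : basis_of (Xd :&: Xb) (al ++ p ++ s).
  have -> : (Xd :&: Xb = Xd :&: Xb :&: Xa + Xd :&: Xc :&: Xb)%VS.
    by apply: subv_anti; rewrite hdb subv_add andTb; apply/andP; split; caps.
  by apply: basis_modular bp bs; rewrite (_ : (_ :&: _)%VS = I4) //; capsE.
have Bca : basis_of (Xc :&: Xa) (al ++ r ++ q).
  have -> : (Xc :&: Xa = Xc :&: Xb :&: Xa + Xd :&: Xc :&: Xa)%VS.
    by apply: subv_anti; rewrite hca subv_add andTb; apply/andP; split; caps.
  by apply: basis_modular br bq; rewrite (_ : (_ :&: _)%VS = I4) //; capsE.
have [zab Bab] : exists z, basis_of (Xb :&: Xa) (al ++ p ++ r ++ z).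
  have b : basis_of (Xd :&: Xb :&: Xa + Xc :&: Xb :&: Xa) (al ++ p ++ r).
    by apply: basis_modular bp br; rewrite (_ : (_ :&: _)%VS = I4) //; capsE.
  have [|z] := basis_extend (Y := (Xb :&: Xa)%VS) _ b; last by rewrite -!catA; exists z.
  by rewrite subv_add; apply/andP; split; caps.
have [zbc Bcb] : exists z, basis_of (Xc :&: Xb) (al ++ s ++ r ++ z).
  have b : basis_of (Xd :&: Xc :&: Xb + Xc :&: Xb :&: Xa) (al ++ s ++ r).
    by apply: basis_modular bs br; rewrite (_ : (_ :&: _)%VS = I4) //; capsE.
  have [|z] := basis_extend (Y := (Xc :&: Xb)%VS) _ b; last by rewrite -!catA; exists z.
  by rewrite subv_add; apply/andP; split; caps.
have [zcd Bdc] : exists z, basis_of (Xd :&: Xc) (al ++ s ++ q ++ z).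
  have b : basis_of (Xd :&: Xc :&: Xb + Xd :&: Xc :&: Xa) (al ++ s ++ q).
    by apply: basis_modular bs bq; rewrite (_ : (_ :&: _)%VS = I4) //; capsE.
  have [|z] := basis_extend (Y := (Xd :&: Xc)%VS) _ b; last by rewrite -!catA; exists z.
  by rewrite subv_add; apply/andP; split; caps.
have [zda Bda] : exists z, basis_of (Xd :&: Xa) (al ++ p ++ q ++ z).
  have b : basis_of (Xd :&: Xb :&: Xa + Xd :&: Xc :&: Xa) (al ++ p ++ q).
    by apply: basis_modular bp bq; rewrite (_ : (_ :&: _)%VS = I4) //; capsE.
  have [|z] := basis_extend (Y := (Xd :&: Xa)%VS) _ b; last by rewrite -!catA; exists z.
  by rewrite subv_add; apply/andP; split; caps.
have [tb Bb] : exists t, basis_of Xb (al ++ p ++ r ++ zab ++ s ++ zbc ++ t).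
  have b : basis_of (Xb :&: Xa + Xc :&: Xb) ((al ++ r) ++ (p ++ zab) ++ s ++ zbc).
    apply: basis_modular; first by rewrite (_ : (_ :&: _)%VS = Xc :&: Xb :&: Xa)%VS //; capsE.
      by apply: perm_basis_of Bab; perm_cat.
    by apply: perm_basis_of Bcb; perm_cat.
  have [|t bt] := basis_extend (Y := (Xb)%VS) _ b; last first.
    by exists t; apply: perm_basis_of bt; perm_cat.
  by rewrite subv_add; apply/andP; split; caps.
have [tc Bc] : exists t, basis_of Xc (al ++ (s ++ r ++ zbc) ++ q ++ zcd ++ t).
  have b : basis_of (Xc :&: Xb + Xd :&: Xc) ((al ++ s) ++ (r ++ zbc) ++ q ++ zcd).
    apply: basis_modular; first by rewrite (_ : (_ :&: _)%VS = Xd :&: Xc :&: Xb)%VS //; capsE.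
      by rewrite -!catA.
    by rewrite -!catA.
  have [|t bt] := basis_extend (Y := (Xc)%VS) _ b; last first.
    by exists t; move: bt; rewrite -!catA.
  by rewrite subv_add; apply/andP; split; caps.
have Bda1 : basis_of (Xd :&: Xa) ((al ++ p) ++ q ++ zda) by rewrite -!catA.
have Bda2 : basis_of (Xd :&: Xa) ((al ++ q) ++ p ++ zda).
  by apply: perm_basis_of Bda; perm_cat.
have [f1 [sf1 f1b f1d]] := fr_dual_list bp Bda1.
have [f2 [sf2 f2c f2d]] := fr_dual_list bq Bda2.
rewrite size_cat in sf1 f1d; rewrite size_cat in sf2 f2d.
have f1p_size : size (take (size q) f1) = size q by rewrite size_takel // sf1 leq_addr.
have f2p_size : size (take (size p) f2) = size p by rewrite size_takel // sf2 leq_addr.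
(* The tails of f1 and f2, dual to zda, agree on the meet of X_d and X_a: on p one vanishes because
   p lies in X_b and the other by duality, and on q the roles are exchanged. So their images under
   [phi] coincide. *)
have wz : wed phi [seq wht w | w <- drop (size q) f1] =
    wed phi [seq wht w | w <- drop (size p) f2].
  have sz1 : size (drop (size q) f1) = size zda by rewrite size_drop sf1 addKn.
  have sz2 : size (drop (size p) f2) = size zda by rewrite size_drop sf2 addKn.
  rewrite /wed !big_map (big_nth 0) [RHS](big_nth 0) sz1 sz2 big_nat [RHS]big_nat.
  apply: eq_bigr => k /andP[_ kz]; rewrite !nth_drop.
  have kq : (size q + k < size q + size zda)%N by rewrite ltn_add2l.
  have kp : (size p + k < size p + size zda)%N by rewrite ltn_add2l.
  have m1 : f1`_(size q + k) \in f1 by rewrite mem_nth ?sf1.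
  have m2 : f2`_(size p + k) \in f2 by rewrite mem_nth ?sf2.
  apply/eqP; rewrite -subr_eq0 -raddfB -raddfB; apply/eqP/phi_wht_ca.
  rewrite -(span_basis Bda); apply: perp_span => u; rewrite dotDl dotNl.
  rewrite mem_cat => /orP[ua|].
    have := basis_mem bal ua; rewrite !memv_cap => /andP[/andP[/andP[_ uc] ub] _].
    by rewrite (f1b _ m1) // (f2c _ m2) // subrr.
  rewrite mem_cat => /orP[up|].
    have := basis_mem (v := u) bp; rewrite mem_cat up orbT !memv_cap => /(_ isT).
    case/andP=> /andP[_ ub] _; rewrite (f1b _ m1) // sub0r.
    have ip : (index u p < size p)%N by rewrite index_mem.
    have := f2d _ _ kp (leq_trans ip (leq_addr _ _)).
    rewrite nth_cat ip nth_index // => ->.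
    by rewrite eqn_leq leqNgt (leq_trans ip) ?leq_addr ?oppr0.
  rewrite mem_cat => /orP[uq|uz].
    have := basis_mem (v := u) bq; rewrite mem_cat uq orbT !memv_cap => /(_ isT).
    case/andP=> /andP[_ uc] _; rewrite (f2c _ m2) // subr0.
    have iq : (index u q < size q)%N by rewrite index_mem.
    have := f1d _ _ kq (leq_trans iq (leq_addr _ _)).
    by rewrite nth_cat iq nth_index // => ->; rewrite eqn_leq leqNgt (leq_trans iq) ?leq_addr.
  have iz : (index u zda < size zda)%N by rewrite index_mem.
  have := f1d _ (size q + index u zda)%N kq; rewrite ltn_add2l => /(_ iz).
  have := f2d _ (size p + index u zda)%N kp; rewrite ltn_add2l => /(_ iz).
  rewrite !nth_cat !ltnNge !leq_addr /= !addKn nth_index // => -> ->.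
  by rewrite !eqn_add2l subrr.
have pf1 w : w \in take (size q) f1 -> perp Xb w by move/mem_take; apply: f1b.
have pf2 w : w \in take (size p) f2 -> perp Xc w by move/mem_take; apply: f2c.
have df1 i j : (i < size q)%N -> (j < size q)%N ->
    dot (take (size q) f1)`_i q`_j = (i == j)%:R.
  move=> iq jq; rewrite nth_take //.
  have := f1d _ _ (ltn_addr (size zda) iq) (ltn_addr (size zda) jq).
  by rewrite nth_cat jq.
have df2 i j : (i < size p)%N -> (j < size p)%N ->
    dot (take (size p) f2)`_i p`_j = (i == j)%:R.
  move=> ip jp; rewrite nth_take //.
  have := f2d _ _ (ltn_addr (size zda) ip) (ltn_addr (size zda) jp).
  by rewrite nth_cat jp.
have c11 : basis_of (Xc :&: Xb) ((al ++ s) ++ (r ++ zbc)) by rewrite -!catA.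
have c12 : basis_of (Xd :&: Xc) ((al ++ s) ++ (q ++ zcd)) by rewrite -!catA.
have c13 : basis_of Xc ((al ++ s) ++ (r ++ zbc) ++ (q ++ zcd) ++ tc).
  by move: Bc; rewrite -!catA.
have c14 : basis_of (Xd :&: Xb) ((al ++ s) ++ p).
  by apply: perm_basis_of Bdb; perm_cat.
pose r1' := Frame bs c11 c12 c13 c14 f2p_size pf2 df2.
have c21 : basis_of (Xb :&: Xa) ((al ++ p) ++ (r ++ zab)) by rewrite -!catA.
have c22 : basis_of (Xd :&: Xb) ((al ++ p) ++ s) by rewrite -!catA.
have c23 : basis_of Xb ((al ++ p) ++ (r ++ zab) ++ s ++ (zbc ++ tb)).
  by move: Bb; rewrite -!catA.
have sf1' : size f1 = size (q ++ zda) by rewrite size_cat.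
have f1d' i j : (i < size (q ++ zda))%N -> (j < size (q ++ zda))%N ->
  dot f1`_i (q ++ zda)`_j = (i == j)%:R by rewrite size_cat; apply: f1d.
pose r2' := Frame bp c21 c22 c23 Bda1 sf1' f1b f1d'.
have c31 : basis_of (Xb :&: Xa) ((al ++ r) ++ (p ++ zab)).
  by apply: perm_basis_of Bab; perm_cat.
have c32 : basis_of (Xc :&: Xb) ((al ++ r) ++ (s ++ zbc)).
  by apply: perm_basis_of Bcb; perm_cat.
have c33 : basis_of Xb ((al ++ r) ++ (p ++ zab) ++ (s ++ zbc) ++ tb).
  by apply: perm_basis_of Bb; perm_cat.
have c34 : basis_of (Xc :&: Xa) ((al ++ r) ++ q) by rewrite -!catA.
pose r3' := Frame br c31 c32 c33 c34 f1p_size pf1 df1.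
have c41 : basis_of (Xc :&: Xa) ((al ++ q) ++ r).
  by apply: perm_basis_of Bca; perm_cat.
have c42 : basis_of (Xd :&: Xc) ((al ++ q) ++ (s ++ zcd)).
  by apply: perm_basis_of Bdc; perm_cat.
have c43 : basis_of Xc ((al ++ q) ++ r ++ (s ++ zcd) ++ (zbc ++ tc)).
  by apply: perm_basis_of Bc; perm_cat.
have sf2' : size f2 = size (p ++ zda) by rewrite size_cat.
have f2d' i j : (i < size (p ++ zda))%N -> (j < size (p ++ zda))%N ->
  dot f2`_i (p ++ zda)`_j = (i == j)%:R by rewrite size_cat; apply: f2d.
pose r4' := Frame bq c41 c42 c43 Bda2 sf2' f2c f2d'.
have E1 : size (fr_list r3) = (size tb + size q)%N.
  have := size_fr_list r3; rewrite -(size_fr_list r3').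
  rewrite /= /fr_list !size_cat !size_map /= f1p_size.
  by move=> /addIn /addIn.
have E2 : (\dim Xc - \dim (Xd :&: Xc) = size r + size zbc + size tc)%N.
  rewrite -(basis_size c13) -(basis_size c12) !size_cat.
  move: (size al) (size s) (size r) (size zbc) (size q) (size zcd) (size tc).
  by clear; lia.
rewrite (frame_unique2 r1 r1' r2 r2') (frame_unique3 r3 r3' r4 r4') E1 E2 /N.
have W1 : wed phi (fr_list r1') = wed phi [seq blk u | u <- tc] *
    wed phi [seq wht w | w <- take (size p) f2] by rewrite -wed_cat.
have W2 : wed phi (fr_list r2') = wed phi [seq blk u | u <- zbc] *
    (wed phi [seq blk u | u <- tb] * (wed phi [seq wht w | w <- take (size q) f1] *
     wed phi [seq wht w | w <- drop (size p) f2])).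
  by rewrite -wz -!wed_cat -map_cat cat_take_drop catA -map_cat.
have W3 : wed phi (fr_list r3') = wed phi [seq blk u | u <- tb] *
    wed phi [seq wht w | w <- take (size q) f1] by rewrite -wed_cat.
have W4 : wed phi (fr_list r4') = wed phi [seq blk u | u <- zbc] *
    (wed phi [seq blk u | u <- tc] * (wed phi [seq wht w | w <- take (size p) f2] *
     wed phi [seq wht w | w <- drop (size p) f2])).
  by rewrite -!wed_cat -map_cat cat_take_drop catA -map_cat.
(* The blocks are (tc, head of f2), zbc and (tb, head of f1), with the common tail behind them. *)
have WE : wed phi (fr_list r1') * wed phi (fr_list r2') =
    (-1) ^+ ((size tc + size p) * size zbc + (size tc + size p) * (size tb + size q)
             + size zbc * (size tb + size q)) *:
    (wed phi (fr_list r3') * wed phi (fr_list r4')).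
  have := @wed_reverse ([seq blk u | u <- tc] ++ [seq wht w | w <- take (size p) f2])
    [seq blk u | u <- zbc] ([seq blk u | u <- tb] ++ [seq wht w | w <- take (size q) f1])
    (wed phi [seq wht w | w <- drop (size p) f2]).
  by rewrite W1 W2 W3 W4 ?wed_cat !size_cat !size_map f1p_size f2p_size -!mulrA.
rewrite -!scalerAl -!scalerAr WE !scalerA; congr (_ *: _).
(* Each space carries the same basis vectors in the frames in which it occurs, so its volumes differ
   by the sign of a block permutation. *)
have vb : vol Xb (fr_R0 r3' ++ fr_R1 r3' ++ fr_R2 r3' ++ fr_T r3') = (-1) ^+ (size p * size r) *
    vol Xb (fr_R0 r2' ++ fr_R1 r2' ++ fr_R2 r2' ++ fr_T r2').
  by rewrite /= -!catA; apply: vol_swap.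
have vc : vol Xc (fr_R0 r4' ++ fr_R1 r4' ++ fr_R2 r4' ++ fr_T r4') =
    (-1) ^+ ((size s + size r + size zbc) * size q + size s * size r + size zbc * size zcd) *
    vol Xc (fr_R0 r1' ++ fr_R1 r1' ++ fr_R2 r1' ++ fr_T r1').
  rewrite /= -!catA.
  have e1 := vol_swap Bc; rewrite !size_cat -!catA in e1.
  have b1 : basis_of Xc ((al ++ q) ++ s ++ r ++ (zbc ++ zcd ++ tc)).
    by apply: perm_basis_of Bc; perm_cat.
  have e2 := vol_swap b1; rewrite -!catA in e2.
  have b2 : basis_of Xc ((al ++ q ++ r ++ s) ++ zbc ++ zcd ++ tc).
    by apply: perm_basis_of Bc; perm_cat.
  have e3 := vol_swap b2; rewrite -!catA in e3.
  rewrite e3 e2 e1 !mulrA -!exprD; congr (_ ^+ _ * _).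
  by move: (size s) (size r) (size zbc) (size zcd) (size q); clear; lia.
have vda : vol (Xd :&: Xa) (fr_R0 r4' ++ fr_Z r4') =
    (-1) ^+ (size p * size q) * vol (Xd :&: Xa) (fr_R0 r2' ++ fr_Z r2').
  by rewrite /= -!catA; apply: vol_swap.
have vab : vol (Xb :&: Xa) (fr_R0 r3' ++ fr_R1 r3') =
    (-1) ^+ (size p * size r) * vol (Xb :&: Xa) (fr_R0 r2' ++ fr_R1 r2').
  by rewrite /= -!catA; apply: vol_swap.
have vcb : vol (Xc :&: Xb) (fr_R0 r3' ++ fr_R2 r3') =
    (-1) ^+ (size s * size r) * vol (Xc :&: Xb) (fr_R0 r1' ++ fr_R1 r1').
  by rewrite /= -!catA; apply: vol_swap.
have vdc : vol (Xd :&: Xc) (fr_R0 r4' ++ fr_R2 r4') =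
    (-1) ^+ (size s * size q) * vol (Xd :&: Xc) (fr_R0 r1' ++ fr_R2 r1').
  by rewrite /= -!catA; apply: vol_swap.
have vdb : vol (Xd :&: Xb) (fr_R0 r1' ++ fr_Z r1') =
    (-1) ^+ (size p * size s) * vol (Xd :&: Xb) (fr_R0 r2' ++ fr_R2 r2').
  have := @vol_swap _ _ _ al p s [::]; rewrite /= !cats0 -!catA; exact.
have vca : vol (Xc :&: Xa) (fr_R0 r4' ++ fr_R1 r4') =
    (-1) ^+ (size r * size q) * vol (Xc :&: Xa) (fr_R0 r3' ++ fr_Z r3').
  have := @vol_swap _ _ _ al r q [::]; rewrite /= !cats0 -!catA; exact.
have qdb := sqF (vol_neq0 c22); have qca := sqF (vol_neq0 c34).
rewrite /fr_vol vb vc vda vab vcb vdc vdb vca.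
apply: sign_vols qdb qca _; rewrite /= !size_cat.
move: (size s) (size r) (size zbc) (size zcd) (size q) (size p) (size zab) (size tb) (size tc).
clear=> s r zbc zcd q p zab tb tc; rewrite !(oddD, oddM).
move: (odd s) (odd r) (odd zbc) (odd zcd) (odd q) (odd p) (odd zab) (odd tb) (odd tc).
by do !case.
Qed.

(** If one of the two sum conditions of the planar case fails, the covectors of the corresponding
    pair of frames are too many for [wed_wht_overflow]; one product vanishes, and by
    [frames_both_zero] so does the other. *)
Lemma frames_quadruple (r1 : frame Xd Xc Xb) (r2 : frame Xd Xb Xa)
    (r3 : frame Xc Xb Xa) (r4 : frame Xd Xc Xa) :
  N r1 * N r2 =
  (-1) ^+ (size (fr_list r3) * (\dim Xc - \dim (Xd :&: Xc))) *: (N r3 * N r4).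
Proof.
have zero : wed phi (fr_list r1) * wed phi (fr_list r2) == 0 -> N r1 * N r2 =
    (-1) ^+ (size (fr_list r3) * (\dim Xc - \dim (Xd :&: Xc))) *: (N r3 * N r4).
  move=> z; move: (z); rewrite (frames_both_zero r1 r2 r3 r4) => z'.
  rewrite /N -!scalerAl -!scalerAr (eqP z) (eqP z').
  by rewrite !scaler0.
have capE (X Y : {vspace U}) : X =i Y -> X = Y by move=> e; apply/vspaceP.
have capd : ((Xd :&: Xb :&: Xa) :&: (Xd :&: Xc :&: Xb) = I4)%VS.
  apply/capE => v; rewrite !memv_cap.
  by case: (v \in Xd); case: (v \in Xc); case: (v \in Xb); case: (v \in Xa).
have capc : ((Xc :&: Xb :&: Xa) :&: (Xd :&: Xc :&: Xa) = I4)%VS.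
  apply/capE => v; rewrite !memv_cap.
  by case: (v \in Xd); case: (v \in Xc); case: (v \in Xb); case: (v \in Xa).
have I4b : (I4 <= Xb)%VS by apply/subvP => v; rewrite !memv_cap => /andP[/andP[]].
have I4c : (I4 <= Xc)%VS.
  by apply/subvP => v; rewrite !memv_cap => /andP[/andP[/andP[]]].
have sdb : (Xd :&: Xb :&: Xa + Xd :&: Xc :&: Xb <= Xd :&: Xb)%VS.
  rewrite subv_add capvSl; apply/subvP => v; rewrite !memv_cap.
  by case/andP=> /andP[-> _] ->.
have sca : (Xc :&: Xb :&: Xa + Xd :&: Xc :&: Xa <= Xc :&: Xa)%VS.
  rewrite subv_add; apply/andP; split; apply/subvP => v; rewrite !memv_cap.
    by case/andP=> /andP[-> _] ->.
  by case/andP=> /andP[_ ->] ->.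
have [hdb|/negP ndb] := boolP (Xd :&: Xb <= Xd :&: Xb :&: Xa + Xd :&: Xc :&: Xb)%VS; last first.
  apply: zero; apply/eqP; apply: frames_overflow => //.
  have := size_fr_f r1; have := size_fr_f r2.
  have := dimv_sum_cap (Xd :&: Xb :&: Xa) (Xd :&: Xc :&: Xb); rewrite capd.
  have : (\dim (Xd :&: Xb :&: Xa + Xd :&: Xc :&: Xb) < \dim (Xd :&: Xb))%N.
    rewrite ltn_neqAle dimvS // andbT; apply/negP => /eqP e.
    by apply: ndb; rewrite -(geq_leqif (dimv_leqif_sup sdb)) e.
  exact: count_overflow.
have [hca|/negP nca] := boolP (Xc :&: Xa <= Xc :&: Xb :&: Xa + Xd :&: Xc :&: Xa)%VS; last first.
  apply: zero; rewrite (frames_both_zero r1 r2 r3 r4); apply/eqP.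
  apply: frames_overflow => //.
  have := size_fr_f r3; have := size_fr_f r4.
  have := dimv_sum_cap (Xc :&: Xb :&: Xa) (Xd :&: Xc :&: Xa); rewrite capc.
  have : (\dim (Xc :&: Xb :&: Xa + Xd :&: Xc :&: Xa) < \dim (Xc :&: Xa))%N.
    rewrite ltn_neqAle dimvS // andbT; apply/negP => /eqP e.
    by apply: nca; rewrite -(geq_leqif (dimv_leqif_sup sca)) e.
  exact: count_overflow'.
exact: frames_quadruple_planar.
Qed.

End Quadruple.

                                     

(** * The points of the line as a basis, and the Lagrangian of a matching *)

Section Points.
Variables (F : fieldType) (n : nat).
Local Notation I := 'I_(n.*2).
Local Notation U := 'rV[F]_n.
Local Notation V := (U * U)%type.
Implicit Types (a b c : matching n) (i j p : I) (k : 'I_n).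

Fact half_point_subproof p : (p./2 < n)%N.
Proof. by rewrite ltn_half_double. Qed.
Definition half_point p : 'I_n := Ordinal (half_point_subproof p).

Fact even_point_subproof k : (k.*2 < n.*2)%N.
Proof. by rewrite ltn_double. Qed.
Definition even_point k : I := Ordinal (even_point_subproof k).

Fact odd_point_subproof k : (k.*2.+1 < n.*2)%N.
Proof. by rewrite ltn_Sdouble. Qed.
Definition odd_point k : I := Ordinal (odd_point_subproof k).

(** The segment from point 2k to point 2k+1 is black and carries the k-th coordinate. The black
    component names the black segment ending at p, the covector marks the black segments that begin
    before p; passing from 2k to 2k+1 adds the k-th covector. *)
Definition theta p : V := (delta_mx 0 (half_point p), \row_k (k.*2 < p)%N%:R).

Lemma pointP p : p = even_point (half_point p) \/ p = odd_point (half_point p).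
Proof.
have := odd_double_half p; case: (odd p) => e; [right | left]; apply: val_inj.
  exact: esym e.
exact: esym e.
Qed.

Lemma theta_even k : theta (even_point k) =
  blk (delta_mx 0 k) + \sum_(l < n | (l < k)%N) wht (delta_mx 0 l).
Proof.
apply: injective_projections => /=.
  rewrite (raddf_sum fst) big1 // addr0; congr delta_mx; apply: val_inj.
  by rewrite /= doubleK.
rewrite add0r (raddf_sum snd) (eq_bigr (fun l : 'I_n => delta_mx 0 l : U)) //.
apply/rowP => l; rewrite !mxE ltn_double summxE.
case: (ltnP l k) => lk.
  rewrite (bigD1 l) //= big1 => [|j /andP[_ jl]]; rewrite ?mxE ?eqxx ?addr0 //.
  by rewrite eq_sym (negPf jl).
rewrite big1 // => j jk; rewrite !mxE eqxx /=; case: eqP => // e.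
by move: jk; rewrite -e ltnNge lk.
Qed.

Lemma theta_odd k : theta (odd_point k) = theta (even_point k) + wht (delta_mx 0 k).
Proof.
apply: injective_projections => /=.
  rewrite addr0; congr delta_mx; apply: val_inj.
  by rewrite /= uphalf_double doubleK.
apply/rowP => l; rewrite !mxE ltn_double ltnS leq_double leq_eqVlt.
rewrite -[(l == k)]/(val l == val k); case: eqP => e /=; last by rewrite addr0.
by rewrite e ltnn add0r.
Qed.

Lemma theta_span : <<[seq theta p | p <- enum I]>>%VS = fullv.
Proof.
set S := <<_>>%VS.
have tS p : theta p \in S by rewrite memv_span // map_f ?mem_enum.
have wS k : wht (delta_mx 0 k) \in S.
  have -> : wht (delta_mx 0 k) = theta (odd_point k) - theta (even_point k).
    by rewrite theta_odd addrC addKr.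
  exact: memvB.
have bS k : blk (delta_mx 0 k) \in S.
  have -> : blk (delta_mx 0 k) = theta (even_point k) -
      \sum_(l < n | (l < k)%N) wht (delta_mx 0 l) by rewrite theta_even addrK.
  by rewrite memvB // memv_suml.
apply/vspaceP => v; rewrite memvf [v]blk_wht memvD //.
  rewrite (row_sum_delta v.1) raddf_sum /= memv_suml // => k _.
  by rewrite blkZ memvZ.
by rewrite (row_sum_delta v.2) raddf_sum /= memv_suml // => k _; rewrite whtZ memvZ.
Qed.

Section Lift.
Variables (A : lmodType F) (g : I -> A).

Let lift_fun (v : V) : A :=
  \sum_k v.1 0 k *: (g (even_point k) -
     \sum_(l < n | (l < k)%N) (g (odd_point l) - g (even_point l))) +
  \sum_k v.2 0 k *: (g (odd_point k) - g (even_point k)).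

Fact lift_fun_linear : linear lift_fun.
Proof.
move=> x u v; rewrite /lift_fun scalerDr addrACA.
by congr (_ + _); rewrite scaler_sumr -big_split /=;
   apply: eq_bigr => k _; rewrite !mxE scalerDl scalerA.
Qed.

(** So [theta] is a basis: the black and white unit vectors are combinations of the [theta p], which
    prescribes [lift_fun]. *)
Lemma theta_lift : exists phi : {linear V -> A}, forall p, phi (theta p) = g p.
Proof.
pose phi : {linear V -> A} := HB.pack lift_fun
  (GRing.isLinear.Build _ _ _ _ lift_fun lift_fun_linear).
exists phi => p; rewrite -[LHS]/(lift_fun (theta p)) /lift_fun /=.
have delta_sum (k : 'I_n) (G : 'I_n -> A) : \sum_l (delta_mx 0 k : U) 0 l *: G l = G k.
  rewrite (bigD1 k) //= big1 => [|l /negPf lk]; rewrite mxE eqxx ?lk ?scale0r //.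
  by rewrite eqxx scale1r addr0.
have row_sum (G : 'I_n -> A) : \sum_l (\row_k (k.*2 < p)%N%:R : U) 0 l *: G l =
    \sum_(l < n | (l.*2 < p)%N) G l.
  rewrite [RHS]big_mkcond; apply: eq_bigr => l _; rewrite mxE.
  by case: ifP; rewrite ?scale1r ?scale0r.
rewrite delta_sum row_sum; case: (pointP p) => e.
  rewrite -e [X in _ + X](eq_bigl (fun l : 'I_n => (l < half_point p)%N)) ?subrK // => l.
  by rewrite [in LHS]e ltn_double.
have hp m : (m.*2 < p)%N = (m <= p./2)%N.
  have : odd p by rewrite e /= odd_double.
  by move: (val p) m; clear; lia.
rewrite [X in _ + X](bigD1 (half_point p)) /= ?hp //.
rewrite [X in _ + (_ + X)](eq_bigl (fun l : 'I_n => (l < half_point p)%N)); last first.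
  by move=> l; rewrite hp ltn_neqAle andbC.
by rewrite addrCA subrK -e subrK.
Qed.

End Lift.

Lemma odd_bool_eq p (q : I) : odd q = ~~ odd p -> (p < q)%N ->
  ((p./2.*2 < q)%N = true) * ((q./2.*2 < p)%N = false) * ((p./2.*2 < p)%N = odd p) *
  ((q./2.*2 < q)%N = ~~ odd p).
Proof.
move=> opq pq; have := odd_double_half p; have := odd_double_half q; move: pq.
rewrite opq; move: (val p) (val q) (odd p) (p./2) (q./2) => p' q' o k l; clear.
by case: o; rewrite -!muln2 => ? ? ?; repeat split; lia.
Qed.

Lemma half_ltE i j : i != j -> (i./2.*2 < j)%N = (i < j)%N.
Proof.
rewrite -val_eqE /=; have := odd_double_half i; move: (val i) (val j) (odd i) (i./2).
by move=> i' j' o k; clear; case: o; rewrite -!muln2; lia.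
Qed.

Definition black_space a : {vspace U} :=
  <<[seq (delta_mx 0 (half_point i) - delta_mx 0 (half_point (a i)) : U) | i <- enum I]>>.

Definition arc_vectors a : seq V := [seq theta i - theta (a i) | i <- enum I].

Lemma arc_vector_in a i : theta i - theta (a i) \in <<arc_vectors a>>%VS.
Proof. by apply: memv_span; apply/mapP; exists i; rewrite ?mem_enum. Qed.

Lemma dot_theta p k : dot (theta p).2 (delta_mx 0 k) = (k.*2 < p)%N%:R.
Proof.
rewrite dotE (bigD1 k) //= big1 => [|l /negPf lk]; rewrite !mxE eqxx ?lk ?mulr0 //.
by rewrite eqxx mulr1 addr0.
Qed.

                                                                                
                      
(** The covector of an arc marks the black segments between its ends, up to a convention at the
    ends. Another arc lies with both ends inside or both outside, so the pairing is 0; for the arc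
    itself the end conventions cancel. *)
Lemma arc_in_L a i : in_L (black_space a) (theta i - theta (a i)).
Proof.
wlog ltia : i / (i < a i)%N.
  move=> wh; have [|leai] := ltnP i (a i); first exact: wh.
  have [|h1 h2] := wh (a i); first by rewrite arcK ltn_neqAle leai andbT (inj_eq val_inj) arc_neq.
  move: (in_LZ (-1) (conj h1 h2)); rewrite arcK scaleN1r opprB; exact.
split; first by apply: memv_span; apply/mapP; exists i; rewrite ?mem_enum.
apply: perp_span => _ /mapP[j _ ->]; rewrite !(dotDl, dotDr, dotNl, dotNr) !dot_theta /=.
have [->|ji] := eqVneq j i.
  by rewrite !(odd_bool_eq (odd_arc _ _) ltia); case: (odd i) => /=; ring.
have [->|jai] := eqVneq j (a i).
  by rewrite arcK !(odd_bool_eq (odd_arc _ _) ltia); case: (odd i) => /=; ring.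
have aji : a j != i by apply: contraNneq jai => <-; rewrite arcK.
have ajai : a j != a i by rewrite (inj_eq (inv_inj (@arcK n a))).
rewrite !half_ltE //.
have btw : (i < j < a i)%N = (i < a j < a i)%N.
  apply/idP/idP => [/arc_noncrossing //|/arc_noncrossing]; by rewrite arcK.
rewrite -val_eqE in ji; rewrite -val_eqE in aji.
have e1 : (i < j)%N = ~~ (j < i)%N by rewrite -leqNgt ltn_neqAle eq_sym ji.
have e2 : (i < a j)%N = ~~ (a j < i)%N by rewrite -leqNgt ltn_neqAle eq_sym aji.
have i1 : (j < i)%N ==> (j < a i)%N by apply/implyP => h; apply: ltn_trans h ltia.
have i2 : (a j < i)%N ==> (a j < a i)%N by apply/implyP => h; apply: ltn_trans h ltia.
move: btw i1 i2; rewrite e1 e2; clear.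
by case: (j < i)%N; case: (a j < i)%N; case: (j < a i)%N; case: (a j < a i)%N => //= _ _ _; ring.
Qed.

Lemma dim_pair : \dim {:V} = n.*2.
Proof. by rewrite dimvf /dim /= /dim /= !mul1n addnn. Qed.

(** The arc vectors lie in a space of dimension at most n, and together with the [theta] of the n
    left ends they span all 2n dimensions. *)
Lemma L_arcs a : L_space (black_space a) <<arc_vectors a>>.
Proof.
have [K [hK dK]] := conormal_exists (black_space a) (black_space a).
rewrite addnC leq_add2l in dK.
have sK : (<<arc_vectors a>> <= K)%VS.
  apply/span_subvP => _ /mapP[i _ ->]; apply/hK; exact: arc_in_L.
suff -> : <<arc_vectors a>>%VS = K by [].
apply/eqP; rewrite -(geq_leqif (dimv_leqif_eq sK)); apply: leq_trans dK _.
pose S := <<[seq theta i | i <- enum (left_end a)]>>%VS.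
have fullE : (fullv <= <<arc_vectors a>> + S)%VS.
  rewrite -theta_span; apply/span_subvP => _ /mapP[i _ ->].
  have iS j : (j < a j)%N -> theta j \in S.
    by move=> h; apply: memv_span; apply/mapP; exists j; rewrite ?mem_enum.
  have [/iS h|leai] := ltnP i (a i); first by rewrite (subvP (addvSr _ _)).
  rewrite -[theta i](subrK (theta (a i))) memv_add ?arc_vector_in // iS // arcK.
  by rewrite ltn_neqAle leai andbT (inj_eq val_inj) arc_neq.
have := leq_trans (dimvS fullE) (dimv_add_leqif _ _); rewrite dim_pair.
have : (\dim S <= n)%N.
  by apply: leq_trans (dim_span _) _; rewrite size_map -cardE card_left_end.
move: (\dim S) (\dim <<arc_vectors a>>) => s d; clear; lia.
Qed.

End Points.

Lemma count_edges (n f e wca wcb wba mc mb ma mcb mba mca : nat) :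
  (f + mba + mcb = mb + mca -> wca + n = wcb + wba + e.*2 ->
   wcb + mc + mb = n + mcb.*2 -> wba + mb + ma = n + mba.*2 ->
   wca + mc + ma = n + mca.*2 -> f = e)%N.
Proof. lia. Qed.

(** * Circles, split edges and frames: counting and spanning *)

Section Counting.
Variables (F : fieldType) (n : nat).
Local Notation I := 'I_(n.*2).
Local Notation U := 'rV[F]_n.
Local Notation V := (U * U)%type.
Implicit Types (a b c : matching n) (i j p : I) (X Y : {vspace U}) (K : {vspace V}).

(** The conormal spaces of (X, Y) and of a pair of complements add up to everything, which forces
    equality in both upper bounds. *)
Lemma conormal_dim X Y K : (forall v, v \in K <-> v.1 \in X /\ perp Y v.2) ->
  (\dim K + \dim Y = \dim X + n)%N.
Proof.
move=> hK; have [K1 [hK1 dK1]] := conormal_exists X Y.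
have -> : K = K1 by apply/vspaceP => v; apply/idP/idP => [/hK/hK1|/hK1/hK].
have [K2 [hK2 dK2]] := conormal_exists (X^C) (Y^C).
have : (fullv <= K1 + K2)%VS.
  apply/subvP => v _.
  have : v.1 \in (X + X^C)%VS by rewrite addv_complf memvf.
  case/memv_addP=> x xX [x' x'X e1].
  have [w [w' [e2 wY w'Y]]] : exists w w', [/\ v.2 = w + w', perp Y w & perp (Y^C) w'].
    by apply: perp_cap; rewrite capv_compl => u; rewrite memv0 => /eqP->; rewrite dot0r.
  have -> : v = (x, w) + (x', w') by apply: injective_projections.
  by apply: memv_add; [apply/hK1 | apply/hK2].
move/dimvS; rewrite dim_pair => /leq_trans/(_ (dimv_add_leqif _ _)).
have := dimvS (subvf X); have := dimvS (subvf Y).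
move: dK2 dK1; rewrite !dimv_compl !dimvf /dim /= !mul1n.
move: (\dim K1) (\dim K2) (\dim X) (\dim Y); clear => k1 k2 x y; lia.
Qed.

Lemma class_mod (vT : vectType F) (Z : {vspace vT}) x y :
  (x - projv Z x == y - projv Z y) = (x - y \in Z).
Proof.
have -> : (x - projv Z x == y - projv Z y) = (projv Z (x - y) == x - y).
  rewrite linearB /= [RHS]eq_sym -[LHS]subr_eq0 -[RHS]subr_eq0 !opprB !addrA.
  by rewrite addrAC [X in X + _]addrAC [in RHS]addrAC.
by apply/eqP/idP => [<-|/projv_id //]; apply: memv_proj.
Qed.

(** A representative of the class modulo Z, so that statements on functions constant along arcs
    apply to classes of points. *)
Definition theta_mod (Z : {vspace V}) p : V := theta F p - projv Z (theta F p).

Lemma theta_modE Z p q : (theta_mod Z p == theta_mod Z q) = (theta F p - theta F q \in Z).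
Proof. exact: class_mod. Qed.

(** The circles index a basis of the quotient by L_b + L_a, whose dimension follows from the
    intersection: the meet of X_b and X_a plus the annihilator of their sum. *)
Lemma card_circles b a : (#|W b a| + \dim (black_space F b) + \dim (black_space F a) =
  n + (\dim (black_space F b :&: black_space F a)).*2)%N.
Proof.
have hb := @L_arcs F n b; have ha := @L_arcs F n a.
set Lb := <<arc_vectors F b>>%VS; set La := <<arc_vectors F a>>%VS.
have dW : (#|W b a| + \dim (Lb + La) = n.*2)%N.
  apply/eqP; rewrite eqn_leq; apply/andP; split.
    (* Sending a point to its circle is onto and kills the arcs, which bounds the number of circles
       above; below, one point per circle spans the quotient. *)
    have [phi hphi] := theta_lift (fun p => delta_mx 0 (enum_rank (circ b a p)) : 'rV[F]_#|W b a|).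
    have := limg_ker_dim (linfun phi) fullv; rewrite dim_pair capfv => <-.
    rewrite addnC leq_add //.
      apply: dimvS; rewrite subv_add; apply/andP; split; apply/span_subvP => _ /mapP[i _ ->];
        rewrite memv_ker lfunE /= linearB /= !hphi ?circ_f ?circ_g subrr //.
    apply: (@leq_trans (\dim (fullv : {vspace 'rV[F]_#|W b a|}))).
      by rewrite dimvf /dim /= mul1n.
    apply: dimvS; apply/subvP => v _; rewrite (row_sum_delta v) memv_suml // => k _.
    rewrite memvZ //; apply/memv_imgP.
    exists (theta F (val (enum_val k))); rewrite ?memvf // lfunE /= hphi.
    by rewrite val_circ enum_valK.
  pose S := <<[seq theta F (val u) | u <- enum (W b a)]>>%VS.
  have fullE : (fullv <= (Lb + La) + S)%VS.
    rewrite -theta_span; apply/span_subvP => _ /mapP[p _ ->].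
    rewrite -[theta F p](subrK (theta F (val (circ b a p)))) memv_add //; last first.
      by apply: memv_span; apply/mapP; exists (circ b a p); rewrite ?mem_enum.
    rewrite -theta_modE; apply/eqP/esym; apply: (circ_ind (F := theta_mod (Lb + La))) => i;
      apply/eqP; rewrite eq_sym theta_modE.
      by apply: (subvP (addvSl _ _)); apply: arc_vector_in.
    by apply: (subvP (addvSr _ _)); apply: arc_vector_in.
  have := leq_trans (dimvS fullE) (dimv_add_leqif _ _); rewrite dim_pair.
  have : (\dim S <= #|W b a|)%N.
    by apply: leq_trans (dim_span _) _; rewrite size_map -cardE.
  move: (\dim S) (\dim (Lb + La)) #|W b a|; clear => s d w; lia.
have hcap : forall v, v \in (Lb :&: La)%VS <->
    v.1 \in (black_space F b :&: black_space F a)%VS /\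
    perp (black_space F b + black_space F a) v.2.
  move=> v; rewrite !memv_cap; split.
    case/andP=> /hb[-> pb] /ha[-> pa]; split=> // _ /memv_addP[u ub [w wa ->]].
    by rewrite dotDr pb ?pa ?addr0.
  case=> /andP[vb va] p; apply/andP; split; [apply/hb | apply/ha]; split=> // u uX; apply: p.
    exact: (subvP (addvSl _ _)).
  exact: (subvP (addvSr _ _)).
have := dW; have := conormal_dim hcap; have := conormal_dim hb; have := conormal_dim ha.
have := dimv_sum_cap Lb La; have := dimv_sum_cap (black_space F b) (black_space F a).
move: (\dim (Lb + La)) (\dim (Lb :&: La)) (\dim Lb) (\dim La) #|W b a|.
move: (\dim (black_space F b + black_space F a)) (\dim (black_space F b :&: black_space F a)).
move: (\dim (black_space F b)) (\dim (black_space F a)); clear; lia.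
Qed.

Section Triple.
Variables (c b a : matching n) (C : cob_choice b).
Local Notation edges := (cob_edges c a C).

Definition edge_vectors : seq V := [seq theta F v.1 - theta F v.2 | v <- edges].

Lemma size_edges_frame (r : frame (black_space F c) (black_space F b) (black_space F a)) :
  size (fr_list r) = size edges.
Proof.
exact: (count_edges (size_fr_list r) (size_cob_edges c a C) (card_circles c b)
  (card_circles b a) (card_circles c a)).
Qed.

(** Each list spans L_b modulo L_c + L_a: the frame by [fr_span], the edges by [cob_edges_ind]
    applied to [theta_mod]; the lengths agree by counting circles. *)
Lemma edges_frame (r : frame (black_space F c) (black_space F b) (black_space F a)) :
  exists2 k, k != 0 &
    wed_rel (<<arc_vectors F c>> + <<arc_vectors F a>>) edge_vectors (fr_list r) k.
Proof.
have hc := @L_arcs F n c; have hb := @L_arcs F n b; have ha := @L_arcs F n a.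
apply: wed_rel_unit; first by rewrite size_map size_edges_frame.
  move=> v /fr_list_in_L /hb; apply/subvP/span_subvP => _ /mapP[i _ ->].
  set Z := (_ + _)%VS; rewrite -theta_modE eq_sym; apply/eqP.
  apply: (cob_edges_ind (C := C) (c := c) (a := a) (F := theta_mod Z)) => [j|j|e he];
    apply/eqP; rewrite 1?eq_sym theta_modE.
  - by rewrite (subvP (addvSr _ _)) // (subvP (addvSl _ _)) // arc_vector_in.
  - by rewrite (subvP (addvSr _ _)) // (subvP (addvSr _ _)) // arc_vector_in.
  - rewrite -opprB memvN; apply: (subvP (addvSl _ _)); apply: memv_span.
    by apply/mapP; exists e.
move=> _ /mapP[e he ->]; apply: fr_span => [u /ha|u /hc|].
- exact: (subvP (addvSr _ _)).
- exact: (subvP (addvSl _ _)).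
by rewrite (cob_edges_arc he); exact: arc_in_L.
Qed.

End Triple.

End Counting.

(** * Signs over the field with three elements and their lift to the integers *)

Section CircleMap.
Variables (F : fieldType) (n : nat) (d a : matching n).
Local Notation I := 'I_(n.*2).
Local Notation U := 'rV[F]_n.
Local Notation V := (U * U)%type.

(** The arcs of d and a are killed because both of their ends lie on one circle. This is the [phi]
    to which the comparison of frames is applied. *)
Lemma circle_map : exists phi : {linear V -> extr F (W d a)},
  [/\ forall v, phi v * phi v = 0,
      forall v, in_L (black_space F d) v -> phi v = 0,
      forall v, in_L (black_space F a) v -> phi v = 0 &
      forall p, phi (theta F p) = egen F (circ d a p)].
Proof.
have [phi hphi] := theta_lift (fun p : I => egen F (circ d a p)).
have kill (b : matching n) : (forall i, circ d a (b i) = circ d a i) ->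
    forall v, in_L (black_space F b) v -> phi v = 0.
  move=> hb v /(@L_arcs F n b) vb; rewrite -[LHS]mulr1; apply: kill_span vb.
  by move=> _ /mapP[i _ ->]; rewrite linearB /= !hphi hb subrr mul0r.
exists phi; split=> //; last 2 first.
- by apply: kill => i; exact: circ_f.
- by apply: kill => i; exact: circ_g.
have phiZ k v : phi (k *: v) = k *: phi v by exact: linearZ.
move=> v; pose X := [tuple theta F i | i < n.*2].
have vX : v \in <<X>>%VS by rewrite theta_span memvf.
rewrite (coord_span vX) raddf_sum /=.
rewrite (eq_bigr (fun i => coord X i v *: egen F (circ d a i))) ?egen_sum_sqr // => i _.
by rewrite phiZ (nth_map i) ?size_enum_ord // nth_ord_enum hphi.
Qed.

End CircleMap.

Lemma fr_vol_neq0 (F : fieldType) (n : nat) (Xc Xb Xa : {vspace 'rV[F]_n})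
    (r : frame Xc Xb Xa) : fr_vol r != 0.
Proof.
rewrite /fr_vol !mulf_neq0 ?signr_eq0 ?vol_neq0 //.
- exact: fr_b.
- exact: fr_ba.
- exact: fr_cb.
- exact: fr_ca.
Qed.

Lemma F3_sqr (k : 'F_3) : k != 0 -> k * k = 1.
Proof. by case: k => -[|[|[|k]]] //= h _; apply: val_inj. Qed.

Lemma F3_pm1 (k : 'F_3) : k != 0 -> k = (-1) ^+ (k != 1).
Proof. by case: k => -[|[|[|k]]] //= h _; apply: val_inj. Qed.

Lemma int_trit (u : int) : `|u| <= 1 -> [\/ u = 0, u = 1 | u = -1].
Proof. by case: u => -[|[|u]] //= _; [constructor 1 | constructor 2 | constructor 3]. Qed.

Lemma trit_lift (u v : int) (b : bool) : `|u| <= 1 -> `|v| <= 1 ->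
  u%:~R = (-1) ^+ b * v%:~R :> 'F_3 -> u = (-1) ^+ b * v.
Proof.
by case: b; case/int_trit=> ->; case/int_trit=> -> /eqP // _; apply/eqP.
Qed.

(** The integers 0, 1 and -1 are distinct modulo 3. *)
Lemma ext_trit_lift (T : finType) (u v : extr int T) (b : bool) :
  (forall A, `|u A| <= 1) -> (forall A, `|v A| <= 1) ->
  ecoef (intmul 1 : {rmorphism int -> 'F_3}) u =
    (-1) ^+ b *: ecoef (intmul 1 : {rmorphism int -> 'F_3}) v ->
  u = (-1) ^+ b *: v.
Proof.
move=> u1 v1 /ffunP e; apply/ffunP => A; have := e A; rewrite !ffunE.
exact: trit_lift.
Qed.

Lemma sign_scale_eq (R : comNzRingType) (M : lmodType R) (k l : nat) (x y : M) :
  (-1) ^+ k *: x = (-1) ^+ l *: y <-> x = (-1) ^+ odd (k + l) *: y.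
Proof.
rewrite signr_odd exprD -scalerA; split=> [<-|->]; by rewrite signrZK.
Qed.

Lemma scale_mul4 (R : comNzRingType) (A : algType R) (k1 k2 k3 k4 k : R) (x y z w : A) :
  k1 *: x * (k2 *: y) = k *: (k3 *: z * (k4 *: w)) ->
  (k1 * k2) *: (x * y) = (k * (k3 * k4)) *: (z * w).
Proof. by rewrite -!scalerAl -!scalerAr !scalerA mulrA. Qed.

Lemma edge_product_coef (n : nat) (d a : matching n) (s t : seq ('I_(n.*2) * 'I_(n.*2))) A :
  `|emap (circ d a) (\prod_(v <- s) (egen int v.1 - egen int v.2) *
                    \prod_(v <- t) (egen int v.1 - egen int v.2)) A| <= 1.
Proof.
rewrite -big_cat emap_prod /=.
rewrite (eq_bigr (fun v => egen int (circ d a v.1) - egen int (circ d a v.2))).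
  have := prod_edge_coef [seq (circ d a v.1, circ d a v.2) | v <- s ++ t] A.
  by rewrite big_map.
by move=> v _; rewrite raddfB /= !emap_gen.
Qed.

Section Signs.
Variables (n : nat) (C : choices n).
Implicit Types (d c b a : matching n).
Local Notation F := 'F_3.
Local Notation X := (black_space 'F_3).
Local Notation edges c b a := (cob_edges c a (C c b a)).

Lemma edge_scalar_exists c b a : exists k : F, k != 0 /\
  exists r : frame (X c) (X b) (X a),
  forall (A : algType F) (phi : {linear ('rV[F]_n * 'rV[F]_n)%type -> A}) (x : A),
    (forall v, phi v * phi v = 0) ->
    (forall v, in_L (X c) v -> phi v * x = 0) ->
    (forall v, in_L (X a) v -> phi v * x = 0) ->
    fr_vol r *: wed phi (fr_list r) * x = k *: wed phi (edge_vectors F c a (C c b a)) * x.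
Proof.
have [r _] := frame_exists (X c) (X b) (X a).
have [k k0 hk] := edges_frame (C c b a) r.
exists (fr_vol r * k); split; first by rewrite mulf_neq0 // fr_vol_neq0.
exists r => A phi x phi2 kc ka; rewrite -!scalerAl (hk A phi x) // ?scalerA //.
move=> v /memv_addP[u /(@L_arcs F n c) uc [w /(@L_arcs F n a) wa ->]].
by rewrite raddfD mulrDl kc ?ka ?addr0.
Qed.

Lemma edge_scalar_quadruple : exists eta : matching n -> matching n -> matching n -> F,
  (forall c b a, eta c b a != 0) /\
  forall d c b a (A : algType F) (phi : {linear ('rV[F]_n * 'rV[F]_n)%type -> A})
      (E : matching n -> matching n -> matching n -> A),
    (forall v, phi v * phi v = 0) ->
    (forall v, in_L (X d) v -> phi v = 0) ->
    (forall v, in_L (X a) v -> phi v = 0) ->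
    (forall c b a, wed phi (edge_vectors F c a (C c b a)) = E c b a) ->
    (eta d c b * eta d b a) *: (E d c b * E d b a) =
    ((-1) ^+ (size (edges c b a) * (\dim (X c) - \dim (X d :&: X c))) *
      (eta c b a * eta d c a)) *: (E c b a * E d c a).
Proof.
have [eta heta] := fin_all_exists (fun p : matching n * matching n * matching n =>
   edge_scalar_exists p.1.1 p.1.2 p.2).
exists (fun c b a => eta (c, b, a)); split=> [c b a|].
  by have [] := heta (c, b, a).
move=> d c b a A phi E phi2 phid phia hE; apply: scale_mul4; rewrite -!hE.
have [_ [r1 h1]] := heta (d, c, b); have [_ [r2 h2]] := heta (d, b, a).
have [_ [r3 h3]] := heta (c, b, a); have [_ [r4 h4]] := heta (d, c, a).
have := frames_quadruple F3_sqr phi2 phid phia r1 r2 r3 r4.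
have e2 : fr_vol r2 *: wed phi (fr_list r2) =
    eta (d, b, a) *: wed phi (edge_vectors F d a (C d b a)).
  rewrite -[LHS]mulr1 -[RHS]mulr1; apply: (h2 A phi 1 phi2) => v.
    by move/phid->; rewrite mul0r.
  by move/phia->; rewrite mul0r.
have e4 : fr_vol r4 *: wed phi (fr_list r4) =
    eta (d, c, a) *: wed phi (edge_vectors F d a (C d c a)).
  rewrite -[LHS]mulr1 -[RHS]mulr1; apply: (h4 A phi 1 phi2) => v.
    by move/phid->; rewrite mul0r.
  by move/phia->; rewrite mul0r.
have k2 v : in_L (X b) v -> phi v * (fr_vol r2 *: wed phi (fr_list r2)) = 0.
  move=> vb; rewrite -scalerAr -[wed _ _]mulr1 fr_kill ?scaler0 // => u.
    by move/phid->; rewrite mul0r.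
  by move/phia->; rewrite mul0r.
have k4 v : in_L (X c) v -> phi v * (fr_vol r4 *: wed phi (fr_list r4)) = 0.
  move=> vb; rewrite -scalerAr -[wed _ _]mulr1 fr_kill ?scaler0 // => u.
    by move/phid->; rewrite mul0r.
  by move/phia->; rewrite mul0r.
rewrite (h1 A phi _ phi2 _ k2); last by move=> v /phid ->; rewrite mul0r.
rewrite (h3 A phi _ phi2 k4); last by move=> v /phia ->; rewrite mul0r.
by rewrite e2 e4 (size_edges_frame (C c b a) r3).
Qed.

Definition edge_prod c b a : extr int 'I_(n.*2) :=
  \prod_(v <- edges c b a) (egen int v.1 - egen int v.2).

Lemma wed_edge_vectors d e c b a
    (phi : {linear ('rV[F]_n * 'rV[F]_n)%type -> extr F (W d e)}) :
  (forall p, phi (theta F p) = egen F (circ d e p)) ->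
  wed phi (edge_vectors F c a (C c b a)) =
  ecoef (intmul 1 : {rmorphism int -> 'F_3}) (emap (circ d e) (edge_prod c b a)).
Proof.
move=> hphi; rewrite emap_prod rmorph_prod /wed big_map; apply: eq_bigr => v _.
by rewrite !raddfB /= !hphi !emap_gen /egen !ecoef_basis.
Qed.

(** The bit h says whether the scalar in F_3 relating edges and normalised frame is -1. The identity
    holds modulo 3 by [frames_quadruple] and lifts because both sides have coefficients 0, 1 and
    -1. *)
Lemma edge_prod_quadruple : exists h : matching n -> matching n -> matching n -> bool,
  forall d c b a,
  (-1) ^+ (h d c b + h d b a) *: emap (circ d a) (edge_prod d c b * edge_prod d b a) =
  (-1) ^+ (h c b a + h d c a + size (edges c b a) * (\dim (X c) - \dim (X d :&: X c))) *:
    emap (circ d a) (edge_prod c b a * edge_prod d c a).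
Proof.
have [eta [eta0 heta]] := edge_scalar_quadruple.
exists (fun c b a => eta c b a != 1) => d c b a.
have [phi [phi2 phid phia hphi]] := circle_map F d a.
have ecoefM (x y : extr int 'I_(n.*2)) :
    ecoef (intmul 1 : {rmorphism int -> 'F_3}) (emap (circ d a) (x * y)) =
    ecoef (intmul 1 : {rmorphism int -> 'F_3}) (emap (circ d a) x) *
      ecoef (intmul 1 : {rmorphism int -> 'F_3}) (emap (circ d a) y).
  by rewrite emapM rmorphM.
have h := heta d c b a _ phi _ phi2 phid phia (fun c b a => wed_edge_vectors c b a hphi).
have := etrans (congr1 (fun z => _ *: z) (ecoefM (edge_prod d c b) (edge_prod d b a)))
  (etrans h (congr1 (fun z => _ *: z) (esym (ecoefM (edge_prod c b a) (edge_prod d c a))))).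
move=> {h}.

rewrite (F3_pm1 (eta0 d c b)) (F3_pm1 (eta0 d b a)).
rewrite (F3_pm1 (eta0 c b a)) (F3_pm1 (eta0 d c a)) -!exprD.
move/sign_scale_eq/ext_trit_lift => e; apply/sign_scale_eq.
rewrite [LHS]e; first last.
- exact: edge_product_coef.
- exact: edge_product_coef.
congr (_ ^+ nat_of_bool (odd _) *: _).
by rewrite [X in (_ + X)%N]addnC -!F3_pm1.

Qed.

End Signs.

              

(** * The associator sign of the block product and the cochain correcting it *)

Lemma bin2D k l : 'C(k + l, 2) = ('C(k, 2) + 'C(l, 2) + k * l)%N.
Proof.
elim: k => [|k IH]; first by rewrite bin0n mul0n addn0.
rewrite addSn !binS !bin1 IH mulSn.
by move: 'C(k, 2) 'C(l, 2) (k * l)%N => x y z; lia.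
Qed.

(** Here a1, ..., a4 count the splits for dcb, dba, cba, dca, and u, v, w are [mu] at dc, cb, db.
    The binomials absorb a1 a2 and a3 a4, as both pairs have the same sum; the term (k + mu) l
    absorbs a3 k and a3 u. *)
Lemma assoc_parity (h1 h2 h3 h4 a1 a2 a3 a4 k l m u v w : nat) :
  (a1 + w = u + v -> a1 + a2 = a3 + a4 ->
  odd ((h1 + h2) + (h3 + h4 + a3 * u)) =
  odd (((h1 + 'C(a1, 2) + (k + u) * l) + (h2 + 'C(a2, 2) + (k + l + a1 + w) * m) + a1 * a2) +
       ((h3 + 'C(a3, 2) + (l + v) * m) + (h4 + 'C(a4, 2) + (k + u) * (l + m + a3)) +
         (a3 * k + a3 * a4))))%N.
Proof.
move=> e1 e2.
have e3 : ('C(a1, 2) + 'C(a2, 2) + a1 * a2 = 'C(a3, 2) + 'C(a4, 2) + a3 * a4)%N.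
  by rewrite -!bin2D e2.
have -> : (k + l + a1 + w = k + l + u + v)%N by rewrite -addnA e1 addnA.
move: e3; move: 'C(a1, 2) 'C(a2, 2) 'C(a3, 2) 'C(a4, 2) => c1 c2 c3 c4 e3.
rewrite [in RHS](_ : _ + _ = h1 + h2 + (h3 + h4 + a3 * u) +
  (c3 + c4 + a3 * a4 + (k + u) * l + (k + u) * m + (l + v) * m + a3 * k).*2)%N.
  by rewrite [RHS]oddD odd_double addbF.
by move: e3; clear; rewrite -addnn; lia.
Qed.

Lemma count_mu (f cb dc db mc mb : nat) :
  (f + cb + dc = mc + db -> cb <= mb -> dc <= mc -> db <= mb ->
   f + (mb - db) = mc - dc + (mb - cb))%N.
Proof. lia. Qed.

Lemma linear_expand (R : comNzRingType) (T : finType) (M : lmodType R)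
    (f : extr R T -> M) (x : extr R T) :
  linear f -> f x = \sum_U x U *: f (ebasis R U).
Proof.
move=> lf; pose g : {linear extr R T -> M} := HB.pack f (GRing.isLinear.Build _ _ _ _ f lf).
rewrite -[f x]/(g x) {1}(ebasisE x) raddf_sum /=; apply: eq_bigr => U _.
by rewrite -[LHS]/(g (x U *: ebasis R U)) linearZ.
Qed.

Lemma linear_sandwichl (R : comNzRingType) (M N : lmodType R) (A : algType R)
  (f : {linear M -> A}) (g : {linear A -> N}) (u v : A) : linear (fun y => g (u * (f y * v))).
Proof. by move=> k x y; rewrite linearP mulrDl mulrDr -scalerAl -scalerAr linearP. Qed.

Lemma linear_sandwichr (R : comNzRingType) (M N : lmodType R) (A : algType R)
  (f : {linear M -> A}) (g : {linear A -> N}) (u v : A) : linear (fun y => g (u * (v * f y))).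
Proof. by move=> k x y; rewrite linearP !mulrDr -!scalerAr linearP. Qed.

Lemma reorder_left (R : comNzRingType) (A : algType R) (k : R) (u v x y z : A) :
  v * u = k *: (u * v) -> v * (u * (x * y) * z) = k *: (u * v * (x * y * z)).
Proof. by move=> e; rewrite !mulrA e -!scalerAl. Qed.

Lemma reorder_right (R : comNzRingType) (A : algType R) (k l : R) (u v x y z : A) :
  x * u = k *: (u * x) -> v * u = l *: (u * v) ->
  v * (x * (u * (y * z))) = (k * l) *: (u * v * (x * y * z)).
Proof.
move=> e1 e2; rewrite [x * (u * _)]mulrA e1 -scalerAl -scalerAr.
by rewrite -[u * x * _]mulrA [v * (u * _)]mulrA e2 -scalerAl scalerA !mulrA.
Qed.

Lemma sign_conclude (R : comNzRingType) (A : algType R) (i j k l k' l' : nat) (x y z : A) :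
  (-1) ^+ i *: x = (-1) ^+ j *: y -> odd (i + j) = odd ((k + l) + (k' + l')) ->
  (-1) ^+ k *: ((-1) ^+ l *: (x * z)) = (-1) ^+ k' *: ((-1) ^+ l' *: (y * z)).
Proof.
move=> /sign_scale_eq-> e; rewrite !scalerA -!exprD; apply/sign_scale_eq.
by rewrite -scalerAl e.
Qed.

Lemma count_assoc (s1 s2 s3 s4 dc cb db ba da ca : nat) :
  (s1 + db = dc + cb -> s2 + da = db + ba -> s3 + ca = cb + ba -> s4 + da = dc + ca ->
   s1 + s2 = s3 + s4)%N.
Proof. lia. Qed.

Lemma emapZ (R : comNzRingType) (T T' : finType) (f : T -> T') k (x : extr R T) :
  emap f (k *: x) = k *: emap f x.
Proof. exact: linearZ. Qed.

Section BlockProduct.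
Variables (n : nat) (C : choices n).
Implicit Types (d c b a : matching n).
Local Notation X := (black_space 'F_3).
Local Notation s c b a := (size (cob_edges c a (C c b a))).

(** A 1-cochain with the number of splits as coboundary ([size_edges_mu]); it also appears in the
    sign of [frames_quadruple]. *)
Definition mu d c : nat := \dim (X c) - \dim (X d :&: X c).

Lemma size_edges_mu d c b : (s d c b + mu d b = mu d c + mu c b)%N.
Proof.
have [r _] := frame_exists (X d) (X c) (X b).
have e := size_fr_list r; rewrite (size_edges_frame (C d c b) r) in e.
exact: count_mu e (dimvS (capvSr _ _)) (dimvS (capvSr _ _)) (dimvS (capvSr _ _)).
Qed.

Definition bmul c b a (x : extr int (W c b)) (y : extr int (W b a)) : extr int (W c a) :=
  OFcob (C c b a) (stack x y).

Lemma emap_lift c b (x : extr int (W c b)) : emap (circ c b) (emap val x) = x.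
Proof.
rewrite emap_comp -[RHS]emap_id; apply: eq_emap => u /=; exact: (val_circ u).
Qed.

Lemma bmulE c b a Y Z : bmul (emap (circ c b) Y) (emap (circ b a) Z) =
  emap (circ c a) (edge_prod C c b a * (Y * Z)).
Proof. exact: OFcobE. Qed.

Lemma bmul_lift c b a (x : extr int (W c b)) (y : extr int (W b a)) :
  bmul x y = emap (circ c a) (edge_prod C c b a * (emap val x * emap val y)).
Proof. by rewrite -[x in LHS]emap_lift -[y in LHS]emap_lift bmulE. Qed.

Lemma homog_bmul c b a k l (x : extr int (W c b)) (y : extr int (W b a)) :
  homog k x -> homog l y -> homog (k + l + s c b a) (bmul x y).
Proof.
move=> hx hy; rewrite bmul_lift addnC; apply: homog_emap; apply: homogM.
  by apply: homog_prod => v; apply: homogB; apply: homog_gen.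
exact: homogM (@homog_emap _ _ _ val _ _ hx) (@homog_emap _ _ _ val _ _ hy).
Qed.

Lemma bmul_expandl c b a (x : extr int (W c b)) (y : extr int (W b a)) :
  bmul x y = \sum_U x U *: bmul (ebasis int U) y.
Proof.
apply: etrans (bmul_lift x y) _; rewrite (linear_expand _ (linear_sandwichl _ _ _ _)).
by apply: eq_bigr => U _; congr (_ *: _); exact: esym (bmul_lift _ _).
Qed.

Lemma bmul_expandr c b a (x : extr int (W c b)) (y : extr int (W b a)) :
  bmul x y = \sum_U y U *: bmul x (ebasis int U).
Proof.
apply: etrans (bmul_lift x y) _; rewrite (linear_expand _ (linear_sandwichr _ _ _ _)).
by apply: eq_bigr => U _; congr (_ *: _); exact: esym (bmul_lift _ _).
Qed.

(** Moving the edge products to the front gives D_dcb D_dba xyz and D_cba D_dca xyz, at the cost of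
    the signs s_dcb s_dba and s_cba k + s_cba s_dca; [edge_prod_quadruple] compares the two. The
    exponent t uses that the degree of a product is the sum of the degrees plus the number of
    splits. *)
Lemma bmul_assoc : exists h : matching n -> matching n -> matching n -> bool,
  let t d c b k l := (h d c b + 'C(s d c b, 2) + (k + mu d c) * l)%N in
  forall d c b a k l m (x : extr int (W d c)) (y : extr int (W c b)) (z : extr int (W b a)),
  homog k x -> homog l y -> homog m z ->
  (-1) ^+ (t d c b k l + t d b a (k + l + s d c b)%N m) *: bmul (bmul x y) z =
  (-1) ^+ (t c b a l m + t d c a k (l + m + s c b a)%N) *: bmul x (bmul y z).
Proof.
have [h hh] := edge_prod_quadruple C; exists h => t d c b a k l m x y z hx hy hz.
have hD c' b' a' : homog (s c' b' a') (edge_prod C c' b' a').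
  by apply: homog_prod => v; apply: homogB; apply: homog_gen.
have eL : bmul (bmul x y) z = (-1) ^+ (s d c b * s d b a) *:
    (emap (circ d a) (edge_prod C d c b * edge_prod C d b a) *
     emap (circ d a) (emap val x * emap val y * emap val z)).
  apply: etrans (f_equal2 (@bmul d b a) (bmul_lift x y) (esym (emap_lift z))) _.
  apply: etrans (bmulE _ _ _ _ _) _.
  apply: etrans (congr1 (emap (circ d a)) (reorder_left _ _ _ (homogC (hD d c b) (hD d b a)))) _.
  by rewrite emapZ; congr (_ *: _); exact: emapM.
have eR : bmul x (bmul y z) = ((-1) ^+ (s c b a * k) * (-1) ^+ (s c b a * s d c a)) *:
    (emap (circ d a) (edge_prod C c b a * edge_prod C d c a) *
     emap (circ d a) (emap val x * emap val y * emap val z)).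
  apply: etrans (f_equal2 (@bmul d c a) (esym (emap_lift x)) (bmul_lift y z)) _.
  apply: etrans (bmulE _ _ _ _ _) _.
  have hX := @homog_emap _ _ _ val _ _ hx.
  apply: etrans (congr1 (emap (circ d a)) (reorder_right _ _
    (homogC (hD c b a) hX) (homogC (hD c b a) (hD d c a)))) _.
  by rewrite emapZ; congr (_ *: _); exact: emapM.
rewrite eL eR -exprD; apply: sign_conclude (hh d c b a) _.
apply: assoc_parity; first exact: size_edges_mu.
exact: count_assoc (size_edges_mu _ _ _) (size_edges_mu _ _ _) (size_edges_mu _ _ _)
  (size_edges_mu _ _ _).
Qed.

End BlockProduct.

(** * Structure constants of the twisted algebra *)

Lemma structure_constants_assoc (R : comNzRingType) (I : finType) (T : I -> I -> I -> R)
    (mul := fun x y : {ffun I -> R} => [ffun m => \sum_i \sum_j x i * y j * T i j m]) :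
  (forall i j k m, \sum_l T j k l * T i l m = \sum_l T i j l * T l k m) ->
  associative mul.
Proof.
move=> hT x y z; apply/ffunP => m; rewrite !ffunE.
transitivity (\sum_i \sum_j \sum_k x i * y j * z k * \sum_l T j k l * T i l m).
  apply: eq_bigr => i _.
  transitivity (\sum_l \sum_j \sum_k x i * y j * z k * (T j k l * T i l m)).
    apply: eq_bigr => l _; rewrite ffunE mulr_sumr mulr_suml; apply: eq_bigr => j _.
    by rewrite mulr_sumr mulr_suml; apply: eq_bigr => k _; ring.
  rewrite exchange_big; apply: eq_bigr => j _; rewrite exchange_big.
  by apply: eq_bigr => k _; rewrite mulr_sumr.
transitivity (\sum_l \sum_k \sum_i \sum_j x i * y j * z k * (T i j l * T l k m)).
  under [RHS]eq_bigr do rewrite exchange_big.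
  rewrite [RHS]exchange_big; apply: eq_bigr => i _.
  under [RHS]eq_bigr do rewrite exchange_big.
  rewrite [RHS]exchange_big; apply: eq_bigr => j _; rewrite [RHS]exchange_big.
  by apply: eq_bigr => k _; rewrite hT mulr_sumr.
apply: eq_bigr => l _; apply: eq_bigr => k _; rewrite ffunE !mulr_suml.
apply: eq_bigr => i _; rewrite !mulr_suml; apply: eq_bigr => j _; ring.
Qed.

Lemma gauss_i_sqr : gauss_i ^+ 2 = -1.
Proof. by apply: val_inj; rewrite /= -[RHS]sqrCi. Qed.

Lemma gauss_i_even (t : nat) : gauss_i ^+ ((2 * t)%:R : 'Z_4) = (-1) ^+ t.
Proof.
rewrite val_Zp_nat // expr_mod; first by rewrite exprM gauss_i_sqr.
by rewrite -[4%N]/(2 * 2)%N exprM gauss_i_sqr sqrrN expr1n.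
Qed.

Lemma sum_tagged (R : nmodType) (J : finType) (T : J -> finType) (j : J) (f : {j & T j} -> R) :
  (forall l, tag l != j -> f l = 0) -> \sum_l f l = \sum_(u : T j) f (Tagged T u).
Proof.
move=> f0; rewrite (eq_bigr (fun l => f (Tagged T (tagged l)))) => [|[] //].
rewrite -(sig_big_dep predT (fun _ => predT) (fun i (u : T i) => f (Tagged T u))) /=.
rewrite (bigD1 j) //= [X in _ + X]big1 ?addr0 // => i ij.
by rewrite big1 // => u _; apply: f0.
Qed.

Lemma basis_elt_sum (R : pzRingType) (T : finType) (i j : T) (G : T -> T -> R) :
  \sum_k \sum_l basis_elt R i k * basis_elt R j l * G k l = G i j.
Proof.
rewrite (bigD1 i) //= [X in _ + X]big1 ?addr0 => [|k /negPf ki]; last first.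
  by rewrite big1 // => l _; rewrite !ffunE ki !mul0r.
rewrite (bigD1 j) //= big1 ?addr0 => [|l /negPf lj].
  by rewrite !ffunE !eqxx !mul1r.
by rewrite !ffunE lj mulr0 mul0r.
Qed.

Lemma scale_coef (R : comNzRingType) (T : finType) (k : R) (x : extr R T) V :
  (k *: x) V = k * x V.
Proof. by rewrite ffunE. Qed.

Lemma sum_scale_coef (R : comNzRingType) (T J : finType) (k : J -> R) (x : J -> extr R T) V :
  (\sum_j k j *: x j) V = \sum_j k j * x j V.
Proof. by rewrite sum_ffunE; apply: eq_bigr => j _; rewrite ffunE. Qed.

Lemma sign_term (q r : int) (e1 e2 e2' : nat) : (q != 0 -> e2 = e2') ->
  (-1) ^+ e1 * q * ((-1) ^+ e2 * r) = (-1) ^+ (e1 + e2') * (q * r).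
Proof.
have [-> _|_ -> //] := eqVneq q 0; first by rewrite mulr0 !mul0r mulr0.
by rewrite exprD; ring.
Qed.

Section Structure.
Variables (n : nat) (C : choices n).
Implicit Types (d c b a : matching n).

Lemma OHblock_elt c b (A : {set W c b}) :
  OHblock c b (basis_elt int (OHelt A)) = ebasis int A.
Proof.
apply/ffunP => B; rewrite !ffunE /OHelt; congr ((nat_of_bool _)%:R).
by apply/eqP/eqP => [/eqP|-> //]; rewrite eq_Tagged => /eqP.
Qed.

Lemma OHblock_other c b (J : OHbasis n) : tag J != (c, b) ->
  OHblock c b (basis_elt int J) = (0 : extr int (W c b)).
Proof.
move=> Jcb; apply/ffunP => B; rewrite !ffunE.
by case: eqP => // e; rewrite -e eqxx in Jcb.
Qed.

Lemma bmul0r c b a (y : extr int (W b a)) U : bmul C (0 : extr int (W c b)) y U = 0.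
Proof. by rewrite bmul_expandl big1 => [|V _]; rewrite ffunE ?scale0r. Qed.

Lemma bmulr0 c b a (x : extr int (W c b)) U : bmul C x (0 : extr int (W b a)) U = 0.
Proof. by rewrite bmul_expandr big1 => [|V _]; rewrite ffunE ?scale0r. Qed.

Lemma OHmul_elt d c b (A : {set W d c}) (B : {set W c b}) (U : {set W d b}) :
  OHmul C (basis_elt int (OHelt A)) (basis_elt int (OHelt B)) (OHelt U) =
  bmul C (ebasis int A) (ebasis int B) U.
Proof.
rewrite ffunE /= (bigD1 c) //= big1 => [|e ec].
  by rewrite !OHblock_elt addr0.
rewrite (OHblock_other (c := d) (b := e)) /=; last by rewrite xpair_eqE eqxx eq_sym.
exact: bmul0r.
Qed.

Lemma OHmul_other d c b (A : {set W d c}) (B : {set W c b}) (L : OHbasis n) :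
  tag L != (d, b) ->
  OHmul C (basis_elt int (OHelt A)) (basis_elt int (OHelt B)) L = 0.
Proof.
case: L => [[d' b'] U] /= Ldb; rewrite ffunE /= big1 // => e _.
have [dd|nd] := eqVneq d' d.
  rewrite (OHblock_other (c := e) (b := b')) /=; last first.
    by apply: contraNneq Ldb => -[_ ->]; rewrite dd.
  exact: bmulr0.
rewrite (OHblock_other (c := d') (b := e)) /=; last by rewrite xpair_eqE eq_sym (negPf nd).
exact: bmul0r.
Qed.

Lemma OHgauss_mul_elt (I J K : OHbasis n) :
  OHgauss_mul C (basis_elt gaussInt I) (basis_elt gaussInt J) K =
  (OHmul C (basis_elt int I) (basis_elt int J) K)%:~R.
Proof.
apply: etrans (ffunE _ _) _.
exact: (basis_elt_sum I J (fun I J => (OHmul C (basis_elt int I) (basis_elt int J) K)%:~R)).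
Qed.

(** Inverts the shift in [OHdeg]: the twist sees only degrees in the groupoid and in Z and must
    recover the exterior degree. *)
Definition degree_of d c (p : int) : nat := (absz (p + #|W d c|%:Z - n%:Z)%R)./2.

Lemma degree_ofE d c (A : {set W d c}) : degree_of d c (OHdeg (OHelt A)).2 = #|A|.
Proof.
rewrite /degree_of /OHdeg /=.
have -> : (#|A|.*2%:Z - #|W d c|%:Z + n%:Z + #|W d c|%:Z - n%:Z)%R = #|A|.*2%:Z.
  by ring.
by rewrite absz_nat doubleK.
Qed.

Variable h : matching n -> matching n -> matching n -> bool.

Definition twist_exponent d c b k l : nat :=
  (h d c b + 'C(size (cob_edges d b (C d c b)), 2) + (k + mu d c) * l)%N.

Definition twist_pair (x y : mor n) : nat :=
  twist_exponent (mor_tgt x) (mor_src x) (mor_src y)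
    (degree_of (mor_tgt x) (mor_src x) x.2) (degree_of (mor_tgt y) (mor_src y) y.2).

(** Only the values 0 and 2 occur, so the powers of i are signs ([gauss_i_even]). *)
Definition twist (p : N2 n) : 'Z_4 := (2 * twist_pair (val p).1 (val p).2)%:R.

Lemma twist_pair_elt d c b (A : {set W d c}) (B : {set W c b}) :
  twist_pair (OHdeg (OHelt A)) (OHdeg (OHelt B)) = twist_exponent d c b #|A| #|B|.
Proof. exact: (f_equal2 (twist_exponent d c b) (degree_ofE A) (degree_ofE B)). Qed.

Definition twisted_coef (I J K : OHbasis n) : gaussInt :=
  if insub (OHdeg I, OHdeg J) : option (N2 n) is Some p then
    gauss_i ^+ twist p * OHgauss_mul C (basis_elt gaussInt I) (basis_elt gaussInt J) K
  else 0.

Lemma twisted_coef_elt d c b (A : {set W d c}) (B : {set W c b}) (K : OHbasis n) :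
  twisted_coef (OHelt A) (OHelt B) K =
  ((-1) ^+ twist_exponent d c b #|A| #|B| *
     OHmul C (basis_elt int (OHelt A)) (basis_elt int (OHelt B)) K)%:~R.
Proof.
rewrite /twisted_coef insubT => [|p]; first by rewrite /mor_src /mor_tgt /=.
rewrite /twist SubK gauss_i_even OHgauss_mul_elt rmorphM rmorphXn rmorphN1.
by congr (_ ^+ _ * _); exact: twist_pair_elt.
Qed.

Lemma twisted_coef_incomposable (I J K : OHbasis n) :
  (tag I).2 != (tag J).1 -> twisted_coef I J K = 0.
Proof. by move=> IJ; rewrite /twisted_coef insubF //; apply: negbTE. Qed.

Lemma twisted_coef_block d c b (A : {set W d c}) (B : {set W c b}) (U : {set W d b}) :
  twisted_coef (OHelt A) (OHelt B) (OHelt U) =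
  ((-1) ^+ twist_exponent d c b #|A| #|B| * bmul C (ebasis int A) (ebasis int B) U)%:~R.
Proof. by rewrite twisted_coef_elt OHmul_elt. Qed.

Lemma twisted_coef_other d c b (A : {set W d c}) (B : {set W c b}) (K : OHbasis n) :
  tag K != (d, b) -> twisted_coef (OHelt A) (OHelt B) K = 0.
Proof. by move=> Kdb; rewrite twisted_coef_elt OHmul_other // mulr0. Qed.

Lemma OHeltP (I : OHbasis n) : exists d c (A : {set W d c}), I = OHelt A.
Proof. by case: I => [[d c] A]; exists d, c, A. Qed.

Lemma bmul_coefl c b a (x : extr int (W c b)) (y : extr int (W b a)) V :
  bmul C x y V = \sum_U x U * bmul C (ebasis int U) y V.
Proof.
exact: etrans (congr1 (fun z : extr int _ => z V) (bmul_expandl C x y))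
  (sum_scale_coef _ _ _).
Qed.

Lemma bmul_coefr c b a (x : extr int (W c b)) (y : extr int (W b a)) V :
  bmul C x y V = \sum_U y U * bmul C x (ebasis int U) V.
Proof.
exact: etrans (congr1 (fun z : extr int _ => z V) (bmul_expandr C x y))
  (sum_scale_coef _ _ _).
Qed.

Local Notation t := twist_exponent.
Local Notation s c b a := (size (cob_edges c a (C c b a))).

Hypothesis h_assoc : forall d c b a k l m
    (x : extr int (W d c)) (y : extr int (W c b)) (z : extr int (W b a)),
  homog k x -> homog l y -> homog m z ->
  (-1) ^+ (t d c b k l + t d b a (k + l + s d c b) m) *: bmul C (bmul C x y) z =
  (-1) ^+ (t c b a l m + t d c a k (l + m + s c b a)) *: bmul C x (bmul C y z).

(** Unless the three basis elements are composable and M lies in the resulting block, both sides are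
    0. Otherwise only one block contributes to each sum, and the identity is a coefficient of
    [h_assoc]. *)
Lemma twisted_coef_assoc (I J K M : OHbasis n) :
  \sum_L twisted_coef J K L * twisted_coef I L M =
  \sum_L twisted_coef I J L * twisted_coef L K M.
Proof.
have [d [c [A ->]]] := OHeltP I; have [c' [b [B ->]]] := OHeltP J.
have [b' [a [D ->]]] := OHeltP K; have [e [f [V ->]]] := OHeltP M.
have [eb|nb] := eqVneq b b'; last first.
  rewrite [LHS]big1 => [|L _].
    rewrite [RHS]big1 // => L _; have [ec|nc] := eqVneq c c'; last first.
      by rewrite (@twisted_coef_incomposable (OHelt A) (OHelt B) L nc) mul0r.
    subst c'; have [eL|nL] := eqVneq (tag L) (d, b); last first.
      by rewrite (twisted_coef_other A B nL) mul0r.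
    by rewrite (@twisted_coef_incomposable L (OHelt D)) ?mulr0 // eL.
  by rewrite (@twisted_coef_incomposable (OHelt B) (OHelt D) L nb) mul0r.
subst b'; have [ec|nc] := eqVneq c c'; last first.
  rewrite [RHS]big1 => [|L _].
    rewrite big1 // => L _; have [eL|nL] := eqVneq (tag L) (c', a); last first.
      by rewrite (twisted_coef_other B D nL) mul0r.
    by rewrite (@twisted_coef_incomposable (OHelt A) L) ?mulr0 // eL.
  by rewrite (@twisted_coef_incomposable (OHelt A) (OHelt B) L nc) mul0r.
subst c'.
rewrite [LHS](@sum_tagged _ _ _ (c, a)) => [|L nL]; last first.
  by rewrite (twisted_coef_other B D nL) mul0r.
rewrite [RHS](@sum_tagged _ _ _ (d, b)) => [|L nL]; last first.
  by rewrite (twisted_coef_other A B nL) mul0r.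
have [[ed ea]|nM] := eqVneq (e, f) (d, a); last first.
  rewrite [LHS]big1 => [|U _]; last by rewrite (@twisted_coef_other d c a A U (OHelt V) nM) mulr0.
  by rewrite [RHS]big1 // => U _; rewrite (@twisted_coef_other d b a U D (OHelt V) nM) mulr0.
subst e f.
have homB (T : finType) (Y : {set T}) : homog #|Y| (ebasis int Y) by apply: homog_basis.
have eL : \sum_(U : {set W d b}) twisted_coef (OHelt A) (OHelt B) (OHelt U) *
      twisted_coef (OHelt U) (OHelt D) (OHelt V) =
    ((-1) ^+ (t d c b #|A| #|B| + t d b a (#|A| + #|B| + s d c b) #|D|) *
       bmul C (bmul C (ebasis int A) (ebasis int B)) (ebasis int D) V)%:~R.
  rewrite bmul_coefl mulr_sumr rmorph_sum; apply: eq_bigr => U _ /=.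
  rewrite !twisted_coef_block -rmorphM; congr (_%:~R).
  (* The exponent depends on the cardinal of U, but the coefficient at U vanishes unless this is the
     degree of the product, so one sign comes out of the sum. *)
  apply: sign_term => qU; congr (t d b a _ _).
  exact: (homog_bmul (homB _ A) (homB _ B) qU).
have eR : \sum_(U : {set W c a}) twisted_coef (OHelt B) (OHelt D) (OHelt U) *
      twisted_coef (OHelt A) (OHelt U) (OHelt V) =
    ((-1) ^+ (t c b a #|B| #|D| + t d c a #|A| (#|B| + #|D| + s c b a)) *
       bmul C (ebasis int A) (bmul C (ebasis int B) (ebasis int D)) V)%:~R.
  rewrite bmul_coefr mulr_sumr rmorph_sum; apply: eq_bigr => U _ /=.
  rewrite !twisted_coef_block -rmorphM; congr (_%:~R).
  apply: sign_term => qU; congr (t d c a _ _).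
  exact: (homog_bmul (homB _ B) (homB _ D) qU).
have e0 := h_assoc (homB _ A) (homB _ B) (homB _ D).
apply: etrans eR (etrans _ (esym eL)); apply: (congr1 (intmul 1)).
apply: etrans (esym (scale_coef _ _ _)) _.
exact: etrans (congr1 (fun z : extr int (W d a) => z V) (esym e0)) (scale_coef _ _ _).
Qed.

End Structure.

Theorem theorem5p13 (n : nat) (C : choices n) :
  exists tau : N2 n -> 'Z_4, associative (twisted_mul C tau).
Proof.
have [h hh] := bmul_assoc C; exists (twist C h).
(* By its definition [twisted_mul] is the product with structure constants [twisted_coef]. *)
apply: (structure_constants_assoc (T := twisted_coef C h)) => I J K M.
exact: twisted_coef_assoc hh I J K M.
Qed.
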